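(* The set $$\bigl\{\bigl((\partial_{s_{(i_1,j_1)}}\cdots\partial_{s_{(i_r,j_r)}})\bullet F_{\mathcal N}(x,s)\bigr)_{|s=0}\ :\ r\ge0,\ i_1<\cdots<i_r,\ j_1>\cdots>j_r\bigr\},$$ where $1\le i_k<m$ and $m+1\le j_k<m+l$, forms a fundamental system of solutions to $M_A(0)$.
   Context: $\mathbb N=\{0,1,2,\dots\}$. Let $m,l$ be positive integers, $e_1,\dots,e_{m+l}$ the standard basis of $\mathbb Z^{m+l}$, and let $A$ be the matrix with columns $a_{i,j}=e_i+e_j$, $1\le i\le m$, $m+1\le j\le m+l$; coordinates (and variables $x_{i,j}$, $\partial_{i,j}$) are indexed by pairs $(i,j)$. $L=\{c=[c_{ij}]\in M_{m\times l}(\mathbb Z):\sum_{i,j}c_{ij}a_{i,j}=0\}$. $I_A=\langle\partial^u-\partial^{u'}:u,u'\text{ nonnegative integer vectors},\,Au=Au'\rangle$; $H_A(0)$ is the left ideal of the Weyl algebra in the $x_{i,j},\partial_{i,j}$ generated by $I_A$ and the Euler operators given by the rows of $A\theta$ ($\theta_{i,j}=x_{i,j}\partial_{i,j}$); $M_A(0)$ is the quotient of the Weyl algebra by $H_A(0)$. A fundamental system of solutions is a $\mathbb C$-basis of the solution space of $M_A(0)$. $w$ is a generic weight vector satisfying $w_{i,j}>w_{p,q}$ whenever $(i,j)\ne(p,q)$, $i\le p$, and $j\le q$. Then, with $E_{i,j}$ the matrix units and $g^{(i,j)}_{(p,q)}=E_{i,j}+E_{p,q}-E_{i,q}-E_{p,j}$,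 the reduced Gröbner basis of $I_A$ with respect to $w$ equals $\{\partial_{i,j}\partial_{p,q}-\partial_{i,q}\partial_{p,j}:i<p,\,j<q\}$, with initial terms $\partial_{i,j}\partial_{p,q}$, and $\mathrm{in}_w(I_A)=\langle\partial_{i,j}\partial_{p,q}:i<p,\,j<q\rangle$. Let $C(w)=\sum_{i<p,j<q}\mathbb N g^{(i,j)}_{(p,q)}$. $B=\{b^{(i,j)}=g^{(i,j)}_{(i+1,j+1)}:1\le i<m,\ m+1\le j<m+l\}$, a basis of $L$; $s=(s_{(i,j)})_{1\le i<m,\,m+1\le j<m+l}$ are indeterminates and $Bs=\sum s_{(i,j)}b^{(i,j)}$. For $u\in L$, write $u=u_+-u_-$ (nonnegative entries, disjoint supports) and $I_u=\{(i,j):u_{ij}<0\}$, the negative support of $v+u$ for $v=0$. $\mathcal N=\{I_u:u\in L,\text{ and every }u'\in L\text{ with }I_{u'}=I_u\text{ lies in }C(w)\}$, $L'=\{u\in L:I_u\in\mathcal N\}$. With $[y]_u=\prod_jy_j(y_j-1)\cdots(y_j-u_j+1)$, $$F_{\mathcal N}(x,s)=\sum_{u\in L'}\frac{[Bs]_{u_-}}{[Bs+u]_{u_+}}x^{Bs+u},$$ where $x^{Bs+u}$ is regarded as $x^u\exp\bigl(\sum(\log x_{i,j})(Bs)_{(i,j)}\bigr)$; differentiation in $s$ and evaluation at $s=0$ are termwise. *)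

(* Defs.v *)
From HB Require Import structures.
From mathcomp Require Import all_boot all_order all_algebra.
From mathcomp Require Import all_classical all_reals all_analysis.
From mathcomp Require Import complex.
From mathcomp Require mpoly.
Import -(notations) mpoly.
From mathcomp.analysis.showcase Require summability.

Set Implicit Arguments.
Unset Strict Implicit.
Unset Printing Implicit Defensive.

Import Order.TTheory GRing.Theory Num.Theory.
Import numFieldNormedType.Exports.

Local Open Scope classical_set_scope.
Local Open Scope ring_scope.
Local Open Scope complex_scope.

HB.instance Definition _ (R : realType) := NormedModule.copy R[i] (R[i])^o.

(* A has columns e_i + e_j with i in the first m.+1 and j in the last l.+1       *)
(* indices of Z^(m.+1 + l.+1): the positive sizes are m.+1 and l.+1, and         *)
(* vectors indexed by the pairs (i, j) are matrices, all indices starting at 0.  *)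

Definition acol (m l : nat) (i : 'I_m.+1) (j : 'I_l.+1) :
    'cV[int]_(m.+1 + l.+1) :=
  delta_mx (lshift l.+1 i) 0 + delta_mx (rshift m.+1 j) 0.

Definition Amul (m l : nat) (u : 'M[int]_(m.+1, l.+1)) :
    'cV[int]_(m.+1 + l.+1) :=
  \sum_i \sum_j u i j *: acol i j.

Definition Llat (m l : nat) : set 'M[int]_(m.+1, l.+1) :=
  [set u | Amul u = 0].

Definition gvec (m l : nat) (i : 'I_m.+1) (j : 'I_l.+1)
    (p : 'I_m.+1) (q : 'I_l.+1) : 'M[int]_(m.+1, l.+1) :=
  delta_mx i j + delta_mx p q - delta_mx i q - delta_mx p j.

(* k : 'I_m is seen in 'I_m.+1 as widen_ord _ k, its successor as lift ord0 k.  *)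
Definition bvec (m l : nat) (k : 'I_m) (h : 'I_l) : 'M[int]_(m.+1, l.+1) :=
  gvec (widen_ord (leqnSn m) k) (widen_ord (leqnSn l) h)
       (lift ord0 k) (lift ord0 h).

Definition Bmul (R : realType) (m l : nat) (s : 'M[R[i]]_(m, l)) :
    'M[R[i]]_(m.+1, l.+1) :=
  \sum_k \sum_h s k h *: map_mx intr (bvec k h).

(* C(w): the generators are read off the reduced Groebner basis of I_A for w,   *)
(* which consists of d_ij d_pq - d_iq d_pj with initial terms d_ij d_pq.        *)
Definition Ccone (m l : nat) : set 'M[int]_(m.+1, l.+1) :=
  [set u | exists c : 'I_m.+1 -> 'I_l.+1 -> 'I_m.+1 -> 'I_l.+1 -> nat,
     u = \sum_(i < m.+1) \sum_(j < l.+1) \sum_(p < m.+1 | (i < p)%N) \sum_(q < l.+1 | (j < q)%N)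
           gvec i j p q *+ c i j p q].

Definition nsupp (m l : nat) (u : 'M[int]_(m.+1, l.+1)) :
    {set 'I_m.+1 * 'I_l.+1} :=
  [set ij | u ij.1 ij.2 < 0]%SET.

Definition Nfam (m l : nat) : set {set 'I_m.+1 * 'I_l.+1} :=
  [set I | (exists2 u, Llat u & nsupp u = I) /\
     forall u', @Llat m l u' -> nsupp u' = I -> Ccone u'].

Definition Lprime (m l : nat) : set 'M[int]_(m.+1, l.+1) :=
  [set u | Llat u /\ Nfam (nsupp u)].

Definition pospart (m l : nat) (u : 'M[int]_(m, l)) : 'M[nat]_(m, l) :=
  map_mx (fun z : int => `|Num.max z 0|%N) u.

Definition negpart (m l : nat) (u : 'M[int]_(m, l)) : 'M[nat]_(m, l) :=
  pospart (- u).

Definition falling (R : realType) (m l : nat) (y : 'M[R[i]]_(m, l))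
    (u : 'M[nat]_(m, l)) : R[i] :=
  \prod_i \prod_j \prod_(k < u i j) (y i j - k%:R).

Definition cexp (R : realType) (z : R[i]) : R[i] :=
  (expR (complex.Re z))%:C * (cos (complex.Im z) +i* sin (complex.Im z)).

(* The term of F_N(x, s) at u; lgx stands for the matrix of the log x_ij, so     *)
(* that the last factor is exp(sum_ij log(x_ij) (Bs)_ij).                        *)
Definition Fterm (R : realType) (m l : nat) (x lgx : 'M[R[i]]_(m.+1, l.+1))
    (u : 'M[int]_(m.+1, l.+1)) (s : 'M[R[i]]_(m, l)) : R[i] :=
  falling (Bmul s) (negpart u)
    / falling (Bmul s + map_mx intr u) (pospart u)
  * ((\prod_i \prod_j x i j ^ u i j)
     * cexp (\sum_i \sum_j lgx i j * Bmul s i j)).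

Definition pderivs (R : realType) (a b : nat) (ds : seq ('I_a * 'I_b))
    (f : 'M[R[i]]_(a, b) -> R[i]) : 'M[R[i]]_(a, b) -> R[i] :=
  foldr (fun kh g => 'D_(delta_mx kh.1 kh.2) g) f ds.

(* Zero outside L', so that the sum over all integer matrices is the one over L'. *)
Definition dFterm (R : realType) (m l : nat)
    (lg : 'M[R[i]]_(m.+1, l.+1) -> 'M[R[i]]_(m.+1, l.+1))
    (sigma : seq ('I_m * 'I_l)) (x : 'M[R[i]]_(m.+1, l.+1))
    (u : 'M[int]_(m.+1, l.+1)) : R[i] :=
  if u \in @Lprime m l then pderivs sigma (Fterm x (lg x) u) 0 else 0.

Definition dF (R : realType) (m l : nat)
    (lg : 'M[R[i]]_(m.+1, l.+1) -> 'M[R[i]]_(m.+1, l.+1))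
    (sigma : seq ('I_m * 'I_l)) (x : 'M[R[i]]_(m.+1, l.+1)) : R[i] :=
  summability.sum (dFterm lg sigma x).

Definition sigma_index (m l : nat) (sigma : seq ('I_m * 'I_l)) : bool :=
  sorted [rel a b : 'I_m * 'I_l | (a.1 < b.1)%N && (b.2 < a.2)%N] sigma.

Definition ideal_gen (T : comNzRingType) (G : set T) : set T :=
  [set p | exists s : seq (T * T),
     (forall t, t \in s -> G t.2) /\ p = \sum_(t <- s) t.1 * t.2].

(* C[d] is the polynomial ring in (m.+1 * l.+1) variables, d_ij being the       *)
(* variable of index mxvec_index i j.                                           *)
Definition monom (m l : nat) (u : 'M[nat]_(m, l)) : multinom (m * l) :=
  Multinom [tuple mxvec u 0 k | k < m * l].

Definition toric_ideal (R : realType) (m l : nat) :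
    set (mpoly (m.+1 * l.+1) R[i]) :=
  ideal_gen [set p | exists u u' : 'M[nat]_(m.+1, l.+1),
    Amul (map_mx Posz u) = Amul (map_mx Posz u') /\
    p = mpolyX R[i] (monom u) - mpolyX R[i] (monom u')].

Definition weight (R : realType) (m l : nat) (w : 'M[R]_(m, l))
    (mu : multinom (m * l)) : R :=
  \sum_i \sum_j w i j * (fun_of_multinom mu (mxvec_index i j))%:R.

Definition initial_form (R : realType) (m l : nat) (w : 'M[R]_(m, l))
    (f : mpoly (m * l) R[i]) : mpoly (m * l) R[i] :=
  \sum_(mu <- msupp f
         | all (fun nu => weight w nu <= weight w mu) (msupp f))
     mcoeff mu f *: mpolyX R[i] mu.

Definition initial_ideal (R : realType) (m l : nat) (w : 'M[R]_(m, l))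
    (I : set (mpoly (m * l) R[i])) : set (mpoly (m * l) R[i]) :=
  ideal_gen [set initial_form w f | f in I].

Definition generic_weight (R : realType) (m l : nat)
    (w : 'M[R]_(m.+1, l.+1)) : Prop :=
  exists M : set (multinom (m.+1 * l.+1)),
    initial_ideal w (@toric_ideal R m l) =
    ideal_gen [set mpolyX R[i] mu | mu in M].

(* Expressions for the elements of the Weyl algebra in the x_ij, d_ij. The      *)
(* Weyl algebra is the quotient of these expressions by its defining relations; *)
(* the action on functions below factors through that quotient.                 *)
Inductive weyl (R : realType) (m l : nat) : Type :=
| Wcst of R[i]
| Wx of 'I_m & 'I_l
| Wd of 'I_m & 'I_l
| Wadd of weyl R m l & weyl R m l
| Wmul of weyl R m l & weyl R m l.
Arguments Wcst {R m l}.
Arguments Wx {R m l}.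
Arguments Wd {R m l}.

Fixpoint wact (R : realType) (m l : nat) (P : weyl R m l)
    (f : 'M[R[i]]_(m, l) -> R[i]) : 'M[R[i]]_(m, l) -> R[i] :=
  match P with
  | Wcst c => fun x => c * f x
  | Wx i j => fun x => x i j * f x
  | Wd i j => 'D_(delta_mx i j) f
  | Wadd P1 P2 => fun x => wact P1 f x + wact P2 f x
  | Wmul P1 P2 => wact P1 (wact P2 f)
  end.

Definition Wmonom (R : realType) (m l : nat)
    (mu : multinom (m * l)) : weyl R m l :=
  \big[@Wmul R m l/Wcst 1]_i \big[@Wmul R m l/Wcst 1]_j
    iter (fun_of_multinom mu (mxvec_index i j))
      (Wmul (Wd i j)) (Wcst 1).

Definition Wpoly (R : realType) (m l : nat)
    (p : mpoly (m * l) R[i]) : weyl R m l :=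
  \big[@Wadd R m l/Wcst 0]_(mu <- msupp p)
    Wmul (Wcst (mcoeff mu p)) (Wmonom R mu).

Definition Weuler (R : realType) (m l : nat) (r : 'I_(m.+1 + l.+1)) :
    weyl R m.+1 l.+1 :=
  \big[@Wadd R m.+1 l.+1/Wcst 0]_i \big[@Wadd R m.+1 l.+1/Wcst 0]_j
    Wmul (Wcst (acol i j r 0)%:~R) (Wmul (Wx i j) (Wd i j)).

Inductive HA (R : realType) (m l : nat) : weyl R m.+1 l.+1 -> Prop :=
| HA_toric p : toric_ideal p -> HA (Wpoly p)
| HA_euler r : HA (Weuler R r)
| HA_add P Q : HA P -> HA Q -> HA (Wadd P Q)
| HA_mul P Q : HA Q -> HA (Wmul P Q).

(* Functions all of whose iterated partial derivatives exist and are complex    *)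
(* differentiable on the open set U, i.e. holomorphic functions on U. This form *)
(* makes sure that 'D never takes a default value in the action of the Weyl     *)
(* algebra on U.                                                                *)
Definition holomorphic_on (R : realType) (m l : nat)
    (U : set 'M[R[i]]_(m, l)) (f : 'M[R[i]]_(m, l) -> R[i]) : Prop :=
  forall (ds : seq ('I_m * 'I_l)) x, U x -> differentiable (pderivs ds f) x.

Definition solution_on (R : realType) (m l : nat)
    (U : set 'M[R[i]]_(m.+1, l.+1))
    (f : 'M[R[i]]_(m.+1, l.+1) -> R[i]) : Prop :=
  holomorphic_on U f /\
  forall P, HA P -> forall x, U x -> wact P f x = 0.

(* The family (phi i), P i, is a basis of the space V of functions on U; two    *)
(* functions are identified when they coincide on U.                            *)
Definition basis_on (R : realType) (X : Type) (U : set X)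
    (V : (X -> R[i]) -> Prop) (I : eqType) (P : pred I)
    (phi : I -> X -> R[i]) : Prop :=
  [/\ forall i, P i -> V (phi i),
      forall (S : seq I) (c : I -> R[i]), uniq S -> all P S ->
        (forall x, U x -> \sum_(i <- S) c i * phi i x = 0) ->
        forall i, i \in S -> c i = 0
    & forall f, V f -> exists (S : seq I) (c : I -> R[i]), all P S /\
        forall x, U x -> f x = \sum_(i <- S) c i * phi i x].

Definition log_branch (R : realType) (m l : nat) (U : set 'M[R[i]]_(m, l))
    (lg : 'M[R[i]]_(m, l) -> 'M[R[i]]_(m, l)) : Prop :=
  {within U, continuous lg} /\
  forall x, U x -> forall i j, cexp (lg x i j) = x i j.

(* |x^g| < eps for all the generators g = g^(i,j)_(p,q) of C(w), in the form     *)
(* |x_ij x_pq| < eps |x_iq x_pj|: for eps small, the series in x with exponents *)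
(* in C(w) converge there.                                                      *)
Definition conv_domain (R : realType) (m l : nat) (eps : R) :
    set 'M[R[i]]_(m, l) :=
  [set x | forall (i p : 'I_m) (j q : 'I_l), (i < p)%N -> (j < q)%N ->
     `|x i j * x p q| < eps%:C * `|x i q * x p j|].

(* Main.v *)
Require Import Defs.
From HB Require Import structures.
From mathcomp Require Import all_boot all_order all_algebra.
From mathcomp Require Import all_classical all_reals all_analysis.
From mathcomp Require Import complex.
From mathcomp Require Import finmap ring lra zify.
From mathcomp Require mpoly.
Import -(notations) mpoly.
From mathcomp.analysis.showcase Require summability.

Set Implicit Arguments.
Unset Strict Implicit.
Unset Printing Implicit Defensive.

Import Order.TTheory GRing.Theory Num.Theory.
Import numFieldNormedType.Exports.

Local Open Scope classical_set_scope.
Local Open Scope ring_scope.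
Local Open Scope complex_scope.

(* In the parameters s, the coefficients [Bs]_{u_-} / [Bs+u]_{u_+} are holomorphic near 0 and
   their derivatives at 0 grow at most geometrically in u, so for small eps the series can be
   differentiated term by term.  If (i,j), (p,q) with i < p and j < q both lie in the negative
   support of u, the coefficient is divisible by (Bs)_ij (Bs)_pq, whose monomials s_a s_b have
   comparable indices a, b; derivations along an antichain i_1 < ... < i_r, j_1 > ... > j_r
   kill such a term.  Hence only u in the cone C(w) contribute, also after a translation by a
   monomial, and each series is a solution.

   Let eta_a be the sum of the theta_d over the corner d <= a.  On the series, eta_a acts as
   multiplication of the coefficients by s_a + c_a(u), where c(u) are the coordinates of u in
   the basis B.  At a point x0 the matrix (eta^tau F_sigma)(x0), indexed by antichains, is
   therefore (1 + O(eps)) times a matrix unitriangular in log x0: it is invertible.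

   For an arbitrary solution f the toric operators give, for a <= b, an expression of
   eta_a eta_b f as a combination of second theta-derivatives of f with coefficients of
   modulus < eps.  So all theta-derivatives of f of bounded order are controlled by the values
   eta^sigma f over antichains sigma; by the mean value inequality and connectedness, f
   vanishes as soon as these values vanish at x0.  Inverting the matrix above then writes f in
   terms of the F_sigma. *)

(** * Moduli and iterated partial derivatives *)

(** Membership in N quantifies over all elements of L with a given negative support, and N is never
    determined. The condition [strict], a pair of negative entries in strictly increasing position,
    stands in for it. It depends on the negative support alone, and an element of L without such a
    pair has nonnegative corner sums; such an element lies both in L' and in the cone. A term with
    such a pair dies under antichain derivations. So the sum over L' can be exchanged for a sum over
    the cone, where the corner sums are the exponents of a power series in the x^b. Geometric growth
    of the coefficients rests on the entries of u having sum 0: the factorials attached to u_- and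
    u_+ have the same total degree, so their quotient is controlled by multinomial coefficients.
    Completeness involves no count of the rank. The Euler equations replace a corner by the opposite
    one, which puts the two factors of eta_a eta_b, a <= b, in strictly increasing position, where
    the quadratic binomials supply a factor x^g of modulus < eps. What remains is a first order
    differential inequality for the values eta^sigma f. *)

Definition cabs (R : realType) (z : R[i]) : R := complex.Re `|z|.

Section Cabs.
Variable R : realType.
Local Notation C := R[i].
Implicit Types z w : C.

(** The norm of R[i] has its values in R[i]; the passage to [cabs] gives values in a totally ordered
    field, as the estimates require. *)
Lemma normE z : `|z| = (cabs z)%:C.
Proof. by rewrite /cabs normc_def. Qed.

Lemma cabs_ge0 z : 0 <= cabs z.
Proof. by rewrite -lecR -normE normr_ge0. Qed.

Lemma cabs_le z (r : R) : (cabs z <= r) = (`|z| <= r%:C).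
Proof. by rewrite normE lecR. Qed.

Lemma cabs_lt z (r : R) : (cabs z < r) = (`|z| < r%:C).
Proof. by rewrite normE ltcR. Qed.

Lemma cabsD z w : cabs (z + w) <= cabs z + cabs w.
Proof. by rewrite cabs_le rmorphD /= -!normE ler_normD. Qed.

Lemma cabsM z w : cabs (z * w) = cabs z * cabs w.
Proof. by apply: complexI; rewrite rmorphM /= -!normE normrM. Qed.

Lemma cabsN z : cabs (- z) = cabs z.
Proof. by rewrite /cabs normrN. Qed.

Lemma cabsC z w : cabs (z - w) = cabs (w - z).
Proof. by rewrite -cabsN opprB. Qed.

Lemma cabs0 : cabs (0 : C) = 0.
Proof. by rewrite /cabs normr0. Qed.

Lemma cabs1 : cabs (1 : C) = 1.
Proof. by rewrite /cabs normr1. Qed.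

Lemma cabsR (r : R) : cabs (r%:C) = `|r|.
Proof.
by rewrite /cabs normc_def /= expr0n /= addr0 sqrtr_sqr.
Qed.

Lemma cabs_nat n : cabs (n%:R : C) = n%:R.
Proof. by rewrite /cabs normr_nat -[n%:R](rmorph_nat (real_complex R)). Qed.

Lemma cabs_int (n : int) : cabs (n%:~R : C) = (`|n|%N)%:R.
Proof.
by case: n => n; rewrite ?NegzE ?rmorphN /= ?cabsN; exact: cabs_nat.
Qed.

Lemma cabs_eq0 z : (cabs z == 0) = (z == 0).
Proof. by rewrite -[RHS]normr_eq0 normE eq_complex /= eqxx andbT. Qed.

Lemma cabs_gt0 z : (0 < cabs z) = (z != 0).
Proof. by rewrite lt0r cabs_ge0 andbT cabs_eq0. Qed.

Lemma cabsV z : cabs (z^-1) = (cabs z)^-1.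
Proof.
have [->|z0] := eqVneq z 0; first by rewrite invr0 cabs0 invr0.
apply: (@mulfI _ (cabs z)); first by rewrite cabs_eq0.
by rewrite -cabsM !mulfV ?cabs1 ?cabs_eq0.
Qed.

Lemma cabsX z n : cabs (z ^+ n) = cabs z ^+ n.
Proof. by elim: n => [|n IH]; rewrite ?expr0 ?cabs1 // !exprS cabsM IH. Qed.

Lemma cabs_sum (I : Type) (s : seq I) (P : pred I) (F : I -> C) :
  cabs (\sum_(i <- s | P i) F i) <= \sum_(i <- s | P i) cabs (F i).
Proof.
elim/big_rec2: _ => [|i x y _ h]; first by rewrite cabs0.
by rewrite (le_trans (cabsD _ _)) // lerD2l.
Qed.

Lemma cabs_prod (I : Type) (s : seq I) (P : pred I) (F : I -> C) :
  cabs (\prod_(i <- s | P i) F i) = \prod_(i <- s | P i) cabs (F i).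
Proof.
by elim/big_rec2: _ => [|i x y _ h]; rewrite ?cabs1 // cabsM h.
Qed.

Lemma Re_le_cabs z : `|complex.Re z| <= cabs z.
Proof.
case: z => a b; rewrite /cabs normc_def /= -sqrtr_sqr ler_sqrt ?lerDl ?sqr_ge0 //.
by rewrite addr_ge0 ?sqr_ge0.
Qed.

Lemma Im_le_cabs z : `|complex.Im z| <= cabs z.
Proof.
case: z => a b; rewrite /cabs normc_def /= -sqrtr_sqr ler_sqrt ?lerDr ?sqr_ge0 //.
by rewrite addr_ge0 ?sqr_ge0.
Qed.

Lemma cabs_le_ReIm z : cabs z <= `|complex.Re z| + `|complex.Im z|.
Proof.
rewrite {1}[z]complexE (le_trans (cabsD _ _)) // cabsM !cabsR.
suff -> : cabs ('i : C) = 1 by rewrite mul1r.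
by rewrite /cabs normc_def /= expr0n expr1n add0r sqrtr1.
Qed.

Lemma gt0_complexE (e : C) : 0 < e -> exists2 r : R, 0 < r & e = r%:C.
Proof.
case: e => a b; rewrite ltcE /= => /andP[/eqP -> a0].
by exists a.
Qed.

End Cabs.

Section DiffCriterion.
Variables (K : numFieldType) (V W : normedModType K).

(** All explicit differentials (exponential, logarithm, series) are found by guessing a continuous
    linear map and bounding the remainder. *)
Lemma diff_crit (f : V -> W) (L : {linear V -> W}) x :
  continuous L ->
  (forall e : K, 0 < e -> \forall h \near (0 : V),
     `|f (x + h) - f x - L h| <= e * `|h|) ->
  differentiable f x /\ 'd f x = L :> (V -> W).
Proof.
move=> cL hL.
have E : f \o shift x = cst (f x) + L +o_ (0 : V) id.
  apply/eqaddoP => e e0; move: (hL e e0); apply: filterS => h.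
  rewrite [x + h]addrC -addrA -opprD => H; exact: H.
have D := diff_unique cL E; split=> //.
by apply/diff_locallyP; rewrite D; split.
Qed.

Lemma near_eq_differentiable (f g : V -> W) x : (\near x, f x = g x) ->
  differentiable f x -> differentiable g x.
Proof.
move=> fg df.
have cL : continuous ('d f x) by exact: diff_continuous.
apply: (proj1 (diff_crit cL _)) => e e0.
have /eqaddoP/(_ _ e0) H := diff_locally df.
have fgx := nbhs_singleton fg.
have N : \forall h \near (0 : V), f (x + h) = g (x + h).
  by move: fg; rewrite (near_shift 0 x) /=; apply: filterS => y; rewrite /= subr0 addrC.
apply: filterS2 N H => y Uy; rewrite -Uy -fgx [x + y]addrC -addrA -opprD => H.
exact: H.
Qed.

End DiffCriterion.

(* Sealed: conversion problems that unfold ['D_v f] over R[i] do not terminate in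
   reasonable time. *)
HB.lock Definition pd (R : realType) (a b : nat) (d : 'I_a * 'I_b)
  (f : 'M[R[i]]_(a, b) -> R[i]) : 'M[R[i]]_(a, b) -> R[i] :=
  'D_(delta_mx d.1 d.2) f.
Arguments pd {R a b} d f _.

Section Smooth.
Variables (R : realType) (a b : nat).
Local Notation C := R[i].
Local Notation V := ('M[C]_(a, b)).
Implicit Types (f g : V -> C) (U : set V).

(** Graded by the order n so that closure under products and inverses goes by induction on n; all
    orders together amount to [holomorphic_on], see [holomorphic_onP]. *)
Fixpoint smooth (n : nat) U f : Prop :=
  (forall x, U x -> differentiable f x) /\
  (if n is n'.+1 then forall d, smooth n' U (pd d f) else True).

Lemma smooth_diff n U f x : smooth n U f -> U x -> differentiable f x.
Proof. by case: n => [|n] [+ _]; apply. Qed.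

Lemma smooth_pd n U f d : smooth n.+1 U f -> smooth n U (pd d f).
Proof. by move=> [_ h]; exact: h. Qed.

Lemma smoothW n U f : smooth n.+1 U f -> smooth n U f.
Proof.
elim: n f => [|n IH] f [df sf]; split=> // d.
by apply: IH; apply: sf.
Qed.

Lemma pdE d f : pd d f = 'D_(delta_mx d.1 d.2) f.
Proof. by rewrite pd.unlock. Qed.

Lemma pderivs_rcons ds d f : pderivs (rcons ds d) f = pderivs ds (pd d f).
Proof. by rewrite /pderivs foldr_rcons pdE. Qed.

Lemma pderivs_cons ds d f : pderivs (d :: ds) f = pd d (pderivs ds f).
Proof. by rewrite pdE. Qed.

Lemma holomorphic_onP U f : holomorphic_on U f <-> forall n, smooth n U f.
Proof.
split=> [hf n|sf ds].
  elim: n f hf => [|n IH] f hf; first by split=> // x Ux; exact: (hf [::]).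
  split=> [x Ux|d]; first exact: (hf [::]).
  apply: IH => ds x Ux; have := hf (rcons ds d) x Ux.
  by rewrite pderivs_rcons.
elim/last_ind: ds f sf => [|ds d IH] f sf x Ux.
  by apply: (smooth_diff (sf 0)).
rewrite pderivs_rcons; apply: IH => // n; exact: (smooth_pd d (sf n.+1)).
Qed.

Lemma near_open U (P : V -> Prop) x : open U -> U x -> (forall y, U y -> P y) ->
  \forall y \near x, P y.
Proof.
move=> oU Ux h; have := open_nbhs_nbhs (conj oU Ux).
by apply: filterS.
Qed.

Lemma pd_ext U f g x d : open U -> U x -> (forall y, U y -> f y = g y) ->
  pd d f x = pd d g x.
Proof. by move=> oU Ux h; rewrite !pdE; apply: near_eq_derive; exact: near_open oU Ux h. Qed.

Lemma diff_ext U f g x : open U -> U x -> (forall y, U y -> f y = g y) ->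
  differentiable f x -> differentiable g x.
Proof.
by move=> oU Ux h; apply: near_eq_differentiable; exact: near_open oU Ux h.
Qed.

Lemma smooth_ext n U f g : open U -> (forall y, U y -> f y = g y) ->
  smooth n U f -> smooth n U g.
Proof.
move=> oU; elim: n f g => [|n IH] f g h [df sf]; split.
- by move=> x Ux; apply: (diff_ext oU Ux h); exact: df.
- by [].
- by move=> x Ux; apply: (diff_ext oU Ux h); exact: df.
- move=> d; apply: IH (sf d) => y Uy; exact: pd_ext oU Uy h.
Qed.

Lemma pd_diff f x d : differentiable f x -> pd d f x = 'd f x (delta_mx d.1 d.2).
Proof. by move=> df; rewrite pdE deriveE. Qed.

Lemma pd_cst (c : C) (x : V) d : pd d (fun=> c) x = 0.
Proof. by rewrite pdE; exact: derive_cst. Qed.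

Lemma pdD f g x d : differentiable f x -> differentiable g x ->
  pd d (fun y => f y + g y) x = pd d f x + pd d g x.
Proof. by move=> df dg; rewrite !pdE; apply: deriveD; exact: diff_derivable. Qed.

Lemma pdM f g x d : differentiable f x -> differentiable g x ->
  pd d (fun y => f y * g y) x = pd d f x * g x + f x * pd d g x.
Proof.
move=> df dg; rewrite !pdE deriveM; try exact: diff_derivable.
by rewrite /GRing.scale /= addrC; congr (_ + _); rewrite mulrC.
Qed.

Lemma pdV f x d : differentiable f x -> f x != 0 ->
  pd d (fun y => (f y)^-1) x = - pd d f x * ((f x)^-1 * (f x)^-1).
Proof.
move=> df f0; rewrite !pdE deriveV; [|exact: f0|exact: diff_derivable].
by rewrite /GRing.scale /= -exprVn expr2 mulrC mulrN mulNr.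
Qed.

Lemma diff_coord i j (x : V) : differentiable (fun y : V => y i j) x.
Proof. exact: differentiable_coord. Qed.

Lemma pd_coord i j (x : V) d : pd d (fun y : V => y i j) x = (((i, j) == d)%:R : C).
Proof.
rewrite pdE /derive; apply/lim_near_cst => //.
near=> h; rewrite /= !mxE addrK.
have h0 : h != 0 by near: h; exact: nbhs_dnbhs_neq.
rewrite /GRing.scale /= mulrA mulVf // mul1r.
by case: d => d1 d2 /=; rewrite xpair_eqE.
Unshelve. all: by end_near. Qed.

Lemma smooth_cst n U c : smooth n U (fun=> c).
Proof.
elim: n c => [|n IH] c; split.
- by move=> x _; exact: differentiable_cst.
- by [].
- by move=> x _; exact: differentiable_cst.
move=> d; have -> : pd d (fun=> c) = fun=> 0 by apply: funext => x; exact: pd_cst.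
exact: IH.
Qed.

Lemma smooth_coord n U i j : smooth n U (fun y : V => y i j).
Proof.
case: n => [|n]; split.
- by move=> x _; exact: diff_coord.
- by [].
- by move=> x _; exact: diff_coord.
move=> d; have -> : pd d (fun y : V => y i j) = fun=> ((i, j) == d)%:R.
  by apply: funext => x; exact: pd_coord.
exact: smooth_cst.
Qed.

Lemma smoothD n U f g : open U -> smooth n U f -> smooth n U g ->
  smooth n U (fun y => f y + g y).
Proof.
move=> oU; elim: n f g => [|n IH] f g [df sf] [dg sg]; split.
- by move=> x Ux; apply: differentiableD; [exact: df|exact: dg].
- by [].
- by move=> x Ux; apply: differentiableD; [exact: df|exact: dg].
- move=> d; apply: (smooth_ext oU) (IH _ _ (sf d) (sg d)) => x Ux.
  by rewrite pdD; [|exact: df|exact: dg].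
Qed.

Lemma smoothM n U f g : open U -> smooth n U f -> smooth n U g ->
  smooth n U (fun y => f y * g y).
Proof.
move=> oU; elim: n f g => [|n IH] f g sf sg.
  case: sf sg => df _ [dg _]; split; last by [].
  by move=> x Ux; apply: differentiableM; [exact: df|exact: dg].
split=> [x Ux|d].
  apply: differentiableM; [exact: (smooth_diff sf)|exact: (smooth_diff sg)].
have h := smoothD oU (IH _ _ (smooth_pd d sf) (smoothW sg))
                     (IH _ _ (smoothW sf) (smooth_pd d sg)).
apply: (smooth_ext oU) h => x Ux.
by rewrite pdM; [|exact: (smooth_diff sf)|exact: (smooth_diff sg)].
Qed.

Lemma smoothV n U f : open U -> (forall x, U x -> f x != 0) -> smooth n U f ->
  smooth n U (fun y => (f y)^-1).
Proof.
move=> oU f0; elim: n => [|n IH] sf.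
  split; last by [].
  by move=> x Ux; apply: differentiableV; [exact: (smooth_diff sf)|exact: f0].
split=> [x Ux|d].
  by apply: differentiableV; [exact: (smooth_diff sf)|exact: f0].
have h := IH (smoothW sf).
have hh := smoothM oU (smoothM oU (smooth_cst n U (-1)) (smooth_pd d sf)) (smoothM oU h h).
apply: (smooth_ext oU) hh => x Ux /=.
by rewrite mulN1r pdV; [|exact: (smooth_diff sf)|exact: f0].
Qed.

Lemma smooth_sum n U (I : Type) (s : seq I) (P : pred I) (F : I -> V -> C) :
  open U -> (forall i, P i -> smooth n U (F i)) ->
  smooth n U (fun y => \sum_(i <- s | P i) F i y).
Proof.
move=> oU h; elim: s => [|i s IH].
  by apply: (smooth_ext oU) (smooth_cst n U 0) => y _; rewrite big_nil.
case: (boolP (P i)) => Pi; last first.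
  by apply: (smooth_ext oU) IH => y _; rewrite big_cons (negPf Pi).
apply: (smooth_ext oU) (smoothD oU (h i Pi) IH) => y _.
by rewrite big_cons Pi.
Qed.

Lemma smooth_prod n U (I : Type) (s : seq I) (P : pred I) (F : I -> V -> C) :
  open U -> (forall i, P i -> smooth n U (F i)) ->
  smooth n U (fun y => \prod_(i <- s | P i) F i y).
Proof.
move=> oU h; elim: s => [|i s IH].
  by apply: (smooth_ext oU) (smooth_cst n U 1) => y _; rewrite big_nil.
case: (boolP (P i)) => Pi; last first.
  by apply: (smooth_ext oU) IH => y _; rewrite big_cons (negPf Pi).
apply: (smooth_ext oU) (smoothM oU (h i Pi) IH) => y _.
by rewrite big_cons Pi.
Qed.

Lemma pd_sum (I : Type) (s : seq I) (P : pred I) (F : I -> V -> C) x d :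
  (forall i, P i -> differentiable (F i) x) ->
  pd d (fun y => \sum_(i <- s | P i) F i y) x = \sum_(i <- s | P i) pd d (F i) x
  /\ differentiable (fun y => \sum_(i <- s | P i) F i y) x.
Proof.
move=> h; elim: s => [|i s [IH1 IH2]].
  have -> : (fun y => \sum_(i <- [::] | P i) F i y) = fun=> 0.
    by apply: funext => y; rewrite big_nil.
  by rewrite big_nil pd_cst; split; [|exact: differentiable_cst].
case: (boolP (P i)) => Pi; last first.
  have -> : (fun y => \sum_(j <- i :: s | P j) F j y) = fun y => \sum_(j <- s | P j) F j y.
    by apply: funext => y; rewrite big_cons (negPf Pi).
  by rewrite big_cons (negPf Pi).
have -> : (fun y => \sum_(j <- i :: s | P j) F j y) =
   fun y => F i y + \sum_(j <- s | P j) F j y.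
  by apply: funext => y; rewrite big_cons Pi.
rewrite big_cons Pi pdD; [|exact: h|exact: IH2].
by rewrite IH1; split; [|apply: differentiableD; [exact: h|exact: IH2]].
Qed.

End Smooth.

(** * Unordered sums and the complex exponential *)

Local Open Scope fset_scope.
Local Open Scope ring_scope.

Section UnorderedSum.
Variables (R : realType) (T : choiceType).
Local Notation C := R[i].
Implicit Types (f g : T -> C) (F : {fset T}).

Definition bsum f (M : R) := forall F, \sum_(u <- F) cabs (f u) <= M.

Definition asum f := exists M, bsum f M.

Definition has_sum f (l : C) := forall e : R, 0 < e ->
  exists F0 : {fset T}, forall F, F0 `<=` F -> cabs (\sum_(u <- F) f u - l) < e.

Definition csum f : C := summability.sum f.

Lemma has_sum_cvg f l : has_sum f l ->
  summability.partial_sum f @ summability.totally --> l.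
Proof.
have ? := @summability.totally_filter T.
move=> h; apply/cvgrPdist_lt => e e0.
have [r r0 re] := gt0_complexE e0.
have [F0 hF0] := h r r0.
exists F0 => //= F FF; rewrite re -cabs_lt cabsC.
by rewrite /summability.partial_sum -(@big_seq_fsetE _ _ _ _ F predT) hF0.
Qed.

Lemma has_sum_csum f l : has_sum f l -> csum f = l.
Proof. by have ? := @summability.totally_filter T; move=> /has_sum_cvg; exact: cvg_lim. Qed.

Lemma has_sumD f g l k : has_sum f l -> has_sum g k ->
  has_sum (fun u => f u + g u) (l + k).
Proof.
move=> hf hg e e0; have e2 : 0 < e / 2 by rewrite divr_gt0.
have [F hF] := hf _ e2; have [G hG] := hg _ e2.
exists (F `|` G) => H; rewrite fsubUset => /andP[FH GH].
rewrite big_split /= opprD addrACA (le_lt_trans (cabsD _ _)) //.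
have := hF _ FH; have := hG _ GH; lra.
Qed.

Lemma has_sumZ f l c : has_sum f l -> has_sum (fun u => c * f u) (c * l).
Proof.
move=> hf e e0; have ec : 0 < e / (cabs c + 1).
  by rewrite divr_gt0 // ltr_wpDl // cabs_ge0.
have [F hF] := hf _ ec; exists F => G /hF.
rewrite -mulr_sumr -mulrBr cabsM ltr_pdivlMr ?ltr_wpDl ?cabs_ge0 //.
apply: le_lt_trans; rewrite mulrC ler_wpM2l ?cabs_ge0 //; lra.
Qed.

Lemma has_sum_real (g : T -> R) (M : R) : (forall u, 0 <= g u) ->
  (forall F, \sum_(u <- F) g u <= M) -> exists l : R, has_sum (fun u => (g u)%:C) l%:C.
Proof.
move=> g0 gM.
pose E := [set x | exists F : {fset T}, x = \sum_(u <- F) g u].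
have E0 : E !=set0 by exists 0; exists fset0; rewrite big_seq_fset0.
have Eb : has_ubound E by exists M => x [F ->].
exists (sup E) => e e0.
have [_ [F ->] hF] := sup_adherent e0 (conj E0 Eb).
exists F => G FG; rewrite -rmorph_sum -rmorphB /= cabsR ltr_norml.
have le1 : \sum_(u <- F) g u <= \sum_(u <- G) g u.
  rewrite (big_fsetID _ (mem F) G) /=.
  have -> : [fset x | x in G & x \in F] = F.
    apply/fsetP => x; rewrite !inE /=; apply/andP/idP => [[]//|xF].
    by split=> //; exact: (fsubsetP FG).
  by rewrite lerDl sumr_ge0.
have le2 : \sum_(u <- G) g u <= sup E by apply: ub_le_sup => //; exists G.
apply/andP; split; last by lra.
by move: hF le1; lra.
Qed.

(** Real and imaginary parts are treated apart, and a real family g is the difference of the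
    nonnegative families g + |g| and |g|, whose sums are suprema of partial sums. *)
Lemma asum_has_sum f : asum f -> exists l, has_sum f l.
Proof.
move=> [M hM].
have part (g : T -> R) : (forall u, `|g u| <= cabs (f u)) ->
    exists l : C, has_sum (fun u => (g u)%:C) l.
  move=> gf.
  have b1 F : \sum_(u <- F) `|g u| <= M.
    by apply: le_trans (hM F); apply: ler_sum => u _.
  have b2 F : \sum_(u <- F) (g u + `|g u|) <= M + M.
    rewrite big_split /= lerD //; apply: le_trans (b1 F).
    by apply: ler_sum => u _; exact: ler_norm.
  have [l1 h1] := has_sum_real (fun u => normr_ge0 (g u)) b1.
  have p2 u : 0 <= g u + `|g u| by rewrite -lerBlDr sub0r lerNl -normrN ler_norm.
  have [l2 h2] := has_sum_real p2 b2.
  exists (l2%:C + (-1) * l1%:C).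
  have -> : (fun u => (g u)%:C) = fun u => (g u + `|g u|)%:C + (-1) * (`|g u|)%:C.
    by apply: funext => u; rewrite mulN1r -rmorphB /= addrK.
  exact: has_sumD h2 (has_sumZ (-1) h1).
have [l1 h1] := part _ (fun u => Re_le_cabs (f u)).
have [l2 h2] := part _ (fun u => Im_le_cabs (f u)).
exists (l1 + 'i * l2).
have -> : f = fun u => (complex.Re (f u))%:C + 'i * (complex.Im (f u))%:C.
  by apply: funext => u; rewrite -complexE.
exact: has_sumD h1 (has_sumZ 'i h2).
Qed.

Lemma csumP f : asum f -> has_sum f (csum f).
Proof. by move=> /asum_has_sum[l hl]; rewrite (has_sum_csum hl). Qed.

Lemma asumD f g : asum f -> asum g -> asum (fun u => f u + g u).
Proof.
move=> [M hM] [N hN]; exists (M + N) => F.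
apply: le_trans (lerD (hM F) (hN F)); rewrite -big_split /=.
by apply: ler_sum => u _; exact: cabsD.
Qed.

Lemma asumZ f c : asum f -> asum (fun u => c * f u).
Proof.
move=> [M hM]; exists (cabs c * M) => F.
apply: le_trans (ler_wpM2l (cabs_ge0 c) (hM F)); rewrite mulr_sumr.
by apply: ler_sum => u _; rewrite cabsM.
Qed.

Lemma asum_le f g : (forall u, cabs (f u) <= cabs (g u)) -> asum g -> asum f.
Proof.
move=> fg [M hM]; exists M => F; apply: le_trans (hM F).
by apply: ler_sum => u _.
Qed.

Lemma csumD f g : asum f -> asum g -> csum (fun u => f u + g u) = csum f + csum g.
Proof. by move=> /csumP hf /csumP hg; apply/has_sum_csum/has_sumD. Qed.

Lemma csumZ f c : asum f -> csum (fun u => c * f u) = c * csum f.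
Proof. by move=> /csumP hf; apply/has_sum_csum/has_sumZ. Qed.

Lemma csum_le f M : bsum f M -> cabs (csum f) <= M.
Proof.
move=> b; have /csumP h : asum f by exists M.
apply/ler_addgt0Pr => e e0; have [F hF] := h e e0.
have := hF F (fsubset_refl _); rewrite cabsC => hF'.
have := cabsD (csum f - \sum_(u <- F) f u) (\sum_(u <- F) f u).
rewrite subrK => H; apply: (le_trans H).
rewrite addrC lerD //; last exact: ltW.
by apply: le_trans (cabs_sum _ _ _) (b F).
Qed.

Lemma asum0 : asum (fun=> 0).
Proof. by exists 0 => F; rewrite big1 // => u _; rewrite cabs0. Qed.

Lemma csum0 : csum (fun=> 0) = 0.
Proof.
apply: has_sum_csum => e e0; exists fset0 => F _.
by rewrite big1 // subr0 cabs0.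
Qed.

Lemma csum_sum (I : Type) (s : seq I) (f : I -> T -> C) :
  (forall i, asum (f i)) ->
  asum (fun u => \sum_(i <- s) f i u) /\
  csum (fun u => \sum_(i <- s) f i u) = \sum_(i <- s) csum (f i).
Proof.
move=> h; elim: s => [|i s [IH1 IH2]].
  have -> : (fun u => \sum_(i <- [::]) f i u) = fun=> 0.
    by apply: funext => u; rewrite big_nil.
  by rewrite big_nil csum0; split=> //; exact: asum0.
have -> : (fun u => \sum_(j <- i :: s) f j u) =
    fun u => f i u + \sum_(j <- s) f j u.
  by apply: funext => u; rewrite big_cons.
by rewrite big_cons csumD // IH2; split=> //; exact: asumD.
Qed.

Lemma csum_bij (h k : T -> T) f : cancel h k -> cancel k h -> asum f ->
  csum (fun u => f (h u)) = csum f.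
Proof.
move=> hk kh /csumP hf; apply: has_sum_csum => e e0.
have [F hF] := hf e e0; exists [fset k u | u in F] => G /fsubsetP FG.
have /hF : F `<=` [fset h u | u in G].
  apply/fsubsetP => u uF; apply/imfsetP; exists (k u); last by rewrite kh.
  by apply: FG; apply/imfsetP; exists u.
rewrite big_imfset //=; exact: (in2W (can_inj hk)).
Qed.

Lemma csum_single f u0 : asum f ->
  csum f = f u0 + csum (fun u => if u == u0 then 0 else f u).
Proof.
move=> af; apply: has_sum_csum.
have s1 : has_sum (fun u => if u == u0 then f u0 else 0) (f u0).
  move=> e e0; exists [fset u0] => F; rewrite fsub1set => uF.
  rewrite (big_fsetD1 u0) //= eqxx big_seq big1 ?addr0 ?subrr ?cabs0 //.
  by move=> u; rewrite !inE => /andP[/negPf->].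
have af' : asum (fun u => if u == u0 then 0 else f u).
  apply: asum_le af => u; case: ifP => // _; by rewrite cabs0 cabs_ge0.
have := has_sumD s1 (csumP af').
congr (has_sum _ _); apply: funext => u.
by case: eqVneq => [->|_]; rewrite ?addr0 ?add0r.
Qed.

End UnorderedSum.

Local Close Scope fset_scope.

Section ComplexExponential.
Variable R : realType.
Local Notation C := R[i].

Lemma cexp0 : cexp (0 : C) = 1.
Proof. by rewrite /cexp /= expR0 cos0 sin0 mul1r. Qed.

Lemma cexpD (z w : C) : cexp (z + w) = cexp z * cexp w.
Proof.
case: z w => [a b] [c d]; rewrite /cexp /= expRD cosD sinD rmorphM /=.
apply/eqP; rewrite eq_complex /=; apply/andP; split; apply/eqP; ring.
Qed.

Lemma cexp_neq0 (z : C) : cexp z != 0.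
Proof.
have : cexp z * cexp (- z) = 1 by rewrite -cexpD subrr cexp0.
by apply: contra_eq_neq => ->; rewrite mul0r eq_sym oner_eq0.
Qed.

Lemma cexpN (z : C) : cexp (- z) = (cexp z)^-1.
Proof.
apply: (mulfI (cexp_neq0 z)).
by rewrite -cexpD subrr cexp0 mulfV ?cexp_neq0.
Qed.

Lemma near0_realP (V : normedModType C) (P : V -> Prop) :
  (\forall h \near (0 : V), P h) <->
  exists2 d : R, 0 < d & forall h, `|h| < d%:C -> P h.
Proof.
split=> [/nbhs_normP[e e0 H]|[d d0 H]].
  have [r r0 re] := gt0_complexE e0; exists r => // h hr.
  by apply: H; rewrite /= sub0r normrN re.
apply/nbhs_normP; exists d%:C; first by rewrite /= ltcR.
by move=> h /=; rewrite sub0r normrN; exact: H.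
Qed.

Lemma is_derive0_le (f : R -> R) (d e : R) : is_derive (0 : R) (1 : R) f d -> 0 < e ->
  exists2 r : R, 0 < r & forall h, `|h| < r -> `|f h - f 0 - h * d| <= e * `|h|.
Proof.
move=> [df dE] e0; have := derivable_nbhs df; rewrite dE => /eqaddoP/(_ e e0).
move=> /nbhs_normP[r r0 H]; exists r => // h hr.
have := H h; rewrite /= sub0r normrN => /(_ hr).
have -> : ((fun h : R => (f \o shift 0) (h *: 1)) - (cst (f 0) + (fun h : R => h *: d))) h
  = f (h * 1 + 0) - (f 0 + h * d) by [].
by rewrite mulr1 addr0 opprD addrA.
Qed.

Lemma cexp_remainder (e : R) : 0 < e ->
  exists2 r : R, 0 < r & forall h : C, cabs h < r ->
    cabs (cexp h - 1 - h) <= e * cabs h.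
Proof.
(* The real and the imaginary part will each be at most 3 k |h|, so k <= e / 8 suffices; the radius
   k / 2 will give |exp a - 1| <= 2 |a| <= k. *)
move=> e0; pose k := Num.min (e / 8) 1.
have k0 : 0 < k by rewrite lt_min ltr01 divr_gt0.
have ke : k <= e / 8 by rewrite ge_min lexx.
have k1 : k <= 1 by rewrite ge_min lexx orbT.
have [r1 r10 H1] := is_derive0_le (@is_derive_expR R 0) k0.
have [r2 r20 H2] := is_derive0_le (is_derive_cos (0 : R)) k0.
have [r3 r30 H3] := is_derive0_le (is_derive_sin (0 : R)) k0.
pose r := Num.min (Num.min r1 r2) (Num.min r3 (k / 2)).
exists r; first by rewrite !lt_min r10 r20 r30 divr_gt0.
move=> h; rewrite /r !lt_min => /andP[/andP[hr1 hr2] /andP[hr3 hrk]].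
have ha := Re_le_cabs h; have hb := Im_le_cabs h.
have {H1} := H1 _ (le_lt_trans ha hr1).
have {H2} := H2 _ (le_lt_trans hb hr2).
have {H3} := H3 _ (le_lt_trans hb hr3).
case: h ha hb hrk {hr1 hr2 hr3} => a b; set n := cabs _.
rewrite [complex.Re _]/= [complex.Im _]/= => ha hb hrk.
rewrite expR0 cos0 sin0 !subr0 !(mulr1, oppr0, mulr0, subr0).
set E := expR a; set S := sin b; set D := cos b => H3 H2 H1.
apply: le_trans (cabs_le_ReIm _) _.
have -> : cexp (a +i* b) - 1 - (a +i* b) = (E * D - 1 - a) +i* (E * S - b).
  by apply/eqP; rewrite eq_complex /=; apply/andP; split; apply/eqP; rewrite /E /D /S; ring.
rewrite [complex.Re _]/= [complex.Im _]/=.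
have n0 : 0 <= n := cabs_ge0 _.
have E2 : `|E - 1| <= 2 * `|a|.
  have -> : E - 1 = (E - 1 - a) + a by rewrite subrK.
  apply: le_trans (ler_normD _ _) _; have := normr_ge0 a; nra.
have E3 : `|E| <= 2.
  have -> : E = (E - 1) + 1 by rewrite subrK.
  apply: le_trans (ler_normD _ _) _; rewrite normr1; lra.
have P1 : `|E * D - 1 - a| <= 3 * k * n.
  have -> : E * D - 1 - a = E * (D - 1) + (E - 1 - a) by ring.
  apply: le_trans (ler_normD _ _) _; rewrite normrM.
  have := normr_ge0 b; have := normr_ge0 E; have := normr_ge0 (D - 1); nra.
have P2 : `|E * S - b| <= 3 * k * n.
  have -> : E * S - b = E * (S - b) + (E - 1) * b by ring.
  apply: le_trans (ler_normD _ _) _; rewrite !normrM.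
  have q1 : `|E| * `|S - b| <= 2 * (k * n).
    by apply: ler_pM => //; apply: le_trans H3 _; rewrite ler_wpM2l // ltW.
  have q2 : `|E - 1| * `|b| <= k * n.
    by apply: ler_pM => //; lra.
  lra.
nra.
Qed.

Lemma cexp_diff (z : C) : differentiable (@cexp R : C -> C) z /\
  'd (@cexp R) z = (fun h : C => cexp z * h) :> (C -> C).
Proof.
apply: (@diff_crit C C C (@cexp R) ( *:%R (cexp z) : {linear C -> C})).
  exact: scaler_continuous.
move=> e e0; have [r r0 ->] := gt0_complexE e0.
have c0 : 0 < r / (cabs (cexp z) + 1) by rewrite divr_gt0 // ltr_wpDl // cabs_ge0.
have [d d0 H] := cexp_remainder c0.
apply/near0_realP; exists d => // h; rewrite -cabs_lt => /H {}H.
have -> : cexp (z + h) - cexp z - cexp z *: h = cexp z * (cexp h - 1 - h).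
  by rewrite cexpD /GRing.scale /=; ring.
rewrite !normE -rmorphM lecR cabsM.
apply: le_trans (ler_wpM2l (cabs_ge0 _) H) _.
rewrite mulrA ler_wpM2r ?cabs_ge0 // mulrC -mulrA ler_piMr ?(ltW r0) //.
have : 0 <= cabs (cexp z) := cabs_ge0 _; move: (cabs _) => t t0.
by rewrite mulrC ler_pdivrMr ?mul1r; lra.
Qed.

Variables (a b : nat).
Local Notation V := ('M[C]_(a, b)).

Lemma diff_cexp (f : V -> C) x : differentiable f x ->
  differentiable (fun y => cexp (f y)) x.
Proof.
move=> df; apply: (@differentiable_comp _ _ _ _ f (@cexp R)); first exact: df.
exact: (proj1 (cexp_diff _)).
Qed.

Lemma pd_cexp (f : V -> C) x d : differentiable f x ->
  pd d (fun y => cexp (f y)) x = pd d f x * cexp (f x).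
Proof.
move=> df; rewrite pd_diff; last exact: diff_cexp.
rewrite (@diff_comp _ _ _ _ f (@cexp R)); [|exact: df|exact: (proj1 (cexp_diff _))].
by rewrite /= (proj2 (cexp_diff _)) pd_diff // mulrC.
Qed.

End ComplexExponential.

Lemma near_translate (K : numFieldType) (V : normedModType K) (P : V -> Prop) (x : V) :
  (\forall y \near x, P y) -> \forall h \near (0 : V), P (x + h).
Proof.
by rewrite (near_shift 0 x); apply: filterS => h; rewrite /= subr0 addrC.
Qed.

(** * Differentials as explicit linear forms, and branches of the logarithm *)

Section LinearForms.
Variables (R : realType) (a b : nat).
Local Notation C := R[i].
Local Notation V := ('M[C]_(a, b)).
Implicit Types (f : V -> C) (x h : V).

Definition vnorm (h : V) : R := complex.Re `|h|.

Lemma vnormE h : `|h| = (vnorm h)%:C.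
Proof. by rewrite /vnorm RRe_real // ger0_real. Qed.

Lemma vnorm_ge0 h : 0 <= vnorm h.
Proof. by rewrite -lecR -vnormE normr_ge0. Qed.

Lemma cabs_entry h i j : cabs (h i j) <= vnorm h.
Proof.
rewrite cabs_le -vnormE [leRHS]/Num.Def.normr /= mx_normE.
have -> : `|h i j| = (`|h i j|%:nng)%:num by [].
by rewrite num_le; apply/bigmax_geP; right; exists (i, j).
Qed.

Definition linform (G : V) (h : V) : C := \sum_d G d.1 d.2 * h d.1 d.2.

Lemma linform_is_linear G : linear (linform G).
Proof.
move=> c x y; rewrite /linform /GRing.scale /= mulr_sumr -big_split /=.
by apply: eq_bigr => d _; rewrite !mxE; ring.
Qed.

HB.instance Definition _ G :=
  GRing.isLinear.Build C V C *:%R (linform G) (linform_is_linear G).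

Lemma linform_continuous G : continuous (linform G).
Proof.
move=> x; apply: differentiable_continuous.
apply: (smooth_diff (n := 0) (U := setT)) => //.
apply: smooth_sum; first exact: openT.
by move=> d _; apply: smoothM; [exact: openT|exact: smooth_cst|exact: smooth_coord].
Qed.

Lemma linform_delta G d : linform G (delta_mx d.1 d.2) = G d.1 d.2.
Proof.
rewrite /linform (bigD1 d) //= big1 ?addr0; first by rewrite mxE !eqxx mulr1.
move=> d' nd; rewrite mxE; case: (d) (d') nd => [i j] [i' j'] /=.
by rewrite xpair_eqE => /negPf ->; rewrite mulr0.
Qed.

Lemma diff_linform f x (G : V) :
  (forall e : R, 0 < e -> exists2 r : R, 0 < r & forall h, vnorm h < r ->
    cabs (f (x + h) - f x - linform G h) <= e * vnorm h) ->
  differentiable f x /\ forall d, pd d f x = G d.1 d.2.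
Proof.
move=> H.
have [df dE] : differentiable f x /\ 'd f x = linform G :> (V -> C).
  apply: (diff_crit (@linform_continuous G)) => e e0.
  have [r r0 ->] := gt0_complexE e0; have [t t0 Ht] := H r r0.
  apply/near0_realP; exists t => // h; rewrite vnormE ltcR => /Ht.
  by rewrite cabs_le rmorphM.
by split=> // d; rewrite pd_diff // dE linform_delta.
Qed.

Lemma diff_pdE f x h : differentiable f x ->
  'd f x h = \sum_d pd d f x * h d.1 d.2.
Proof.
move=> df; rewrite [h in LHS]matrix_sum_delta pair_big /= linear_sum.
apply: eq_bigr => d _; rewrite linearZ pd_diff; last exact: df.
by rewrite /GRing.scale /= mulrC.
Qed.

Lemma diff_remainder f x : differentiable f x ->
  forall e : R, 0 < e -> exists2 r : R, 0 < r & forall h, vnorm h < r ->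
    cabs (f (x + h) - f x - 'd f x h) <= e * vnorm h.
Proof.
move=> df e e0.
have e0' : (0 : C) < e%:C by rewrite ltcR.
have /eqaddoP/(_ _ e0') := diff_locally df.
move=> /near0_realP[r r0 H]; exists r => // h hr.
have := H h; rewrite vnormE ltcR => /(_ hr).
have -> : (f \o shift x - (cst (f x) + 'd f x)) h = f (h + x) - (f x + 'd f x h) by [].
by rewrite -rmorphM /= -cabs_le [h + x]addrC opprD addrA.
Qed.

Lemma linform_le (G : V) h :
  cabs (linform G h) <= (\sum_d cabs (G d.1 d.2)) * vnorm h.
Proof.
apply: le_trans (cabs_sum _ _ _) _; rewrite mulr_suml; apply: ler_sum => d _.
by rewrite cabsM ler_wpM2l ?cabs_ge0 ?cabs_entry.
Qed.

End LinearForms.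

Section LogBranch.
Variables (R : realType) (a b : nat) (U : set 'M[R[i]]_(a, b)).
Variable lg : 'M[R[i]]_(a, b) -> 'M[R[i]]_(a, b).
Hypotheses (oU : open U) (hlg : log_branch U lg).

Lemma log_branch_neq0 x i j : U x -> x i j != 0.
Proof. by move=> Ux; rewrite -(proj2 hlg x Ux) cexp_neq0. Qed.

(** Continuity makes d = lg (x + h) i j - lg x i j small, and cexp d = 1 + q with q = h_ij / x_ij.
    The first order expansion of the exponential, read backwards, bounds |q - d| by a small multiple
    of |d|, and |d| by 2 |q|. *)
Lemma log_branch_diff x i j : U x -> differentiable (fun y => lg y i j) x /\
  forall d, pd d (fun y => lg y i j) x = ((i, j) == d)%:R * (x i j)^-1.
Proof.
move=> Ux; have x0 := log_branch_neq0 i j Ux.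
pose G : 'M[R[i]]_(a, b) := (x i j)^-1 *: delta_mx i j.
suff [df dE] : differentiable (fun y => lg y i j) x /\
    forall d, pd d (fun y => lg y i j) x = G d.1 d.2.
  split=> // -[k l]; rewrite dE !mxE /= mulrC xpair_eqE.
  by rewrite [k == i]eq_sym [l == j]eq_sym.
apply: diff_linform => e e0.
have LG h : linform G h = (x i j)^-1 * h i j.
  rewrite /linform (bigD1 (i, j)) //= big1 ?addr0.
    by rewrite !mxE !eqxx mulr1.
  by case=> k l; rewrite xpair_eqE !mxE /= => /negPf->; rewrite mulr0 mul0r.
pose k := cabs (x i j)^-1.
have k0 : 0 < k by rewrite cabs_gt0 invr_neq0.
(* The bound 1/2 serves to get |d| <= 2 |q|, the other one to bring the final e' 2 k |h| below e
   |h|. *)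
pose e' := Num.min (2^-1) (e / (2 * k)).
have e'0 : 0 < e' by rewrite lt_min invr_gt0 ltr0n divr_gt0 // mulr_gt0.
have [r r0 Hr] := cexp_remainder e'0.
have cl : {for x, continuous lg}.
  have [cl _] := hlg; move: cl; rewrite (continuous_open_subspace _ oU).
  by apply; exact: mem_set.
have : \forall y \near x, U y by exact: near_open oU Ux _.
have r0C : (0 : R[i]) < r%:C by rewrite ltcR.
have /cvgrPdist_lt/(_ _ r0C) := cl.
move=> /near_translate H1 /near_translate H2.
have /near0_realP[t t0 Ht] : \forall h \near (0 : 'M[R[i]]_(a, b)),
    `|lg x - lg (x + h)| < r%:C /\ U (x + h) by exact: filterI H1 H2.
exists t => // h ht; have [] := Ht h; first by rewrite vnormE ltcR.
rewrite vnormE ltcR => Hd Uxh.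
set d := lg (x + h) i j - lg x i j.
have dr : cabs d < r.
  apply: le_lt_trans Hd; apply: le_trans (cabs_entry _ i j); rewrite !mxE cabsC.
  exact: lexx.
have Ed : cexp d = 1 + (x i j)^-1 * h i j.
  rewrite cexpD cexpN (proj2 hlg _ Uxh) (proj2 hlg _ Ux) mxE mulrC mulrDr mulVf //.
have := Hr _ dr; rewrite Ed LG; set q := _ * h i j => {}Hr.
have {Hr} : cabs (q - d) <= e' * cabs d.
  by move: Hr; congr (cabs _ <= _); ring.
move=> Hr.
have q1 : cabs q <= k * vnorm h by rewrite cabsM ler_wpM2l ?cabs_ge0 ?cabs_entry.
have h1 : e' <= 2^-1 by rewrite ge_min lexx.
have h2 : e' * (2 * k) <= e.
  by rewrite -ler_pdivlMr ?mulr_gt0 // ge_min lexx orbT.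
have d0 : 0 <= cabs d := cabs_ge0 d.
have dq : cabs d <= 2 * cabs q.
  have := cabsD (d - q) q; rewrite subrK.
  have : cabs (d - q) <= 2^-1 * cabs d by rewrite cabsC (le_trans Hr) // ler_wpM2r.
  lra.
rewrite cabsC; apply: le_trans Hr _.
have vh := vnorm_ge0 h.
apply: le_trans (_ : e' * (2 * (k * vnorm h)) <= _).
  by rewrite ler_pM2l // (le_trans dq) // ler_wpM2l.
by rewrite [2 * (k * _)]mulrA [e' * _]mulrA ler_wpM2r.
Qed.

Lemma smooth_inv_coord n i j : smooth n U (fun y => (y i j)^-1).
Proof.
apply: smoothV => //; last exact: smooth_coord.
by move=> x Ux; exact: log_branch_neq0.
Qed.

Lemma smooth_log_branch n i j : smooth n U (fun y => lg y i j).
Proof.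
case: n => [|n]; split.
- by move=> x Ux; case: (log_branch_diff i j Ux).
- by [].
- by move=> x Ux; case: (log_branch_diff i j Ux).
move=> d; apply: (smooth_ext oU)
  (smoothM oU (smooth_cst n U ((i, j) == d)%:R) (smooth_inv_coord n i j)).
by move=> x Ux; rewrite (proj2 (log_branch_diff i j Ux)).
Qed.

End LogBranch.

(** * Termwise differentiation of series in finitely many holomorphic functions *)

Section PowerSeries.
Variables (R : realType) (a b : nat) (U : set 'M[R[i]]_(a, b)).
Variables (T : choiceType) (K : finType) (c : T -> K -> nat).
Variables (Z : K -> 'M[R[i]]_(a, b) -> R[i]) (rho : R).
Local Notation C := R[i].
Local Notation V := ('M[C]_(a, b)).
Implicit Types (A : T -> C) (x h : V).

Definition mdeg (u : T) : nat := \sum_k c u k.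

Definition mono (u : T) (x : V) : C := \prod_k Z k x ^+ c u k.

Definition series A (x : V) : C := csum (fun u => A u * mono u x).

(** All powers of the degree are required at once, so that the class is stable under the factors,
    linear in the degree, which differentiation produces; see [moments_mul]. *)
Definition moments A := forall p : nat,
  asum (fun u => A u * ((1 + (mdeg u)%:R) ^+ p * rho ^+ mdeg u)%:C).

Section Remainder.
Variables (x h : V) (e t : R).
Hypotheses (rho0 : 0 < rho) (e0 : 0 < e) (t0 : 0 <= t) (te : t <= e).

(** First order control of a product of n factors: p and p' are its values at x and x + h, and D is
    its differential at h. The bounds are stable under products with degrees adding up; the last one
    costs n^2, whence the second moment in [series_diff]. *)
Definition ctl (n : nat) (p p' D : C) := [/\ cabs p <= rho ^+ n, cabs p' <= rho ^+ n,
  cabs (p' - p) <= n%:R * t * rho ^+ n &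
  cabs (p' - p - D) <= n%:R ^+ 2 * (e * t) * rho ^+ n].

Lemma ctlM n m p p' D q q' E : ctl n p p' D -> ctl m q q' E ->
  ctl (n + m) (p * q) (p' * q') (p * E + q * D).
Proof.
move=> [f1 f2 f3 f4] [g1 g2 g3 g4]; rewrite /ctl exprD natrD; split.
- by rewrite cabsM ler_pM ?cabs_ge0.
- by rewrite cabsM ler_pM ?cabs_ge0.
- have -> : p' * q' - p * q = (p' - p) * q' + p * (q' - q) by ring.
  apply: le_trans (cabsD _ _) _; rewrite !cabsM.
  apply: le_trans (lerD (ler_pM _ _ f3 g2) (ler_pM _ _ f1 g3)) _; rewrite ?cabs_ge0 //.
  by rewrite le_eqVlt; apply/orP; left; apply/eqP; ring.
- have -> : p' * q' - p * q - (p * E + q * D) =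
    (p' - p - D) * q + p * (q' - q - E) + (p' - p) * (q' - q) by ring.
  apply: le_trans (cabsD _ _) _; rewrite !cabsM.
  apply: le_trans (lerD (cabsD _ _) (lexx _)) _; rewrite !cabsM.
  apply: le_trans (lerD (lerD (ler_pM _ _ f4 g1) (ler_pM _ _ f1 g4)) (ler_pM _ _ f3 g3)) _;
    rewrite ?cabs_ge0 //.
  set r1 := rho ^+ n; set r2 := rho ^+ m.
  have r10 : 0 <= r1 by rewrite exprn_ge0 // ltW.
  have r20 : 0 <= r2 by rewrite exprn_ge0 // ltW.
  have N0 : 0 <= n%:R :> R by []. have M0 : 0 <= m%:R :> R by [].
  (* The product of the two increments is quadratic in t; as t <= e, it fits into the mixed term 2 n
     m of (n + m)^2. *)
  have tt : t * t <= e * t by rewrite ler_wpM2r.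
  have et : 0 <= e * t by rewrite mulr_ge0 // ltW.
  have -> : n%:R * t * r1 * (m%:R * t * r2) = (n%:R * m%:R * (r1 * r2)) * (t * t) by ring.
  have nm : 0 <= n%:R * m%:R * (r1 * r2) by rewrite !mulr_ge0.
  have := ler_wpM2l nm tt; have := mulr_ge0 nm et.
  set q0 := n%:R * m%:R * (r1 * r2) * (e * t) => h1 h2.
  have -> : (n%:R + m%:R) ^+ 2 * (e * t) * (r1 * r2) =
    n%:R ^+ 2 * (e * t) * r1 * r2 + r1 * (m%:R ^+ 2 * (e * t) * r2) + (q0 + q0).
    by rewrite /q0; ring.
  by rewrite lerD2l; apply: le_trans h2 _; rewrite lerDl.
Qed.

Definition controlled (n : nat) (f : V -> C) : Prop :=
  differentiable f x /\ ctl n (f x) (f (x + h)) ('d f x h).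

Lemma controlled1 : controlled 0 (fun=> 1).
Proof.
split; first exact: differentiable_cst.
have -> : 'd (fun=> 1 : C) x h = 0 by rewrite (diff_cst (1 : C) x).
by rewrite /ctl !expr0 cabs1 !subrr cabs0 expr0n /= !mul0r; split.
Qed.

Lemma controlledM n m f g : controlled n f -> controlled m g ->
  controlled (n + m) (fun y => f y * g y).
Proof.
move=> [df cf] [dg cg]; split; first by apply: differentiableM; [exact: df|exact: dg].
have E := congr1 (fun F : V -> C => F h) (diffM df dg).
exact: (eq_ind_r (fun D => ctl (n + m) _ _ D) (ctlM cf cg) E).
Qed.

Lemma controlled_mono u : (forall k, controlled 1 (Z k)) -> controlled (mdeg u) (mono u).
Proof.
move=> hZ; rewrite /mdeg /mono.
have ex k n : controlled n (fun y => Z k y ^+ n).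
  elim: n => [|n IH]; first exact: controlled1.
  have := controlledM (hZ k) IH; rewrite add1n.
  have -> // : (fun y => Z k y * Z k y ^+ n) = (fun y => Z k y ^+ n.+1).
  by apply: funext => y; rewrite exprS.
elim: (index_enum K) => [|k s IH].
  have -> : (fun y => \prod_(k <- [::]) Z k y ^+ c u k) = fun=> 1.
    by apply: funext => y; rewrite big_nil.
  by rewrite big_nil; exact: controlled1.
have := controlledM (ex k (c u k)) IH; rewrite big_cons.
have -> // : (fun y => Z k y ^+ c u k * (\prod_(k <- s) Z k y ^+ c u k)) =
  fun y => \prod_(k <- k :: s) Z k y ^+ c u k.
by apply: funext => y; rewrite big_cons.
Qed.

End Remainder.

Hypothesis rho0 : 0 < rho.

Lemma near0_vnorm (P : V -> Prop) :
  (\forall h \near (0 : V), P h) <->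
  exists2 d : R, 0 < d & forall h, vnorm h < d -> P h.
Proof.
split=> [/near0_realP[d d0 H]|[d d0 H]].
  by exists d => // h hd; apply: H; rewrite vnormE ltcR.
by apply/near0_realP; exists d => // h; rewrite vnormE ltcR; exact: H.
Qed.

Lemma vnormZ (z : C) (v : V) : vnorm (z *: v) = cabs z * vnorm v.
Proof. by apply: complexI; rewrite rmorphM /= -!vnormE normrZ normE. Qed.

Lemma mono_le u y : (forall k, cabs (Z k y) <= rho) -> cabs (mono u y) <= rho ^+ mdeg u.
Proof.
move=> Zr; rewrite /mono cabs_prod /mdeg expr_sum; apply: ler_prod => k _.
by rewrite cabs_ge0 cabsX lerXn2r ?nnegrE ?cabs_ge0 // ltW.
Qed.

Lemma asum_mono A y : moments A -> (forall k, cabs (Z k y) <= rho) ->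
  asum (fun u => A u * mono u y).
Proof.
move=> mA Zr; apply: asum_le (mA 0) => u; rewrite !cabsM cabsR expr0 mul1r.
rewrite ler_wpM2l ?cabs_ge0 // ger0_norm ?exprn_ge0 ?(ltW rho0) //.
exact: mono_le.
Qed.

(** [kappa] is a relative Lipschitz constant common to all the Z_k: kappa rho exceeds each sum of
    moduli of first derivatives by at least 1, and this 1 absorbs the remainder of the first order
    expansion. *)
Lemma near_controlled x (e : R) : 0 < e ->
  (forall k, differentiable (Z k) x) -> (forall k, cabs (Z k x) < rho) ->
  forall kappa, kappa = (\sum_k \sum_d cabs (pd d (Z k) x) + 1) / rho ->
  \forall h \near (0 : V), kappa * vnorm h <= e /\
    forall k, controlled x h e (kappa * vnorm h) 1 (Z k).
Proof.
move=> e0 dZ Zr kappa kE.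
have kr : kappa * rho = \sum_k \sum_d cabs (pd d (Z k) x) + 1.
  by rewrite kE divfK // gt_eqF.
have s0 k : 0 <= \sum_d cabs (pd d (Z k) x) by apply: sumr_ge0 => d _; exact: cabs_ge0.
have s1 k : \sum_d cabs (pd d (Z k) x) <= kappa * rho - 1.
  by rewrite kr addrK (bigD1 k) //= lerDl sumr_ge0.
have k0 : 0 < kappa by rewrite kE divr_gt0 // ltr_wpDl // sumr_ge0.
apply: filterI.
  apply/near0_vnorm; exists (e / kappa); first by rewrite divr_gt0.
  by move=> h /ltW; rewrite ler_pdivlMr // mulrC.
apply: (@filter_forall V K
  (fun k => [set h | controlled x h e (kappa * vnorm h) 1 (Z k)]) (nbhs (0 : V))) => k.
(* The bound 1 is for the Lipschitz estimate, the other one for the second order estimate with t =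
   kappa |h|. *)
pose eta := Num.min 1 (e * kappa * rho).
have eta0 : 0 < eta by rewrite lt_min ltr01 !mulr_gt0.
have [r r0 Hr] := diff_remainder (dZ k) eta0.
have q0 : 0 < (rho - cabs (Z k x)) / (kappa * rho).
  by rewrite divr_gt0 ?mulr_gt0 // subr_gt0.
apply/near0_vnorm; exists (Num.min r ((rho - cabs (Z k x)) / (kappa * rho))).
  by rewrite lt_min r0.
move=> h; rewrite lt_min => /andP[/Hr {}Hr].
rewrite ltr_pdivlMr ?mulr_gt0 // => h2.
have vh := vnorm_ge0 h.
have e1 : eta <= 1 by rewrite ge_min lexx.
have e2 : eta <= e * kappa * rho by rewrite ge_min lexx orbT.
have hD : cabs (Z k (x + h) - Z k x) <= kappa * vnorm h * rho.
  have -> : Z k (x + h) - Z k x = (Z k (x + h) - Z k x - 'd (Z k) x h) + 'd (Z k) x h.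
    by rewrite subrK.
  apply: le_trans (cabsD _ _) _.
  have : cabs ('d (Z k) x h) <= (\sum_d cabs (pd d (Z k) x)) * vnorm h.
    rewrite (diff_pdE _ (dZ k)); apply: le_trans (cabs_sum _ _ _) _.
    rewrite mulr_suml; apply: ler_sum => d _.
    by rewrite cabsM ler_wpM2l ?cabs_ge0 ?cabs_entry.
  have := ler_wpM2r vh (s1 k); have := ler_wpM2r vh e1.
  move: Hr; lra.
split; first exact: dZ.
split; rewrite ?expr1 ?expr1n ?mul1r //.
- exact: ltW.
- have := cabsD (Z k (x + h) - Z k x) (Z k x); rewrite subrK => H.
  by apply: le_trans H _; move: hD h2; lra.
- apply: le_trans Hr _; apply: le_trans (ler_wpM2r vh e2) _.
  by rewrite le_eqVlt; apply/orP; left; apply/eqP; ring.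
Qed.

(** With t = kappa |h|, the remainder of a term of degree n is at most n^2 e t rho^n. Summed against
    the coefficients this is at most M e t, where M bounds the second moment: a small multiple of
    |h|. *)
Lemma series_diff A x : moments A ->
  (forall k, differentiable (Z k) x) -> (forall k, cabs (Z k x) < rho) ->
  differentiable (series A) x /\
  forall d, pd d (series A) x = csum (fun u => A u * pd d (mono u) x).
Proof.
move=> mA dZ Zr.
pose kappa := (\sum_k \sum_d cabs (pd d (Z k) x) + 1) / rho.
have k0 : 0 < kappa.
  rewrite divr_gt0 // ltr_wpDl // sumr_ge0 // => k _.
  by apply: sumr_ge0 => d _; exact: cabs_ge0.
have [M hM] := mA 2.
have M0 : 0 <= M by have := hM fset0; rewrite big_seq_fset0.
have N (e : R) (e0 : 0 < e) := near_controlled e0 dZ Zr (erefl kappa).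
have rem (e : R) h : 0 < e -> kappa * vnorm h <= e ->
   (forall k, controlled x h e (kappa * vnorm h) 1 (Z k)) ->
   bsum (fun u => A u * (mono u (x + h) - mono u x - 'd (mono u) x h))
     (M * (e * (kappa * vnorm h))).
  move=> e0 he cZ F; rewrite mulrC.
  have t0 : 0 <= kappa * vnorm h by rewrite mulr_ge0 ?vnorm_ge0 // ltW.
  have et : 0 <= e * (kappa * vnorm h) by rewrite mulr_ge0 // ltW.
  apply: le_trans (ler_wpM2l et (hM F)); rewrite mulr_sumr; apply: ler_sum => u _.
  have [_ [_ _ _ H]] := controlled_mono rho0 e0 t0 he u cZ.
  rewrite !cabsM cabsR mulrCA ler_wpM2l ?cabs_ge0 //; apply: le_trans H _.
  have r0 : 0 <= rho ^+ mdeg u by rewrite exprn_ge0 // ltW.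
  rewrite ger0_norm ?mulr_ge0 ?exprn_ge0 ?addr_ge0 ?(ltW rho0) //.
  rewrite -mulrA mulrCA ler_wpM2l // ler_wpM2r //.
  by rewrite lerXn2r ?nnegrE ?addr_ge0 // lerDr.
have dm u : differentiable (mono u) x.
  have := N 1 ltr01 => /nbhs_singleton[H1 H2].
  have t0 : 0 <= kappa * vnorm (0 : V) by rewrite mulr_ge0 ?vnorm_ge0 // ltW.
  by have [] := controlled_mono rho0 ltr01 t0 H1 u H2.
have asd h (e : R) : 0 < e -> kappa * vnorm h <= e ->
   (forall k, controlled x h e (kappa * vnorm h) 1 (Z k)) ->
   [/\ asum (fun u => A u * mono u (x + h)), asum (fun u => A u * mono u x) &
     asum (fun u => A u * 'd (mono u) x h)].
  move=> e0 he cZ.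
  have a1 : asum (fun u => A u * mono u (x + h)).
    by apply: asum_mono => // k; have [_ [_]] := cZ k; rewrite expr1.
  have a2 : asum (fun u => A u * mono u x).
    by apply: asum_mono => // k; exact: ltW.
  split=> //.
  have -> : (fun u => A u * 'd (mono u) x h) = fun u =>
     A u * mono u (x + h) + ((-1) * (A u * mono u x) +
       (-1) * (A u * (mono u (x + h) - mono u x - 'd (mono u) x h))).
    by apply: funext => u; move: ('d (mono u) x h) => D; ring.
  apply: asumD => //; apply: asumD; apply: asumZ => //.
  by eexists; exact: rem e h e0 he cZ.
(* The differentials at one small nonzero multiple of the basis vector are summable, being
   combinations of values and remainders; dividing by the scalar gives the partial derivatives. *)
have ap d : asum (fun u => A u * pd d (mono u) x).
  have /near0_vnorm[r r0 Hr] := N 1 ltr01.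
  pose v : V := delta_mx d.1 d.2.
  pose z : R := r / (2 * (vnorm v + 1)).
  have v0 := vnorm_ge0 v.
  have z0 : 0 < z by rewrite divr_gt0 // mulr_gt0 // ltr_wpDl.
  have zv : vnorm (z%:C *: v) < r.
    rewrite vnormZ cabsR gtr0_norm // mulrAC ltr_pdivrMr ?mulr_gt0 // ?ltr_wpDl //.
    by rewrite ltr_pM2l //; lra.
  have [h1 h2] := Hr _ zv.
  have [_ _ a3] := asd _ _ ltr01 h1 h2.
  have zc : z%:C != 0 :> C by rewrite -cabs_eq0 cabsR normr_eq0 gt_eqF.
  have := asumZ (z%:C)^-1 a3; congr asum; apply: funext => u.
  rewrite linearZ pd_diff; last exact: dm.
  by rewrite /GRing.scale /= mulrCA mulKf.
pose G : V := \matrix_(i, j) csum (fun u => A u * pd (i, j) (mono u) x).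
have GE d : G d.1 d.2 = csum (fun u => A u * pd d (mono u) x) by case: d => i j; rewrite mxE.
have LG h : linform G h = csum (fun u => A u * 'd (mono u) x h).
  rewrite /linform.
  have -> : (fun u => A u * 'd (mono u) x h) =
    fun u => \sum_d h d.1 d.2 * (A u * pd d (mono u) x).
    apply: funext => u; rewrite diff_pdE; last exact: dm.
    rewrite mulr_sumr; apply: eq_bigr => d _; by rewrite mulrA mulrC.
  rewrite (proj2 (csum_sum _ _)); last by move=> d; apply: asumZ.
  by apply: eq_bigr => d _; rewrite GE csumZ // mulrC.
suff [H1 H2] : differentiable (series A) x /\ forall d, pd d (series A) x = G d.1 d.2.
  by split=> // d; rewrite H2 GE.
apply: diff_linform => e e0.
(* The remainder will be at most M e' kappa |h|; M + 1 avoids a division by 0. *)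
pose e' := e / ((M + 1) * kappa).
have Mk : 0 < (M + 1) * kappa by rewrite mulr_gt0 // ltr_wpDl.
have e'0 : 0 < e' by rewrite divr_gt0.
have /near0_vnorm[r r0 Hr] := N e' e'0.
exists r => // h /Hr[h1 h2].
have [a1 a2 a3] := asd h e' e'0 h1 h2.
rewrite LG.
have -> : series A (x + h) - series A x - csum (fun u => A u * 'd (mono u) x h) =
   csum (fun u => A u * (mono u (x + h) - mono u x - 'd (mono u) x h)).
  have -> : (fun u => A u * (mono u (x + h) - mono u x - 'd (mono u) x h)) =
    fun u => A u * mono u (x + h) + ((-1) * (A u * mono u x) +
       (-1) * (A u * 'd (mono u) x h)).
    by apply: funext => u; move: ('d (mono u) x h) => D; ring.
  rewrite csumD //; last by apply: asumD; apply: asumZ.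
  rewrite csumD; [|exact: asumZ|exact: asumZ].
  by rewrite !csumZ // !mulN1r addrA.
apply: le_trans (csum_le (rem e' h e'0 h1 h2)) _.
have vh := vnorm_ge0 h.
have E : e' * ((M + 1) * kappa) = e by rewrite divfK // gt_eqF.
have -> : M * (e' * (kappa * vnorm h)) = (e' * (M * kappa)) * vnorm h by ring.
rewrite ler_wpM2r // -[leRHS]E ler_wpM2l ?(ltW e'0) // ler_wpM2r ?(ltW k0) //; lra.
Qed.

End PowerSeries.

Section LogarithmicDerivatives.
Variables (R : realType) (a b : nat).
Local Notation C := R[i].
Local Notation V := ('M[C]_(a, b)).
Variables (x : V) (d : 'I_a * 'I_b).
Implicit Types (f g : V -> C) (w : C).

(** At the point x, f is an eigenvector of theta_d with eigenvalue w; eigenvalues add up under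
    products, so that monomials need no separate computation. *)
Definition logder f w := differentiable f x /\
  pd d f x = w * (x d.1 d.2)^-1 * f x.

Lemma logder1 : logder (fun=> 1) 0.
Proof. by split; [exact: differentiable_cst|rewrite pd_cst !mul0r]. Qed.

Lemma logderM f g w w' : logder f w -> logder g w' ->
  logder (fun y => f y * g y) (w + w').
Proof.
move=> [df ef] [dg eg]; split; first by apply: differentiableM; [exact: df|exact: dg].
rewrite (pdM _ df dg) ef eg; ring.
Qed.

Lemma logderV f w : f x != 0 -> logder f w -> logder (fun y => (f y)^-1) (- w).
Proof.
move=> f0 [df ef]; split; first by apply: differentiableV; [exact: df|exact: f0].
rewrite (pdV _ df f0) ef !mulNr; congr (- _).
by move: (x d.1 d.2)^-1 f0 => t f0; field.
Qed.

Lemma logderX f w n : logder f w -> logder (fun y => f y ^+ n) (n%:R * w).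
Proof.
move=> h; elim: n => [|n IH].
  by rewrite mul0r; have := logder1; congr logder.
rewrite -natr1 mulrDl mul1r addrC; have := logderM h IH; congr logder.
by apply: funext => y; rewrite exprS.
Qed.

Lemma logder_expz f w (n : int) : f x != 0 -> logder f w ->
  logder (fun y => f y ^ n) (n%:~R * w).
Proof.
move=> f0 h; case: n => n; first exact: logderX.
rewrite NegzE rmorphN /= mulNr; apply: (@logderV (fun y => f y ^+ n.+1)).
  by rewrite expf_neq0.
exact: logderX.
Qed.

Lemma logder_prod (I : Type) (s : seq I) (F : I -> V -> C) (w : I -> C) :
  (forall i, logder (F i) (w i)) ->
  logder (fun y => \prod_(i <- s) F i y) (\sum_(i <- s) w i).
Proof.
move=> h; elim: s => [|i s IH].
  rewrite big_nil; have := logder1; congr logder.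
  by apply: funext => y; rewrite big_nil.
rewrite big_cons; have := logderM (h i) IH; congr logder.
by apply: funext => y; rewrite big_cons.
Qed.

End LogarithmicDerivatives.

Section MonomialSeries.
Variables (R : realType) (a b : nat) (U : set 'M[R[i]]_(a, b)).
Variables (T : choiceType) (K : finType) (c : T -> K -> nat).
Variables (Z : K -> 'M[R[i]]_(a, b) -> R[i]) (rho : R).
Variable w : K -> 'I_a * 'I_b -> R[i].
Local Notation C := R[i].
Local Notation V := ('M[C]_(a, b)).
Hypotheses (oU : open U) (rho0 : 0 < rho)
  (hZ : forall k x d, U x -> logder x d (Z k) (w k d))
  (dZ : forall k x, U x -> differentiable (Z k) x)
  (Zr : forall k x, U x -> cabs (Z k x) < rho)
  (x0 : forall x i j, U x -> x i j != 0).
Implicit Types (A : T -> C) (x : V).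

Definition mweight u d : C := \sum_k (c u k)%:R * w k d.

Lemma logder_mono u x d : U x -> logder x d (mono c Z u) (mweight u d).
Proof. by move=> Ux; apply: logder_prod => k; apply: logderX; exact: hZ. Qed.

Lemma moments_mul A (B : T -> C) (D : R) q : 0 <= D ->
  (forall u, cabs (B u) <= D * (1 + (mdeg c u)%:R) ^+ q) ->
  moments c rho A -> moments c rho (fun u => B u * A u).
Proof.
move=> D0 hB mA p; apply: asum_le (asumZ D%:C (mA (p + q)%N)) => u.
rewrite !cabsM !cabsR (ger0_norm D0) -mulrA mulrCA [leRHS]mulrCA.
apply: ler_wpM2l; first exact: cabs_ge0.
have q0 k : 0 <= (1 + (mdeg c u)%:R : R) ^+ k by rewrite exprn_ge0 // addr_ge0.
have r0 : 0 <= rho ^+ mdeg c u by rewrite exprn_ge0 // ltW.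
rewrite !ger0_norm ?mulr_ge0 //.
apply: le_trans (ler_wpM2r (mulr_ge0 (q0 p) r0) (hB u)) _.
by rewrite exprD le_eqVlt; apply/orP; left; apply/eqP; ring.
Qed.

Lemma w_ge0 d : 0 <= \sum_k cabs (w k d).
Proof. by apply: sumr_ge0 => k _; exact: cabs_ge0. Qed.

Lemma mweight_le u d :
  cabs (mweight u d) <= (\sum_k cabs (w k d)) * (1 + (mdeg c u)%:R) ^+ 1.
Proof.
rewrite expr1 mulr_suml; apply: le_trans (cabs_sum _ _ _) _; apply: ler_sum => k _.
rewrite cabsM cabs_nat mulrC ler_wpM2l ?cabs_ge0 //.
rewrite (le_trans (_ : _ <= (mdeg c u)%:R)) ?lerDr // ler_nat /mdeg.
by rewrite (bigD1 k) //= leq_addr.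
Qed.

Lemma series_summable A x : moments c rho A -> U x -> asum (fun u => A u * mono c Z u x).
Proof. by move=> mA Ux; apply: asum_mono mA _ => // k; apply/ltW/Zr. Qed.

Lemma pd_series A x d : moments c rho A -> U x ->
  differentiable (series c Z A) x /\
  pd d (series c Z A) x = (x d.1 d.2)^-1 * series c Z (fun u => mweight u d * A u) x.
Proof.
move=> mA Ux.
have [D E] := series_diff rho0 mA (fun k => dZ k Ux) (fun k => Zr k Ux).
split; first exact: D.
rewrite E /series -csumZ; last first.
  by apply: series_summable => //; exact: moments_mul (w_ge0 d) (fun u => mweight_le u d) mA.
congr csum; apply: funext => u; rewrite (proj2 (logder_mono u d Ux)); ring.
Qed.

Lemma smooth_series n A : moments c rho A -> smooth n U (series c Z A).
Proof.
elim: n A => [|n IH] A mA; split.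
- by move=> x Ux; exact: (proj1 (series_diff rho0 mA (fun k => dZ k Ux) (fun k => Zr k Ux))).
- by [].
- by move=> x Ux; exact: (proj1 (series_diff rho0 mA (fun k => dZ k Ux) (fun k => Zr k Ux))).
move=> d; have sx : smooth n U (fun y : V => (y d.1 d.2)^-1).
  by apply: smoothV; [exact: oU|move=> x Ux; exact: x0|exact: smooth_coord].
have mA' := moments_mul (w_ge0 d) (fun u => mweight_le u d) mA.
apply: (smooth_ext oU) (smoothM oU sx (IH _ mA')) => x Ux.
by rewrite (proj2 (pd_series d mA Ux)).
Qed.

End MonomialSeries.

(** * Corner sums of matrices with vanishing row and column sums *)

Section Corners.
Variables (S : comNzRingType) (m l : nat).
Implicit Types (F : 'I_m.+1 -> 'I_l.+1 -> S).

(** The matrix b^(k,h) is the outer product of two such vectors, see [bvecE]. *)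
Definition stepco (n : nat) (k : 'I_n) (i : 'I_n.+1) : int :=
  (i == k :> nat)%:Z - (i == k.+1 :> nat)%:Z.

Definition bco (k : 'I_m) (h : 'I_l) (i : 'I_m.+1) (j : 'I_l.+1) : int :=
  stepco k i * stepco h j.

Definition corner F (k : 'I_m) (h : 'I_l) : S :=
  \sum_(i : 'I_m.+1 | (i <= k)%N) \sum_(j : 'I_l.+1 | (j <= h)%N) F i j.

(** For integer matrices this is membership in L; for the matrix of the theta_ij f at a point it is
    the system of Euler equations. This is why the ring is arbitrary. *)
Definition balanced F :=
  (forall i, \sum_j F i j = 0) /\ (forall j, \sum_i F i j = 0).

(** Complementing the columns changes the sign, and so does complementing the rows. *)
Lemma balanced_compl F (P : pred 'I_m.+1) (Q : pred 'I_l.+1) : balanced F ->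
  \sum_(i | P i) \sum_(j | Q j) F i j = \sum_(i | ~~ P i) \sum_(j | ~~ Q j) F i j.
Proof.
move=> [hr hc].
have row i : \sum_(j | Q j) F i j = - \sum_(j | ~~ Q j) F i j.
  by have := hr i; rewrite (bigID Q) /= => /eqP; rewrite addr_eq0 => /eqP.
rewrite (eq_bigr _ (fun i _ => row i)) sumrN.
have : \sum_i \sum_(j | ~~ Q j) F i j = 0.
  by rewrite exchange_big /= big1 // => j _; exact: hc.
by rewrite (bigID P) /= addrC => /eqP; rewrite addr_eq0 => /eqP->.
Qed.

Lemma corner_compl F k h : balanced F ->
  corner F k h = \sum_(i : 'I_m.+1 | (k < i)%N) \sum_(j : 'I_l.+1 | (h < j)%N) F i j.
Proof.
move=> /balanced_compl bF; rewrite /corner bF.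
by apply: eq_big => [i|i _]; rewrite ?ltnNge //; apply: eq_bigl => j; rewrite ltnNge.
Qed.

(** Summation by parts: pairing with step vectors is the difference operator, as both boundary
    values vanish. *)
Lemma sum_stepco n (f : nat -> S) (i : 'I_n.+1) : f 0%N = 0 -> f n.+1 = 0 ->
  \sum_(k < n) f k.+1 * (stepco k i)%:~R = f i.+1 - f i.
Proof.
move=> f0 fn.
have -> : \sum_(k < n) f k.+1 * (stepco k i)%:~R =
  \sum_(k < n) (if k == i :> nat then f k.+1 else 0)
  - \sum_(k < n) (if k.+1 == i :> nat then f k.+1 else 0).
  rewrite -sumrB; apply: eq_bigr => k _; rewrite /stepco rmorphB /= mulrBr.
  by rewrite ![_ == i :> nat]eq_sym; do 2!case: eqP => _; rewrite ?mulr1 ?mulr0.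
congr (_ - _).
  have [im|mi] := ltnP i n.
    rewrite (bigD1 (Ordinal im)) //= eqxx big1 ?addr0 // => k.
    by rewrite -val_eqE /= => /negPf->.
  rewrite big1 => [|k _]; last by rewrite ltn_eqF // (leq_trans (ltn_ord k)).
  have -> : i = n :> nat by apply/eqP; rewrite eqn_leq mi -ltnS ltn_ord.
  by rewrite fn.
case: i => [[|i] hi] /=; first by rewrite big1 // f0.
have im : (i < n)%N by [].
rewrite (bigD1 (Ordinal im)) //= eqxx big1 ?addr0 // => k.
by rewrite -val_eqE /= eqSS => /negPf->.
Qed.

(** F is the mixed second difference of its corner sums, which vanish on the boundary of the grid
    because F is balanced; two summations by parts move the differences onto the step vectors. *)
Lemma corner_decomp F i j : balanced F ->
  F i j = \sum_k \sum_h corner F k h * (bco k h i j)%:~R.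
Proof.
move=> [hr hc].
(* The bounds are strict so that G vanishes at p = 0 and q = 0; the corner at (k, h) is therefore G
   at (k + 1, h + 1). *)
pose G (p q : nat) := \sum_(i' : 'I_m.+1 | (i' < p)%N) \sum_(j' : 'I_l.+1 | (j' < q)%N) F i' j'.
have cG k h : corner F k h = G k.+1 h.+1 by [].
have full (n : nat) (f : 'I_n.+1 -> S) :
    \sum_(k : 'I_n.+1 | (k < n.+1)%N) f k = \sum_k f k.
  by apply: eq_bigl => k; exact: ltn_ord.
have G1 q : G 0%N q = 0 by rewrite /G big_pred0.
have G2 q : G m.+1 q = 0.
  by rewrite /G full exchange_big /= big1 // => j' _; exact: hc.
have G3 p : G p 0%N = 0 by rewrite /G big1 // => i' _; rewrite big_pred0.
have G4 p : G p l.+1 = 0.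
  by rewrite /G big1 // => i' _; rewrite full; exact: hr.
transitivity (\sum_(k < m) (G k.+1 j.+1 - G k.+1 j) * (stepco k i)%:~R).
  rewrite (@sum_stepco _ (fun p => G p j.+1 - G p j)) ?G1 ?G2 ?subrr //.
  have inc (n : nat) (f : 'I_n.+1 -> S) (k : 'I_n.+1) :
      \sum_(k' : 'I_n.+1 | (k' < k.+1)%N) f k' =
      f k + \sum_(k' : 'I_n.+1 | (k' < k)%N) f k'.
    rewrite (bigD1 k) ?ltnSn //=; congr (_ + _); apply: eq_bigl => k'.
    by rewrite ltnS [RHS]ltn_neqAle andbC.
  by rewrite /G !inc; ring.
apply: eq_bigr => k _.
rewrite -(@sum_stepco _ (fun q => G k.+1 q)) ?G3 ?G4 // mulr_suml.
apply: eq_bigr => h _; rewrite cG /bco rmorphM /= mulrA.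
by rewrite -!mulrA; congr (_ * _); rewrite -!intrM mulrC.
Qed.

End Corners.

(** * The lattice and the cone *)

Section Lattice.
Variables (m l : nat).
Local Notation Mz := ('M[int]_(m.+1, l.+1)).
Implicit Types (u v : Mz).

Lemma AmulE (S : Mz) :
  (forall i, Amul S (lshift l.+1 i) 0 = \sum_j S i j) /\
  (forall j, Amul S (rshift m.+1 j) 0 = \sum_i S i j).
Proof.
split=> r; rewrite /Amul summxE.
  rewrite (bigD1 r) //= [X in _ + X]big1 ?addr0; last first.
    move=> i ir; rewrite summxE big1 // => j _.
    by rewrite !mxE (inj_eq (@lshift_inj _ _)) eq_lrshift eq_sym (negPf ir) mulr0.
  rewrite summxE; apply: eq_bigr => j _.
  by rewrite !mxE eqxx eq_lrshift addr0 mulr1.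
apply: eq_bigr => i _; rewrite summxE (bigD1 r) //= [X in _ + X]big1 ?addr0.
  by rewrite !mxE !eqxx eq_rlshift /= add0r mulr1.
move=> j jr.
by rewrite !mxE (inj_eq (@rshift_inj _ _)) eq_rlshift eq_sym (negPf jr) mulr0.
Qed.

Lemma LlatP u : Llat u <-> balanced u.
Proof.
have [hr hc] := AmulE u; split=> [Lu|[h1 h2]].
  by split=> [i|j]; rewrite -?hr -?hc Lu mxE.
apply/matrixP => r z; rewrite ord1 mxE; case: (split_ordP r) => [i ->|j ->].
  by rewrite hr h1.
by rewrite hc h2.
Qed.

Lemma LlatD u v : Llat u -> Llat v -> Llat (u + v).
Proof.
move=> /LlatP[h1 h2] /LlatP[h3 h4]; apply/LlatP.
by split=> i; under eq_bigr do rewrite mxE; rewrite big_split /= ?h1 ?h2 ?h3 ?h4 addr0.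
Qed.

Lemma LlatN u : Llat u -> Llat (- u).
Proof.
move=> /LlatP[h1 h2]; apply/LlatP.
by split=> i; under eq_bigr do rewrite mxE; rewrite sumrN ?h1 ?h2 oppr0.
Qed.

Lemma Amul_eq_Llat u v : Amul u = Amul v -> Llat (u - v).
Proof.
move=> E; have [hr hc] := AmulE u; have [hr' hc'] := AmulE v.
apply/LlatP; split=> i.
  rewrite (eq_bigr (fun j => u i j - v i j)); last by move=> j _; rewrite !mxE.
  by rewrite sumrB -hr -hr' E subrr.
rewrite (eq_bigr (fun j => u j i - v j i)); last by move=> j _; rewrite !mxE.
by rewrite sumrB -hc -hc' E subrr.
Qed.

Lemma bvecE k h i j : @bvec m l k h i j = bco k h i j.
Proof.
rewrite /bvec /gvec !mxE /bco /stepco -!val_eqE /= /bump /= !add1n.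
by do 4!case: (_ == _ :> nat).
Qed.

(* The corner sums of [u] are its coordinates in the basis B, see [corner_decompz]. *)
Definition cone : set Mz :=
  [set u | Llat u /\ forall k h, 0 <= corner (fun i j => u i j) k h].

Lemma Ccone0 : @Ccone m l 0.
Proof.
exists (fun _ _ _ _ => 0%N); apply/esym; do 4!(apply: big1 => ? _).
by rewrite mulr0n.
Qed.

Lemma CconeD u v : Ccone u -> Ccone v -> Ccone (u + v).
Proof.
move=> [c ->] [d ->]; exists (fun i j p q => c i j p q + d i j p q)%N.
do 4!(rewrite -big_split /=; apply: eq_bigr => ? _).
by rewrite mulrnDr.
Qed.

Lemma Ccone_gvec (i : 'I_m.+1) (j : 'I_l.+1) (p : 'I_m.+1) (q : 'I_l.+1) n :
  (i < p)%N -> (j < q)%N -> Ccone (@gvec m l i j p q *+ n).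
Proof.
move=> ip jq; exists (fun i' j' p' q' => if (i', j', p', q') == (i, j, p, q) then n else 0%N).
rewrite (bigD1 i) //= [X in _ = _ + X]big1 ?addr0; last first.
  by move=> i' ni; do 3!(apply: big1 => ? _); rewrite !xpair_eqE (negPf ni).
rewrite (bigD1 j) //= [X in _ = _ + X]big1 ?addr0; last first.
  by move=> j' ni; do 2!(apply: big1 => ? _); rewrite !xpair_eqE (negPf ni) andbF.
rewrite (bigD1 p) //= [X in _ = _ + X]big1 ?addr0; last first.
  by move=> p' /andP[_ ni]; apply: big1 => ? _; rewrite !xpair_eqE (negPf ni) andbF.
rewrite (bigD1 q) //= [X in _ = _ + X]big1 ?addr0 ?eqxx //.
by move=> q' /andP[_ ni]; rewrite !xpair_eqE (negPf ni) andbF.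
Qed.

Lemma corner_decompz u i j : Llat u ->
  u i j = \sum_k \sum_h corner (fun i j => u i j) k h * bco k h i j.
Proof.
move=> /LlatP /corner_decomp ->; apply: eq_bigr => k _; apply: eq_bigr => h _.
by rewrite intz.
Qed.

(** Corner sums are the coordinates in B, and the elements of B are among the generators of C(w). *)
Lemma cone_Ccone u : cone u -> Ccone u.
Proof.
move=> [Lu c0].
have -> : u = \sum_k \sum_h bvec k h *+ `|corner (fun i j => u i j) k h|%N.
  apply/matrixP => i j; rewrite (corner_decompz _ _ Lu) summxE; apply: eq_bigr => k _.
  rewrite summxE; apply: eq_bigr => h _; rewrite mulmxnE bvecE -mulr_natr natz.
  by rewrite gez0_abs // mulrC.
apply: (big_ind (@Ccone m l)); [exact: Ccone0|exact: CconeD|move=> k _].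
apply: (big_ind (@Ccone m l)); [exact: Ccone0|exact: CconeD|move=> h _].
by apply: Ccone_gvec; rewrite /= /bump /= add1n.
Qed.

(** The negative support contains the support of some initial term d_ij d_pq. *)
Definition strict u := [exists ij : 'I_m.+1 * 'I_l.+1, [exists pq : 'I_m.+1 * 'I_l.+1,
  [&& (ij.1 < pq.1)%N, (ij.2 < pq.2)%N, u ij.1 ij.2 < 0 & u pq.1 pq.2 < 0]]].

Lemma strictP u : reflect (exists (i : 'I_m.+1) (j : 'I_l.+1) (p : 'I_m.+1) (q : 'I_l.+1),
  [/\ (i < p)%N, (j < q)%N, u i j < 0 & u p q < 0])
  (strict u).
Proof.
apply: (iffP existsP) => [[[i j] /existsP[[p q] /and4P[]]]|[i [j [p [q [h1 h2 h3 h4]]]]]].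
  by move=> /= h1 h2 h3 h4; exists i, j, p, q.
by exists (i, j); apply/existsP; exists (p, q); rewrite /= h1 h2 h3 h4.
Qed.

(* The corner sum at (k, h) equals the sum over the opposite corner; without a
   strict pair of negative entries one of the two has no negative entry. *)
Lemma nonstrict_cone u : Llat u -> ~~ strict u -> cone u.
Proof.
move=> Lu ns; split=> // k h.
have [/existsP[[i j] /= /and3P[ik jh uij]]|] :=
  boolP [exists ij : 'I_m.+1 * 'I_l.+1, [&& (ij.1 <= k)%N, (ij.2 <= h)%N & u ij.1 ij.2 < 0]].
  rewrite corner_compl; last exact/LlatP.
  apply: sumr_ge0 => p kp; apply: sumr_ge0 => q hq; rewrite leNgt.
  apply: contra ns => upq; apply/strictP; exists i, j, p, q.
  by split=> //; [exact: leq_ltn_trans kp|exact: leq_ltn_trans hq].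
rewrite negb_exists => /forallP H; apply: sumr_ge0 => i ik; apply: sumr_ge0 => j jh.
by have := H (i, j); rewrite /= ik jh /= -leNgt.
Qed.

(** Strictness depends on the negative support alone, so [nonstrict_cone] applies to every element
    of L with the same negative support. *)
Lemma nonstrict_Lprime u : Llat u -> ~~ strict u -> Lprime u.
Proof.
move=> Lu ns; split=> //; split; first by exists u.
move=> v Lv nE; apply/cone_Ccone/nonstrict_cone => //.
apply: contra ns => /strictP[i [j [p [q [h1 h2 h3 h4]]]]].
have E i' j' : (v i' j' < 0) = (u i' j' < 0).
  by have /setP/(_ (i', j')) := nE; rewrite !inE.
by apply/strictP; exists i, j, p, q; rewrite -!E.
Qed.

Definition cdeg u (k : 'I_m * 'I_l) : nat := `|corner (fun i j => u i j) k.1 k.2|%N.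

Lemma cone_entryE u i j : cone u -> u i j = \sum_k (cdeg u k)%:Z * bco k.1 k.2 i j.
Proof.
move=> [Lu c0]; rewrite (corner_decompz _ _ Lu) pair_bigA /=; apply: eq_bigr => k _.
by rewrite gez0_abs.
Qed.

Lemma cdeg_inj u v : cone u -> cone v -> cdeg u =1 cdeg v -> u = v.
Proof.
move=> cu cv E; apply/matrixP => i j; rewrite !cone_entryE //.
by apply: eq_bigr => k _; rewrite E.
Qed.

Lemma absz_bco_le1 k h i j : (`|@bco m l k h i j| <= 1)%N.
Proof.
have s n (k' : 'I_n) i' : (`|stepco k' i'| <= 1)%N.
  rewrite /stepco; case: eqP => [->|_]; case: eqP => //.
by rewrite /bco abszM (leq_mul (s _ _ _) (s _ _ _)).
Qed.

Lemma cone_entry_le u i j : cone u -> (`|u i j| <= mdeg cdeg u)%N.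
Proof.
move=> cu; rewrite (cone_entryE _ _ cu) /mdeg.
elim/big_rec2: _ => [|k n z _ IH] //.
have := absz_bco_le1 k.1 k.2 i j; move: (bco _ _ _ _) (cdeg u k) => b c; nia.
Qed.

Lemma cone0 : cone 0.
Proof.
split; first by apply/LlatP; split=> i; rewrite big1 // => j _; rewrite mxE.
by move=> k h; apply: sumr_ge0 => i _; apply: sumr_ge0 => j _; rewrite mxE.
Qed.

Lemma mdeg_gt0 u : cone u -> u != 0 -> (0 < mdeg cdeg u)%N.
Proof.
move=> cu; rewrite lt0n; apply: contraNN => /eqP E; apply/eqP/matrixP => i j.
by have := cone_entry_le i j cu; rewrite E leqn0 absz_eq0 mxE => /eqP.
Qed.

End Lattice.

(** * Convergence of sums over the cone *)

Section GeometricSums.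
Variable R : realType.

Lemma geometric_le2 (r : R) n : 0 <= r -> r <= 2^-1 -> \sum_(k < n) r ^+ k <= 2.
Proof.
move=> r0 r1; elim: n => [|n IH]; first by rewrite big_ord0.
rewrite big_ord_recl expr0.
have -> : \sum_(i < n) r ^+ lift ord0 i = r * \sum_(i < n) r ^+ i.
  by rewrite mulr_sumr; apply: eq_bigr => i _; rewrite -exprS.
have : r * (\sum_(i < n) r ^+ i) <= 2^-1 * 2.
  by apply: ler_pM => //; apply: sumr_ge0 => i _; exact: exprn_ge0.
lra.
Qed.

(** The coordinates in B embed the cone in the vectors of natural numbers. A finite part lies in a
    box, and the sum over a box is a product of geometric sums, each at most 2. *)
Lemma cone_geometric m l (r : R) (s : seq 'M[int]_(m.+1, l.+1)) :
  0 <= r -> r <= 2^-1 -> uniq s -> (forall u, u \in s -> cone u) ->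
  \sum_(u <- s) r ^+ mdeg (@cdeg m l) u <= 2 ^+ #|{: 'I_m * 'I_l}|.
Proof.
move=> r0 r1 us cs.
pose N := \max_(u <- s) \max_k cdeg u k.
have hN u k : u \in s -> (cdeg u k < N.+1)%N.
  move=> su; rewrite ltnS /N; apply: leq_trans (leq_bigmax_seq _ su isT).
  exact: (leq_bigmax k).
pose phi u : {ffun 'I_m * 'I_l -> 'I_N.+1} := [ffun k => inord (cdeg u k)].
pose G (f : {ffun 'I_m * 'I_l -> 'I_N.+1}) : R := \prod_k r ^+ f k.
have GE u : u \in s -> r ^+ mdeg (@cdeg m l) u = G (phi u).
  move=> su; rewrite /mdeg expr_sum; apply: eq_bigr => k _.
  by rewrite ffunE inordK // hN.
rewrite (eq_big_seq _ GE) -(big_map phi xpredT).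
have up : uniq (map phi s).
  rewrite map_inj_in_uniq // => u v su sv E; apply: cdeg_inj; try exact: cs.
  move=> k; have /ffunP/(_ k) := E; rewrite !ffunE => /(congr1 val) /=.
  by rewrite !inordK ?hN.
rewrite big_uniq //=.
have G0 f : 0 <= G f by apply: prodr_ge0 => k _; exact: exprn_ge0.
apply: le_trans (_ : \sum_f G f <= _).
  by rewrite [leRHS](bigID (mem (map phi s))) /= lerDl sumr_ge0.
rewrite /G -(bigA_distr_bigA (fun k (n : 'I_N.+1) => r ^+ n)) /=.
rewrite -prodr_const; apply: ler_prod => k _; rewrite geometric_le2 //.
by rewrite sumr_ge0 // => i _; exact: exprn_ge0.
Qed.

Lemma leq_bin_exp n k : ('C(n, k) <= 2 ^ n)%N.
Proof.
elim: n k => [|n IH] [|k] //; first by rewrite bin0 expn_gt0.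
by rewrite binS expnS mul2n -addnn leq_add.
Qed.

(** (n + 1)^p is at most p! times the binomial coefficient of p + n over p. Polynomial weights can
    thus be traded for a geometric factor. *)
Lemma pow_le_exp2 p n : (n.+1 ^ p <= p`! * 2 ^ p * 2 ^ n)%N.
Proof.
rewrite -mulnA -expnD; apply: leq_trans (_ : p`! * 'C(p + n, p) <= _)%N; last first.
  by rewrite leq_mul2l leq_bin_exp orbT.
rewrite mulnC bin_ffact ffact_prod.
have -> : (n.+1 ^ p = \prod_(i < p) n.+1)%N by rewrite prod_nat_const card_ord.
apply: leq_prod => i _; have := ltn_ord i; lia.
Qed.

(** Of the factor 4, one factor 2 absorbs the polynomial weight by [pow_le_exp2], and the other
    leaves a ratio of at most 1/2. *)
Lemma moments_bound m l (A : 'M[int]_(m.+1, l.+1) -> R[i]) (D k rho : R) q :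
  0 <= D -> 0 <= k -> 0 <= rho -> 4 * (k * rho) <= 1 ->
  (forall u, ~ cone u -> A u = 0) ->
  (forall u, cone u -> cabs (A u) <=
     D * ((1 + (mdeg (@cdeg m l) u)%:R) ^+ q * k ^+ mdeg (@cdeg m l) u)) ->
  moments (@cdeg m l) rho A.
Proof.
move=> D0 k0 rho0 kr A0 hA p; set n := mdeg _.
pose E : R := D * ((p + q)`! * 2 ^ (p + q))%:R.
exists (E * 2 ^+ #|{: 'I_m * 'I_l}|) => F.
rewrite (bigID (fun u => u \in @cone m l)) /= [X in _ + X]big1 ?addr0; last first.
  move=> u /negP nu; rewrite A0 ?mul0r ?cabs0 // => cu; apply: nu; exact: mem_set.
have E0 : 0 <= E by rewrite mulr_ge0.
have r0 : 0 <= 2 * (k * rho) by rewrite !mulr_ge0.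
have r1 : 2 * (k * rho) <= 2^-1 by lra.
apply: le_trans (_ : \sum_(u <- F | u \in @cone m l) E * (2 * (k * rho)) ^+ n u <= _).
  apply: ler_sum => u /set_mem cu; rewrite cabsM cabsR ger0_norm; last first.
    by rewrite mulr_ge0 ?exprn_ge0 ?addr_ge0.
  apply: le_trans (ler_wpM2r _ (hA u cu)) _.
    by rewrite mulr_ge0 ?exprn_ge0 ?addr_ge0.
  rewrite -/(n u).
  have -> : D * ((1 + (n u)%:R) ^+ q * k ^+ n u) * ((1 + (n u)%:R) ^+ p * rho ^+ n u) =
    D * (((1 + (n u)%:R) ^+ (p + q)) * (k * rho) ^+ n u).
    rewrite exprD exprMn; move: ((1 + _) ^+ q) ((1 + _) ^+ p) (k ^+ _) (rho ^+ _).
    by move=> a b c d; ring.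
  rewrite /E -mulrA ler_wpM2l // [(2 * _) ^+ _]exprMn mulrA ler_wpM2r ?exprn_ge0 ?mulr_ge0 //.
  by rewrite nat1r -natrX -natrX -natrM ler_nat pow_le_exp2.
rewrite -mulr_sumr ler_wpM2l // -big_filter.
apply: cone_geometric => //; first by rewrite filter_uniq ?fset_uniq.
by move=> u; rewrite mem_filter => /andP[/set_mem].
Qed.

End GeometricSums.

(** * Monomials with integer exponents and derivatives in the parameters *)

Section IntegerMonomials.
Variables (R : realType) (a b : nat).
Local Notation C := R[i].
Implicit Types (v u : 'M[int]_(a, b)) (x : 'M[C]_(a, b)).

Definition xpow v x : C := \prod_i \prod_j x i j ^ v i j.

Lemma xpow0 x : xpow 0 x = 1.
Proof. by rewrite /xpow !big1 // => i _; rewrite big1 // => j _; rewrite mxE expr0z. Qed.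

Lemma xpowD x v u : (forall i j, x i j != 0) -> xpow (v + u) x = xpow v x * xpow u x.
Proof.
move=> x0; rewrite /xpow -big_split /=; apply: eq_bigr => i _.
by rewrite -big_split /=; apply: eq_bigr => j _; rewrite mxE expfzDr.
Qed.

Lemma xpowN x v : (forall i j, x i j != 0) -> xpow (- v) x = (xpow v x)^-1.
Proof.
move=> x0; rewrite /xpow -prodfV; apply: eq_bigr => i _.
by rewrite -prodfV; apply: eq_bigr => j _; rewrite mxE -invr_expz.
Qed.

Lemma xpow_delta x i j : xpow (delta_mx i j) x = x i j.
Proof.
rewrite /xpow (bigD1 i) //= (bigD1 j) //= mxE !eqxx expr1z !big1 ?mulr1 //.
  by move=> i' /negPf ni; apply: big1 => j' _; rewrite mxE ni expr0z.
by move=> j' /negPf nj; rewrite mxE nj andbF expr0z.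
Qed.

Lemma logder_xpow x d v : (forall i j, x i j != 0) ->
  logder x d (xpow v) (v d.1 d.2)%:~R.
Proof.
move=> x0.
have -> : ((v d.1 d.2)%:~R : C) = \sum_i \sum_j (v i j)%:~R * ((i, j) == d)%:R.
  rewrite (bigD1 d.1) //= (bigD1 d.2) //= -surjective_pairing eqxx mulr1 !big1 ?addr0 //.
    move=> i ni; apply: big1 => j _; case: (d) ni => d1 d2 /= ni.
    by rewrite xpair_eqE (negPf ni) mulr0.
  move=> j nj; case: (d) nj => d1 d2 /= nj.
  by rewrite xpair_eqE (negPf nj) andbF mulr0.
apply: logder_prod => i; apply: logder_prod => j.
apply: (@logder_expz _ _ _ _ _ (fun y : 'M[C]_(a, b) => y i j)); first exact: x0.
split; first exact: diff_coord.
rewrite pd_coord; case: eqP => [<-|_] /=; last by rewrite !mul0r.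
by rewrite mul1r mulVf.
Qed.

Lemma xpow_sum (I : Type) (s : seq I) (v : I -> 'M[int]_(a, b)) x :
  (forall i j, x i j != 0) -> xpow (\sum_(k <- s) v k) x = \prod_(k <- s) xpow (v k) x.
Proof.
move=> x0; elim: s => [|k s IH]; first by rewrite !big_nil xpow0.
by rewrite !big_cons xpowD // IH.
Qed.

Lemma xpowMn x v n : (forall i j, x i j != 0) -> xpow (v *+ n) x = xpow v x ^+ n.
Proof.
move=> x0; elim: n => [|n IH]; first by rewrite mulr0n expr0 xpow0.
by rewrite mulrS exprS xpowD // IH.
Qed.

End IntegerMonomials.

Section ConeMonomials.
Variables (R : realType) (m l : nat) (eps : R) (U : set 'M[R[i]]_(m.+1, l.+1)).
Local Notation C := R[i].
Local Notation V := ('M[C]_(m.+1, l.+1)).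
Implicit Types (x : V) (u : 'M[int]_(m.+1, l.+1)).
Local Notation K := ('I_m * 'I_l)%type.

Lemma xpow_gvec x i j p q : (forall i j, x i j != 0) ->
  xpow (gvec i j p q) x = x i j * x p q / (x i q * x p j).
Proof.
move=> x0; rewrite /gvec !(xpowD _ _ x0, xpowN _ x0, xpow_delta).
by rewrite invfM mulrA.
Qed.

(** The variables of the power series: on the convergence domain these monomials have modulus < eps,
    and x^u for u in the cone is a monomial in them, see [xpow_cone]. *)
Definition Zc (k : K) (x : V) : C := xpow (bvec k.1 k.2) x.

Lemma gvec_lt x (i p : 'I_m.+1) (j q : 'I_l.+1) : (forall i j, x i j != 0) ->
  conv_domain eps x -> (i < p)%N -> (j < q)%N -> cabs (xpow (gvec i j p q) x) < eps.
Proof.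
move=> x0 cx ip jq; rewrite xpow_gvec // cabsM cabsV.
rewrite ltr_pdivrMr ?cabs_gt0 ?mulf_neq0 //.
have := cx _ _ _ _ ip jq; rewrite !normE -rmorphM ltcR; exact.
Qed.

Lemma Zc_lt k x : (forall i j, x i j != 0) -> conv_domain eps x -> cabs (Zc k x) < eps.
Proof. by move=> x0 cx; apply: gvec_lt => //=; rewrite /bump /= add1n. Qed.

Definition wc (k : K) (d : 'I_m.+1 * 'I_l.+1) : C := (bvec k.1 k.2 d.1 d.2)%:~R.

Lemma logder_Zc k x d : (forall i j, x i j != 0) -> logder x d (Zc k) (wc k d).
Proof. exact: logder_xpow. Qed.

Lemma cone_sumE u : cone u -> u = \sum_k bvec k.1 k.2 *+ cdeg u k.
Proof.
move=> cu; apply/matrixP => i j; rewrite (cone_entryE _ _ cu) summxE.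
by apply: eq_bigr => k _; rewrite mulmxnE bvecE -mulr_natr natz mulrC.
Qed.

Lemma xpow_cone u x : (forall i j, x i j != 0) -> cone u ->
  xpow u x = mono (@cdeg m l) Zc u x.
Proof.
move=> x0 cu; rewrite {1}(cone_sumE cu) xpow_sum //.
by apply: eq_bigr => k _; rewrite xpowMn.
Qed.

Lemma mweight_cone u d : cone u -> mweight (@cdeg m l) wc u d = (u d.1 d.2)%:~R.
Proof.
move=> cu; rewrite [in RHS](cone_sumE cu) summxE rmorph_sum /=; apply: eq_bigr => k _.
by rewrite mulmxnE rmorphMn /= mulr_natl.
Qed.

End ConeMonomials.

Section Functionals.
Variables (R : realType) (a b : nat).
Local Notation C := R[i].
Local Notation V := ('M[C]_(a, b)).
Local Notation I := ('I_a * 'I_b)%type.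
Variable W : set V.
Hypotheses (oW : open W) (W0 : W 0).
Implicit Types (f g : V -> C) (s : seq I).

Definition hol g := forall n, smooth n W g.

Lemma hol_pd g d : hol g -> hol (pd d g).
Proof. by move=> hg n; exact: (smooth_pd d (hg n.+1)). Qed.

Lemma hol_diff g x : hol g -> W x -> differentiable g x.
Proof. by move=> hg Wx; exact: (smooth_diff (hg 0%N) Wx). Qed.

Lemma holD f g : hol f -> hol g -> hol (fun y => f y + g y).
Proof. by move=> hf hg n; exact: smoothD. Qed.

Lemma holM f g : hol f -> hol g -> hol (fun y => f y * g y).
Proof. by move=> hf hg n; exact: smoothM. Qed.

Lemma hol_cst c : hol (fun=> c).
Proof. by move=> n; exact: smooth_cst. Qed.

Lemma hol_lin (G : V) : hol (linform G).
Proof.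
move=> n; apply: smooth_sum => // d _; apply: smoothM => //; first exact: smooth_cst.
exact: smooth_coord.
Qed.

Lemma pd_lin (G : V) d (x : V) : pd d (linform G) x = G d.1 d.2.
Proof.
rewrite /linform (proj1 (pd_sum _ _ _)); last first.
  move=> e _; apply: differentiableM; [exact: differentiable_cst|exact: diff_coord].
rewrite (bigD1 d) //= big1 ?addr0.
  rewrite pdM; [|exact: differentiable_cst|exact: diff_coord].
  by rewrite pd_cst mul0r add0r pd_coord -surjective_pairing eqxx mulr1.
move=> e ne; rewrite pdM; [|exact: differentiable_cst|exact: diff_coord].
by rewrite pd_cst mul0r add0r pd_coord -surjective_pairing (negPf ne) mulr0.
Qed.

Lemma lin0 (G : V) : linform G 0 = 0.
Proof. exact: linear0. Qed.

(* The sum over all subwords [t] of [s] of the modulus at 0 of the derivative of [g] along [t]: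
   a submultiplicative seminorm. *)
Fixpoint Tn s g : R :=
  if s is d :: s' then Tn s' g + Tn s' (pd d g) else cabs (g 0).

(* The derivatives at 0 of [g] times an exponential with linear exponent [lam]; see
   [pderivs_exp]. *)
Fixpoint Tl (lam : I -> C) s g : C :=
  if s is d :: s' then Tl lam s' (pd d g) + lam d * Tl lam s' g else g 0.

Lemma Tn_ext s f g : (forall y, W y -> f y = g y) -> Tn s f = Tn s g.
Proof.
elim: s f g => [|d s IH] f g E /=; first by rewrite E.
have E' y : W y -> pd d f y = pd d g y by move=> Wy; exact: pd_ext oW Wy E.
by rewrite (IH _ _ E) (IH _ _ E').
Qed.

Lemma Tl_ext lam s f g : (forall y, W y -> f y = g y) -> Tl lam s f = Tl lam s g.
Proof.
elim: s f g => [|d s IH] f g E /=; first by rewrite E.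
have E' y : W y -> pd d f y = pd d g y by move=> Wy; exact: pd_ext oW Wy E.
by rewrite (IH _ _ E) (IH _ _ E').
Qed.

Lemma Tn_ge0 s g : 0 <= Tn s g.
Proof. by elim: s g => [|d s IH] g /=; rewrite ?cabs_ge0 ?addr_ge0. Qed.

Lemma pd_cstE c d : pd d (fun=> c : C) = (fun=> 0) :> (V -> C).
Proof. by apply: funext => y; exact: pd_cst. Qed.

Lemma Tn_cst s c : Tn s (fun=> c) = cabs c.
Proof.
elim: s c => [|d s IH] c //=.
by rewrite IH pd_cstE IH cabs0 addr0.
Qed.

Lemma Tl_cst0 lam s : Tl lam s (fun=> 0) = 0.
Proof. by elim: s => [|d s IH] //=; rewrite pd_cstE IH mulr0 addr0. Qed.

Lemma TnD s f g : hol f -> hol g -> Tn s (fun y => f y + g y) <= Tn s f + Tn s g.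
Proof.
elim: s f g => [|d s IH] f g hf hg /=; first exact: cabsD.
rewrite (@Tn_ext s (pd d (fun y => f y + g y)) (fun y => pd d f y + pd d g y)).
  by rewrite addrACA lerD // IH //; exact: hol_pd.
by move=> y Wy; rewrite pdD; [|exact: hol_diff|exact: hol_diff].
Qed.

Lemma TnM s f g : hol f -> hol g -> Tn s (fun y => f y * g y) <= Tn s f * Tn s g.
Proof.
elim: s f g => [|d s IH] f g hf hg /=; first by rewrite cabsM.
rewrite (@Tn_ext s (pd d (fun y => f y * g y)) (fun y => pd d f y * g y + f y * pd d g y)).
  have hf' := hol_pd d hf; have hg' := hol_pd d hg.
  have H1 := IH _ _ hf hg; have H2 := IH _ _ hf' hg; have H3 := IH _ _ hf hg'.
  have H4 := TnD s (holM hf' hg) (holM hf hg').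
  have := mulr_ge0 (Tn_ge0 s (pd d f)) (Tn_ge0 s (pd d g)); nra.
by move=> y Wy; rewrite pdM; [|exact: hol_diff|exact: hol_diff].
Qed.

Lemma Tn_prod s (J : Type) (r : seq J) (F : J -> V -> C) : (forall j, hol (F j)) ->
  hol (fun y => \prod_(j <- r) F j y) /\
  Tn s (fun y => \prod_(j <- r) F j y) <= \prod_(j <- r) Tn s (F j).
Proof.
move=> hF; elim: r => [|j r [IH1 IH2]].
  have -> : (fun y => \prod_(j <- [::]) F j y) = fun=> 1.
    by apply: funext => y; rewrite big_nil.
  by rewrite big_nil Tn_cst cabs1; split => //; exact: hol_cst.
have -> : (fun y => \prod_(i <- j :: r) F i y) = fun y => F j y * \prod_(i <- r) F i y.
  by apply: funext => y; rewrite big_cons.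
split; first exact: holM.
rewrite big_cons; apply: le_trans (TnM s (hF j) IH1) _.
by rewrite ler_wpM2l ?Tn_ge0.
Qed.

Lemma Tn_lin s (G : V) (M : R) : (forall d, cabs (G d.1 d.2) <= M) ->
  Tn s (linform G) <= (size s)%:R * M.
Proof.
move=> hG; elim: s => [|d s IH] /=; first by rewrite lin0 cabs0 mul0r.
rewrite (_ : pd d (linform G) = fun=> G d.1 d.2); last first.
  by apply: funext => y; exact: pd_lin.
by rewrite Tn_cst -natr1 mulrDl mul1r lerD.
Qed.

Definition lamnorm (lam : I -> C) s : R := \prod_(d <- s) (1 + cabs (lam d)).

Lemma Tl_le lam s g : cabs (Tl lam s g) <= lamnorm lam s * Tn s g.
Proof.
rewrite /lamnorm; elim: s g => [|d s IH] g /=; first by rewrite big_nil mul1r.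
rewrite big_cons; apply: le_trans (cabsD _ _) _; rewrite cabsM.
have L0 : 0 <= \prod_(j <- s) (1 + cabs (lam j)).
  by apply: prodr_ge0 => j _; rewrite addr_ge0 ?cabs_ge0.
have := IH (pd d g); have := ler_wpM2l (cabs_ge0 (lam d)) (IH g).
have := mulr_ge0 L0 (Tn_ge0 s g).
have := mulr_ge0 (cabs_ge0 (lam d)) (mulr_ge0 L0 (Tn_ge0 s (pd d g))).
move: (\prod_(_ <- _) _) L0 (cabs (lam d)) (Tn s g) (Tn s (pd d g)) => L L0 c t t'.
by rewrite mulrDl mul1r mulrDr; nra.
Qed.

Lemma TlD lam s f g : hol f -> hol g ->
  Tl lam s (fun y => f y + g y) = Tl lam s f + Tl lam s g.
Proof.
elim: s f g => [|d s IH] f g hf hg //=.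
rewrite (@Tl_ext lam s (pd d (fun y => f y + g y)) (fun y => pd d f y + pd d g y)).
  by rewrite !IH ?mulrDr 1?addrACA //; exact: hol_pd.
by move=> y Wy; rewrite pdD; [|exact: hol_diff|exact: hol_diff].
Qed.

Lemma pdZ c f x d : differentiable f x -> pd d (fun y => c * f y) x = c * pd d f x.
Proof.
move=> df; rewrite pdM; [|exact: differentiable_cst|exact: df].
by rewrite pd_cst mul0r add0r.
Qed.

Lemma holZ c f : hol f -> hol (fun y => c * f y).
Proof. by move=> hf; apply: holM => //; exact: hol_cst. Qed.

Lemma TlZ lam s c f : hol f -> Tl lam s (fun y => c * f y) = c * Tl lam s f.
Proof.
elim: s f => [|d s IH] f hf //=.
rewrite (@Tl_ext lam s (pd d (fun y => c * f y)) (fun y => c * pd d f y)).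
  by rewrite !IH // ?mulrDr ?[c * (lam d * _)]mulrCA //; exact: hol_pd.
by move=> y Wy; rewrite pdZ; [|exact: hol_diff].
Qed.

(** Moving the exponential to the left turns the derivation along d into itself plus G_d. [pderivs]
    applies the last letter first whereas [Tl] consumes the first one, hence [rev]. *)
Lemma pderivs_exp (G : V) s g : hol g ->
  pderivs s (fun y => g y * cexp (linform G y)) 0 =
  Tl (fun d => G d.1 d.2) (rev s) g.
Proof.
elim/last_ind: s g => [|s d IH] g hg.
  by rewrite /= lin0 cexp0 mulr1.
rewrite rev_rcons /= pderivs_rcons.
have hg' : hol (fun y => pd d g y + G d.1 d.2 * g y).
  by apply: holD; [exact: hol_pd|exact: holZ].
have ext : forall t f h, (forall y, W y -> f y = h y) ->
    forall y, W y -> pderivs t f y = pderivs t h y.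
  elim=> [|e t IHt] f h E y Wy; first exact: E.
  by rewrite !pderivs_cons; apply: (pd_ext e oW Wy) => z Wz; exact: IHt.
rewrite (ext s _ (fun y => (pd d g y + G d.1 d.2 * g y) * cexp (linform G y))) //.
  by rewrite IH // TlD ?TlZ //; [exact: hol_pd|exact: holZ].
move=> y Wy; have dl : differentiable (linform G) y by exact: hol_diff (hol_lin G) Wy.
etransitivity; first exact: (pdM d (hol_diff hg Wy) (diff_cexp dl)).
by rewrite (pd_cexp d dl) pd_lin mulrDl; congr (_ + _); ring.
Qed.

(** A linear factor vanishes at 0 unless some letter differentiates it. *)
Lemma Tl_lin0 lam s (G : V) g : hol g -> (forall d, d \in s -> G d.1 d.2 = 0) ->
  Tl lam s (fun y => linform G y * g y) = 0.
Proof.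
elim: s g => [|d s IH] g hg hG /=; first by rewrite lin0 mul0r.
have hG' e : e \in s -> G e.1 e.2 = 0 by move=> es; apply: hG; rewrite inE es orbT.
rewrite (@Tl_ext lam s (pd d _) (fun y => linform G y * pd d g y)).
  by rewrite !IH ?mulr0 ?addr0 //; exact: hol_pd.
move=> y Wy; rewrite pdM; [|exact: hol_diff (hol_lin G) Wy|exact: hol_diff].
by rewrite pd_lin hG ?mem_head // mul0r add0r.
Qed.

(** A nonzero contribution at 0 needs one letter for each linear factor. The two letters are
    distinct since s has no repetition, and the hypothesis rules out every such pair. *)
Lemma Tl_lin2 lam s (G H : V) g : hol g -> uniq s ->
  (forall d e, d \in s -> e \in s -> d != e -> G d.1 d.2 = 0 \/ H e.1 e.2 = 0) ->
  Tl lam s (fun y => linform G y * (linform H y * g y)) = 0.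
Proof.
elim: s g => [|d s IH] g hg /=; first by rewrite lin0 mul0r.
move=> /andP[ds us] hGH.
have hGH' e e' : e \in s -> e' \in s -> e != e' -> G e.1 e.2 = 0 \/ H e'.1 e'.2 = 0.
  by move=> es fs; apply: hGH; rewrite inE ?es ?fs orbT.
have hH := hol_lin H; have hG := hol_lin G.
have nd e : e \in s -> d != e by move=> es; apply: contraNneq ds => ->.
rewrite (@Tl_ext lam s (pd d _) (fun y => (G d.1 d.2 * (linform H y * g y) +
   H d.1 d.2 * (linform G y * g y)) + linform G y * (linform H y * pd d g y))).
  rewrite TlD; last 2 first.
  - by apply: holD; apply: holZ; exact: holM.
  - by apply: holM => //; apply: holM => //; exact: hol_pd.
  rewrite !IH // ?mulr0 ?addr0; [|exact: hol_pd].
  rewrite TlD; [|by apply: holZ; exact: holM|by apply: holZ; exact: holM].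
  rewrite !TlZ; [|exact: holM|exact: holM].
  (* If d differentiates the first factor with a nonzero result, no other letter can differentiate
     the second one. *)
  have -> : G d.1 d.2 * Tl lam s (fun y => linform H y * g y) = 0.
    have [->|nG] := eqVneq (G d.1 d.2) 0; first by rewrite mul0r.
    rewrite Tl_lin0 ?mulr0 // => e es.
    have [||//|G0|//] := hGH d e; rewrite ?mem_head ?inE ?es ?orbT ?nd //.
    by rewrite G0 eqxx in nG.
  have -> : H d.1 d.2 * Tl lam s (fun y => linform G y * g y) = 0.
    have [->|nH] := eqVneq (H d.1 d.2) 0; first by rewrite mul0r.
    rewrite Tl_lin0 ?mulr0 // => e es.
    have [||||H0] := hGH e d; rewrite ?mem_head ?inE ?es ?orbT // 1?eq_sym ?nd //.
    by rewrite H0 eqxx in nH.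
  by rewrite addr0.
move=> y Wy; have dH := hol_diff hH Wy; have dG := hol_diff hG Wy.
have dg := hol_diff hg Wy.
rewrite (pdM d dG (hol_diff (holM hH hg) Wy)) (pdM d dH dg) !pd_lin; ring.
Qed.

End Functionals.

(** * The coefficients of the series *)

Section FactorialBounds.
Variable I : Type.
Implicit Types (r : seq I) (f : I -> nat).

Lemma prod_fact_le r f : (\prod_(i <- r) (f i)`! <= (\sum_(i <- r) f i)`!)%N.
Proof.
elim: r => [|i r IH]; first by rewrite !big_nil.
rewrite !big_cons; set b := (\sum_(j <- r) f j)%N in IH *.
rewrite -(bin_fact (leq_addr b (f i))) addKn mulnCA leq_mul2l.
apply/orP; right; apply: leq_trans IH _; rewrite -[leqLHS]mul1n leq_mul2r.
by rewrite bin_gt0 leq_addr orbT.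
Qed.

(** The multinomial coefficient is a product of binomial coefficients, one per index, each at most 2
    to the power of the total. *)
Lemma fact_sum_le r f : ((\sum_(i <- r) f i)`! <=
  2 ^ (size r * \sum_(i <- r) f i) * \prod_(i <- r) (f i)`!)%N.
Proof.
elim: r => [|i r IH]; first by rewrite !big_nil.
rewrite !big_cons /=; set b := (\sum_(j <- r) f j)%N in IH *.
rewrite -(bin_fact (leq_addr b (f i))) addKn mulSn expnD -mulnA.
apply: leq_mul; first exact: leq_bin_exp.
rewrite mulnCA leq_mul2l; apply/orP; right; apply: leq_trans IH _.
by rewrite leq_mul2r leq_exp2l // leq_mul2l leq_addl !orbT.
Qed.

End FactorialBounds.

Section Coefficients.
Variables (R : realType) (m l : nat).
Local Notation C := R[i].
Local Notation V := ('M[C]_(m, l)).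
Local Notation I := ('I_m * 'I_l)%type.
Local Notation Mz := ('M[int]_(m.+1, l.+1)).
Local Notation J := ('I_m.+1 * 'I_l.+1)%type.
Implicit Types (u v : Mz) (s : seq I) (y : V).

(** The coefficients of (Bs)_d as a linear form in s. *)
Definition Bform (d : J) : V := \matrix_(k, h) (bco k h d.1 d.2)%:~R.

Lemma BmulE y i j : Bmul y i j = linform (Bform (i, j)) y.
Proof.
rewrite /Bmul /linform summxE -(pair_bigA _ (fun k h => Bform (i, j) k h * y k h)) /=.
apply: eq_bigr => k _; rewrite summxE; apply: eq_bigr => h _.
by rewrite [LHS]mxE [X in _ * X]mxE bvecE [Bform _ _ _]mxE mulrC.
Qed.

Definition Wrad : R := ((#|{: I}|).+1%:R)^-1.

Lemma Wrad_gt0 : 0 < Wrad. Proof. by rewrite invr_gt0. Qed.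

(* On this ball |(Bs)_ij| < 1, so that no denominator of a coefficient vanishes. *)
Definition Wball : set V := ball (0 : V) Wrad%:C.

Lemma Wball_open : open Wball.
Proof. by apply: ball_open; rewrite ltcR Wrad_gt0. Qed.

Lemma Wball0 : Wball 0.
Proof. by apply: ballxx; rewrite ltcR Wrad_gt0. Qed.

Lemma cabs_Bform_le1 d (k : I) : cabs (Bform d k.1 k.2) <= 1.
Proof. by rewrite mxE cabs_int lern1 absz_bco_le1. Qed.

Lemma Wball_lt1 y d : Wball y -> cabs (linform (Bform d) y) < 1.
Proof.
rewrite /Wball -ball_normE /= sub0r normrN vnormE ltcR /Wrad => h.
apply: le_lt_trans (linform_le _ _) _.
have S : \sum_k cabs (Bform d k.1 k.2) <= (#|{: I}|)%:R.
  apply: le_trans (ler_sum _ (fun k _ => cabs_Bform_le1 d k)) _.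
  by rewrite sumr_const.
apply: le_lt_trans (ler_wpM2r (vnorm_ge0 y) S) _.
have c0 : 0 <= (#|{: I}|)%:R :> R by [].
apply: le_lt_trans (ler_wpM2l c0 (ltW h)) _.
by rewrite ltr_pdivrMr // mul1r ltr_nat.
Qed.

Local Notation hol := (hol Wball).

Definition negz_part (n : int) : nat := `|Num.max (- n) 0|%N.
Definition posz_part (n : int) : nat := `|Num.max n 0|%N.

Lemma posz_partP (n : nat) : posz_part n = n /\ negz_part n = 0%N.
Proof. by rewrite /posz_part /negz_part; split; lia. Qed.

Lemma negz_partP (n : nat) : posz_part (Negz n) = 0%N /\ negz_part (Negz n) = n.+1.
Proof. by rewrite /posz_part /negz_part; split; lia. Qed.

(* [phi n y] is Gamma(y + 1) / Gamma(y + n + 1). *)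
Definition phi (n : int) (y : C) : C :=
  (\prod_(k < negz_part n) (y - k%:R)) / \prod_(k < posz_part n) (y + n%:~R - k%:R).

Definition acoef v (y : V) : C := \prod_d phi (v d.1 d.2) (linform (Bform d) y).

Lemma acoefE v y : falling (Bmul y) (negpart v) /
  falling (Bmul y + map_mx intr v) (pospart v) = acoef v y.
Proof.
rewrite /falling /acoef -prodf_div; under eq_bigr do rewrite -prodf_div.
rewrite pair_bigA /=; apply: eq_bigr => -[i j] _ /=.
by rewrite /phi !mxE BmulE.
Qed.

Lemma phi_nat (n : nat) (y : C) : phi n y = (\prod_(k < n) (y + (n - k)%:R))^-1.
Proof.
have [h1 h2] := posz_partP n; rewrite /phi h1 h2 big_ord0 mul1r; congr (_^-1).
apply: eq_bigr => k _; rewrite natrB ?addrA //; exact: ltnW.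
Qed.

Lemma phi_neg (n : nat) (y : C) : phi (Negz n) y = \prod_(k < n.+1) (y - k%:R).
Proof. by have [h1 h2] := negz_partP n; rewrite /phi h1 h2 big_ord0 invr1 mulr1. Qed.

Lemma shift_neq0 (n : nat) (y : C) : cabs y < 1 -> (0 < n)%N -> y + n%:R != 0.
Proof.
move=> y1 n0; rewrite addr_eq0; apply: contraTneq y1 => ->.
by rewrite cabsN cabs_nat -leNgt ler1n.
Qed.

(** The functional equation of Gamma. For n > 0 the factor y + n has to be cancelled, and |y| < 1
    keeps it away from 0. *)
Lemma phi_pred n (y : C) : cabs y < 1 -> phi (n - 1) y = (y + n%:~R) * phi n y.
Proof.
move=> y1; case: n => [[|n]|n].
- by rewrite [0 - 1](_ : _ = Negz 0) // phi_neg phi_nat big_ord1 big_ord0 invr1 mulr1 subr0 addr0.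
- have -> : (Posz n.+1 - 1 = Posz n) by lia.
  rewrite !phi_nat big_ord_recl subn0 invfM mulVKf; last exact: shift_neq0.
  by congr (_^-1); apply: eq_bigr => k _; rewrite subSS.
- have -> : (Negz n - 1 = Negz n.+1) by lia.
  by rewrite !phi_neg [LHS]big_ord_recr /= NegzE rmorphN /= mulrC.
Qed.

(** The derivation d_ij lowers the exponent of x^(Bs+v) at d by one and produces the factor
    (Bs+v)_d; this product is again the coefficient attached to the new exponent. As v - E_d leaves
    L, arbitrary integer matrices v are allowed. *)
Lemma acoef_pred v d y : Wball y ->
  acoef (v - delta_mx d.1 d.2) y = (linform (Bform d) y + (v d.1 d.2)%:~R) * acoef v y.
Proof.
move=> Wy; rewrite /acoef (bigD1 d) //= [in RHS](bigD1 d) //= !mxE !eqxx.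
rewrite phi_pred; last exact: Wball_lt1.
rewrite -mulrA; congr (_ * (_ * _)); apply: eq_bigr => e ne; rewrite !mxE.
by case: (d) (e) ne => [i j] [i' j'] /=; rewrite xpair_eqE => /negPf->; rewrite subr0.
Qed.

Lemma hol_shift d (c : C) : hol (fun y => linform (Bform d) y + c).
Proof. by apply: holD; [exact: Wball_open|exact/hol_lin/Wball_open|exact: hol_cst]. Qed.

Lemma hol_shiftV d (n : nat) : (0 < n)%N -> hol (fun y => (linform (Bform d) y + n%:R)^-1).
Proof.
move=> n0 k; apply: smoothV; [exact: Wball_open| |exact: hol_shift].
by move=> y Wy; apply: shift_neq0 => //; exact: Wball_lt1.
Qed.

Lemma hol_prod (T : Type) (r : seq T) (F : T -> V -> C) : (forall t, hol (F t)) ->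
  hol (fun y => \prod_(t <- r) F t y).
Proof. by move=> hF n; apply: smooth_prod; [exact: Wball_open|move=> t _; exact: hF]. Qed.

Lemma hol_phi n d : hol (fun y => phi n (linform (Bform d) y)).
Proof.
case: n => n.
  have -> : (fun y => phi n (linform (Bform d) y)) =
    fun y => \prod_(k < n) (linform (Bform d) y + (n - k)%:R)^-1.
    by apply: funext => y; rewrite phi_nat prodfV.
  by apply: hol_prod => k; apply: hol_shiftV; rewrite subn_gt0.
have -> : (fun y => phi (Negz n) (linform (Bform d) y)) =
    fun y => \prod_(k < n.+1) (linform (Bform d) y + (- k%:R)).
    by apply: funext => y; rewrite phi_neg.
by apply: hol_prod => k; exact: hol_shift.
Qed.

Lemma hol_acoef v : hol (acoef v).
Proof. by apply: hol_prod => d; exact: hol_phi. Qed.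

(** At a negative entry d the coefficient has a falling factorial whose factor of index 0 is (Bs)_d;
    the cofactor g collects everything else. *)
Lemma acoef_strict v : strict v ->
  exists (i : 'I_m.+1) (j : 'I_l.+1) (p : 'I_m.+1) (q : 'I_l.+1), [/\ (i < p)%N, (j < q)%N &
  exists2 g, hol g & forall y,
    acoef v y = linform (Bform (i, j)) y * (linform (Bform (p, q)) y * g y)].
Proof.
move=> /strictP[i [j [p [q [ip jq vij vpq]]]]]; exists i, j, p, q; split=> //.
have fac (n : int) d : n < 0 -> exists2 f, hol f &
    forall y, phi n (linform (Bform d) y) = linform (Bform d) y * f y.
  case: n => // n _; exists (fun y => \prod_(k < n) (linform (Bform d) y + - (lift ord0 k)%:R)).
    by apply: hol_prod => k; exact: hol_shift.
  by move=> y; rewrite phi_neg big_ord_recl subr0.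
have [f1 h1 e1] := fac _ (i, j) vij; have [f2 h2 e2] := fac _ (p, q) vpq.
pose rest (d : J) y : C := if (d == (i, j)) || (d == (p, q)) then 1
  else phi (v d.1 d.2) (linform (Bform d) y).
exists (fun y => f1 y * (f2 y * \prod_d rest d y)).
  have oW := Wball_open; apply: holM => //; apply: holM => //; apply: hol_prod => d.
  rewrite /rest; case E: (_ || _); [exact: hol_cst|exact: hol_phi].
move=> y; have ne : (p, q) != (i, j).
  by rewrite xpair_eqE negb_and -!val_eqE (gtn_eqF ip).
rewrite /acoef (bigD1 (i, j)) //= (bigD1 (p, q)) //= e1 e2.
have -> : \prod_d rest d y = \prod_(d | (d != (i, j)) && (d != (p, q))) rest d y.
  rewrite [RHS]big_mkcond; apply: eq_bigr => d _; rewrite /rest -negb_or.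
  by case: (_ || _).
set A := \prod_(_ | _) _; set B := \prod_(_ | _) _.
have -> : A = B.
  by apply: eq_bigr => d /andP[n1 n2]; rewrite /rest (negPf n1) (negPf n2).
ring.
Qed.

(** Unlike [sigma_index], this condition is stable under reversal of the word. *)
Definition antichain s := uniq s /\ forall d e : I, d \in s -> e \in s -> d != e ->
  ~~ ((d.1 <= e.1)%N && (d.2 <= e.2)%N).

Lemma bco_neq0 (d : I) i j : bco d.1 d.2 i j != 0 ->
  [/\ (d.1 <= i)%N, (i <= d.1.+1)%N, (d.2 <= j)%N & (j <= d.2.+1)%N].
Proof.
have st n (k : 'I_n) (i' : 'I_n.+1) : stepco k i' != 0 -> (k <= i' <= k.+1)%N.
  rewrite /stepco; case: (eqVneq (i' : nat) k) => [-> _|_]; first by rewrite leqnn leqnSn.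
  by case: (eqVneq (i' : nat) k.+1) => [-> _|_]; [rewrite leqnSn leqnn|rewrite subrr].
rewrite /bco mulf_eq0 negb_or => /andP[/st/andP[h1 h2] /st/andP[h3 h4]].
by split.
Qed.

(** A letter d occurring in (Bs)_ij satisfies d <= (i, j), and a letter e occurring in (Bs)_pq
    satisfies (p, q) <= e + (1, 1). With i < p and j < q this forces d <= e, impossible for distinct
    letters of an antichain. *)
Lemma Tl_acoef_strict lam s v g : antichain s -> hol g -> strict v ->
  Tl lam s (fun y => acoef v y * g y) = 0.
Proof.
move=> [us hs] hg /acoef_strict[i [j [p [q [ip jq [f hf E]]]]]].
have oW := Wball_open.
rewrite (@Tl_ext _ _ _ _ oW Wball0 lam s _ (fun y => linform (Bform (i, j)) y *
  (linform (Bform (p, q)) y * (f y * g y)))); last first.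
  by move=> y _; rewrite E -!mulrA.
apply: (Tl_lin2 oW Wball0) => //; first exact: holM.
move=> d e ds es de; rewrite !mxE /=.
have [->|n1] := eqVneq (bco d.1 d.2 i j) 0; first by left.
have [->|n2] := eqVneq (bco e.1 e.2 p q) 0; first by right.
have [h1 _ h2 _] := bco_neq0 n1; have [_ h3 _ h4] := bco_neq0 n2.
by have := hs _ _ ds es de; rewrite negb_and => /orP[]; lia.
Qed.

Lemma sigma_antichain s : sigma_index s -> antichain s.
Proof.
rewrite /sigma_index; set rel := [rel a b : I | _] => ss.
have tr : transitive rel.
  by move=> b a c /andP[h1 h2] /andP[h3 h4]; apply/andP; split; lia.
have irr : irreflexive rel by move=> a; rewrite /= ltnn.
split; first exact: sorted_uniq tr irr _ ss.
move=> d e ds es de; have : rel d e || rel e d.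
  move: ss de; rewrite sorted_pairwise //; move: ds es.
  elim: s => // c t IH; rewrite !inE /= => /orP[/eqP->|dt] /orP[/eqP->|et] /andP[/allP h1 h2].
  - by rewrite eqxx.
  - by move=> _; apply/orP; left; exact: h1.
  - by move=> _; apply/orP; right; exact: h1.
  - exact: IH.
by rewrite /rel /= => /orP[] /andP[h1 h2]; lia.
Qed.

Lemma antichain_rev s : antichain s -> antichain (rev s).
Proof. by move=> [us hs]; split; [rewrite rev_uniq|move=> d e; rewrite !mem_rev; exact: hs]. Qed.

(** Majorant for [Tn] of h = 1 / ((Bs)_d + q): a derivative of h is a constant of modulus at most 1
    times h^2, so one more letter replaces K by K + K^2. *)
Fixpoint Kinv (n : nat) : R := if n is n'.+1 then Kinv n' + Kinv n' ^+ 2 else 1.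

Lemma Kinv_ge1 n : 1 <= Kinv n.
Proof. by elim: n => //= n IH; rewrite (le_trans IH) // lerDl sqr_ge0. Qed.

Lemma Kinv_mono n n' : (n <= n')%N -> Kinv n <= Kinv n'.
Proof.
move=> /subnK <-; elim: (n' - n)%N => [|k IH]; first by rewrite add0n.
by rewrite addSn /= (le_trans IH) // lerDl sqr_ge0.
Qed.

Lemma Tn_shiftV s d (q : nat) : (0 < q)%N ->
  Tn s (fun y => (linform (Bform d) y + q%:R)^-1) <= Kinv (size s) / q%:R.
Proof.
move=> q0; have oW := Wball_open; elim: s => [|e s IH] /=.
  by rewrite lin0 add0r cabsV cabs_nat mul1r.
set h := (fun y => _) in IH *; have hh : hol h by exact: hol_shiftV.
rewrite (@Tn_ext _ _ _ _ oW Wball0 s (pd e h) (fun y => - Bform d e.1 e.2 * (h y * h y))); last first.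
  move=> y Wy; rewrite pdV; last 2 first.
  - exact: hol_diff (hol_shift d _) Wy.
  - by apply: shift_neq0 => //; exact: Wball_lt1.
  congr (- _ * _); rewrite pdD; [|exact: hol_diff (hol_lin oW _) Wy|exact: differentiable_cst].
  by rewrite pd_cst addr0 pd_lin.
have := TnM oW Wball0 s (hol_cst _ (- Bform d e.1 e.2)) (holM oW hh hh).
rewrite (Tn_cst _ (- Bform d e.1 e.2)) cabsN => H1.
have H2 := TnM oW Wball0 s hh hh.
have t0 := Tn_ge0 s (fun y => h y * h y).
rewrite mulrDl lerD //; apply: le_trans H1 _; apply: le_trans (ler_piMl t0 (cabs_Bform_le1 d e)) _.
apply: le_trans H2 _; apply: le_trans (ler_pM (Tn_ge0 _ _) (Tn_ge0 _ _) IH IH) _.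
rewrite mulrACA -expr2 ler_wpM2l ?sqr_ge0 // ler_piMl ?invr_ge0 //.
by rewrite invf_le1 ?ltr0n // ler1n.
Qed.

(** A constant per factor of [phi]: [Kinv n] serves the denominators, and n + 1 the numerators, as n
    + k <= (n + 1)(k + 1). *)
Definition Kphi (n : nat) : R := Kinv n + (n%:R + 1).

Lemma Kphi_ge1 n : 1 <= Kphi n.
Proof. by have := Kinv_ge1 n; have : 0 <= n%:R :> R by []; rewrite /Kphi; lra. Qed.

Lemma Tn_phi s n (z : int) d : (size s <= n)%N ->
  Tn s (fun y => phi z (linform (Bform d) y)) <=
  Kphi n ^+ `|z|%N * (((negz_part z)`!)%:R / ((posz_part z)`!)%:R).
Proof.
move=> sn; have oW := Wball_open; have n0 : 0 <= n%:R :> R by [].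
have K1 := Kinv_ge1 n.
case: z => z.
  have [-> ->] := posz_partP z; rewrite fact0 mul1r absz_nat.
  have -> : (fun y => phi z (linform (Bform d) y)) =
    fun y => \prod_(k < z) (linform (Bform d) y + (z - k)%:R)^-1.
    by apply: funext => y; rewrite phi_nat prodfV.
  have hF (k : 'I_z) : hol (fun y => (linform (Bform d) y + (z - k)%:R)^-1).
    by apply: hol_shiftV; rewrite subn_gt0.
  apply: le_trans (proj2 (Tn_prod oW Wball0 s (index_enum _) hF)) _.
  apply: le_trans (_ : \prod_(k < z) (Kphi n / (z - k)%:R) <= _).
    apply: ler_prod => k _; rewrite Tn_ge0 /=.
    apply: le_trans (Tn_shiftV s d _) _; first by rewrite subn_gt0.
    rewrite ler_wpM2r ?invr_ge0 // /Kphi; have := Kinv_mono sn; lra.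
  rewrite big_split /= prodr_const card_ord prodfV -natr_prod.
  have -> : (\prod_(k < z) (z - k) = z`!)%N; last by [].
  elim: z {hF} => [|z IH]; first by rewrite big_ord0.
  by rewrite big_ord_recl subn0 factS -IH; congr (_ * _)%N; apply: eq_bigr => k _; rewrite subSS.
have [-> ->] := negz_partP z; rewrite fact0 divr1 (_ : `|Negz z|%N = z.+1) //.
have -> : (fun y => phi (Negz z) (linform (Bform d) y)) =
    fun y => \prod_(k < z.+1) (linform (Bform d) y + (- k%:R)).
    by apply: funext => y; rewrite phi_neg.
have hF (k : 'I_z.+1) : hol (fun y => linform (Bform d) y + - k%:R) by exact: hol_shift.
apply: le_trans (proj2 (Tn_prod oW Wball0 s (index_enum _) hF)) _.
apply: le_trans (_ : \prod_(k < z.+1) (Kphi n * k.+1%:R) <= _).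
  apply: ler_prod => k _; rewrite Tn_ge0 /=.
  apply: le_trans (TnD oW Wball0 s (hol_lin oW _) (hol_cst _ _)) _.
  rewrite (Tn_cst _ (- k%:R)) cabsN cabs_nat.
  have := Tn_lin s (cabs_Bform_le1 d); rewrite mulr1.
  have : (size s)%:R <= n%:R :> R by rewrite ler_nat.
  have k0 : 0 <= k%:R :> R by [].
  rewrite -natr1 /Kphi; nra.
rewrite big_split /= prodr_const card_ord -natr_prod.
have -> : (\prod_(k < z.+1) k.+1 = z.+1`!)%N; last by [].
elim: z {hF} => [|z IH]; first by rewrite big_ord1.
by rewrite big_ord_recr /= IH [RHS]factS mulnC.
Qed.

Definition ncard : nat := #|{: J}|.
Definition Kcoef (n : nat) : R := (Kphi n * (2 ^ ncard)%:R) ^+ ncard.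

Lemma Kcoef_ge1 n : 1 <= Kcoef n.
Proof.
by rewrite /Kcoef exprn_ege1 // mulr_ege1 ?Kphi_ge1 // ler1n expn_gt0.
Qed.

(** By [Tn_phi] the growth in u is geometric up to the quotient of the factorials of u_- by those of
    u_+; this quotient is geometric too because u_- and u_+ have equal total size. Entries of u are
    bounded by its degree. *)
Lemma Tn_acoef s n u : (size s <= n)%N -> cone u ->
  Tn s (acoef u) <= Kcoef n ^+ mdeg (@cdeg m l) u.
Proof.
move=> sn cu; have oW := Wball_open.
apply: le_trans (proj2 (Tn_prod oW Wball0 s (index_enum _) (fun d => hol_phi (u d.1 d.2) d))) _.
have H0 (d : J) : true -> 0 <= Tn s (fun y => phi (u d.1 d.2) (linform (Bform d) y)) <=
  Kphi n ^+ `|u d.1 d.2|%N *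
    (((negz_part (u d.1 d.2))`!)%:R / ((posz_part (u d.1 d.2))`!)%:R).
  by move=> _; rewrite Tn_ge0 Tn_phi.
apply: le_trans (_ : \prod_(d : J) (Kphi n ^+ `|u d.1 d.2|%N *
    (((negz_part (u d.1 d.2))`!)%:R / ((posz_part (u d.1 d.2))`!)%:R)) <= _).
  by apply: ler_prod => d _; exact: H0.
rewrite big_split /= big_split /= prodfV -!natr_prod -expr_sum.
pose S := (\sum_(d : J) `|u d.1 d.2|)%N; rewrite -/S.
have SE : (S <= ncard * mdeg (@cdeg m l) u)%N.
  rewrite -sum_nat_const; apply: leq_sum => d _; exact: cone_entry_le.
pose P (d : J) := posz_part (u d.1 d.2); pose N (d : J) := negz_part (u d.1 d.2).
(* The entries of u sum to 0, as u lies in L. *)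
have NP : (\sum_d N d = \sum_d P d)%N.
  have [Lu _] := cu; have /LlatP[hr _] := Lu.
  have E d : (P d)%:Z = (N d)%:Z + u d.1 d.2 by rewrite /P /N /posz_part /negz_part; lia.
  have : \sum_d (P d)%:Z = \sum_d (N d)%:Z.
    rewrite (eq_bigr _ (fun d _ => E d)) big_split /= -[X in _ + X]pair_bigA /=.
    by rewrite [X in _ + X]big1 ?addr0 // => i _; exact: hr.
  have Z (f : J -> nat) : \sum_d (f d)%:Z = (\sum_d f d)%N%:Z.
    by rewrite -[RHS]natz natr_sum; apply: eq_bigr => d _; rewrite natz.
  by rewrite !Z => -[].
have NS : (\sum_d N d <= S)%N.
  by apply: leq_sum => d _; rewrite /N /negz_part; lia.
(* The product of the N! is at most (sum N)! = (sum P)!, hence at most a power of 2 times the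
   product of the P!. *)
have H : (\prod_d (N d)`! <= 2 ^ (ncard * S) * \prod_d (P d)`!)%N.
  apply: leq_trans (prod_fact_le _ _) _; rewrite NP.
  apply: leq_trans (fact_sum_le _ _) _; rewrite leq_mul2r leq_exp2l //.
  have -> : size (index_enum J) = ncard by rewrite /ncard cardT enumT.
  by rewrite leq_mul2l -NP NS !orbT.
have P0 : (0 < \prod_d (P d)`!)%N by apply: prodn_gt0 => d; exact: fact_gt0.
apply: le_trans (_ : Kphi n ^+ S * (2 ^ (ncard * S))%:R <= _).
  rewrite ler_wpM2l ?exprn_ge0 ?(le_trans ler01 (Kphi_ge1 n)) //.
  by rewrite ler_pdivrMr ?ltr0n // -natrM ler_nat.
rewrite expnM natrX -exprMn /Kcoef -exprM ler_weXn2l //.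
by rewrite mulr_ege1 ?Kphi_ge1 // ler1n expn_gt0.
Qed.

End Coefficients.

(** * Logarithmic series over the cone *)

Section LogSeries.
Variables (R : realType) (m l : nat) (eps : R).
Variables (U : set 'M[R[i]]_(m.+1, l.+1)) (lg : 'M[R[i]]_(m.+1, l.+1) -> 'M[R[i]]_(m.+1, l.+1)).
Local Notation C := R[i].
Local Notation X := ('M[C]_(m.+1, l.+1)).
Local Notation V := ('M[C]_(m, l)).
Local Notation I := ('I_m * 'I_l)%type.
Local Notation J := ('I_m.+1 * 'I_l.+1)%type.
Local Notation Mz := ('M[int]_(m.+1, l.+1)).
Local Notation hol := (hol (@Wball R m l)).
Hypotheses (eps0 : 0 < eps) (oU : open U) (cU : U `<=` conv_domain eps)
  (hlg : log_branch U lg).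
Implicit Types (x : X) (y : V) (s : seq I) (u : Mz) (g : Mz -> V -> C).

Let oW := @Wball_open R m l.
Let W0 := @Wball0 R m l.

Lemma U_neq0 x i j : U x -> x i j != 0.
Proof. by move=> Ux; exact: (log_branch_neq0 hlg). Qed.

Lemma U_logder_Zc k x d : U x -> logder x d (@Zc R m l k) (wc R k d).
Proof. by move=> Ux; apply: logder_Zc => i j; exact: U_neq0. Qed.

Lemma U_diff_Zc k x : U x -> differentiable (@Zc R m l k) x.
Proof. by move=> Ux; exact: (proj1 (U_logder_Zc k (ord0, ord0) Ux)). Qed.

Lemma U_Zc_lt k x : U x -> cabs (@Zc R m l k x) < eps.
Proof. by move=> Ux; apply: Zc_lt (cU Ux) => i j; exact: U_neq0. Qed.

(** The exponent sum_ij log(x_ij) (Bs)_ij as a linear form in s; the coefficient of s_k is a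
    logarithm of x^(b^k). *)
Definition lamx x : V := \matrix_(k, h) \sum_(d : J) lg x d.1 d.2 * (bco k h d.1 d.2)%:~R.
Definition lam x (k : I) : C := lamx x k.1 k.2.

Lemma lamE x k : lam x k = \sum_(d : J) (bco k.1 k.2 d.1 d.2)%:~R * lg x d.1 d.2.
Proof. by rewrite /lam mxE; apply: eq_bigr => d _; rewrite mulrC. Qed.

Lemma linform_lamx x y : linform (lamx x) y = \sum_i \sum_j lg x i j * Bmul y i j.
Proof.
rewrite pair_bigA /= /linform; under [RHS]eq_bigr do rewrite BmulE /linform mulr_sumr.
rewrite exchange_big /=; apply: eq_bigr => k _; rewrite mxE mulr_suml.
by apply: eq_bigr => d _; rewrite !mxE mulrA.
Qed.

Lemma smooth_lam n k : smooth n U (fun x => lam x k).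
Proof.
have h : smooth n U (fun x => \sum_(d : J) (bco k.1 k.2 d.1 d.2)%:~R * lg x d.1 d.2).
  apply: smooth_sum => // d _; apply: smoothM => //; first exact: smooth_cst.
  exact: smooth_log_branch.
by apply: (smooth_ext oU) h => x _; rewrite lamE.
Qed.

Lemma pd_lam k x e : U x ->
  pd e (fun x => lam x k) x = Bform R e k.1 k.2 * (x e.1 e.2)^-1.
Proof.
move=> Ux.
rewrite (pd_ext e oU Ux (g := fun x => \sum_(d : J) (bco k.1 k.2 d.1 d.2)%:~R * lg x d.1 d.2));
  last by move=> z _; rewrite lamE.
have dl (d : J) : differentiable (fun y : X => lg y d.1 d.2) x /\ _ :=
  log_branch_diff oU hlg d.1 d.2 Ux.
rewrite (proj1 (pd_sum _ _ _)); last first.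
  by move=> d _; apply: differentiableM; [exact: differentiable_cst|exact: (proj1 (dl d))].
rewrite (bigD1 e) //= big1 ?addr0.
  rewrite (pdZ _ _ (proj1 (dl e))) (proj2 (dl e)) -surjective_pairing eqxx mul1r.
  by rewrite mxE.
move=> d ne; rewrite (pdZ _ _ (proj1 (dl d))) (proj2 (dl d)) -surjective_pairing (negPf ne).
by rewrite mul0r mulr0.
Qed.

(** Families g_u(s) for which sum_u g_u(s) x^(Bs+u) can be derived along up to n parameters at s = 0
    and freely in x. The theta operators preserve the class. *)
Definition Fam (n : nat) g := [/\ forall u, hol (g u), forall u, ~ cone u -> g u = (fun=> 0) &
  forall s, (size s <= n)%N -> moments (@cdeg m l) eps (fun u => (Tn s (g u))%:C)].

(** The derivative at s = 0, along the reversed word, of sum_u g_u(s) x^(Bs+u); [Tl] accounts for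
    the exponential. *)
Definition Ser s g x : C := csum (fun u => xpow u x * Tl (lam x) s (g u)).

Lemma moments_le (f h : Mz -> R) : (forall u, 0 <= f u <= h u) ->
  moments (@cdeg m l) eps (fun u => (h u)%:C) -> moments (@cdeg m l) eps (fun u => (f u)%:C).
Proof.
move=> fh mh p; apply: asum_le (mh p) => u; rewrite !cabsM ler_wpM2r ?cabs_ge0 //.
have /andP[f0 fhu] := fh u.
by rewrite !cabsR !ger0_norm // (le_trans f0).
Qed.

Lemma FamW n n' g : (n' <= n)%N -> Fam n g -> Fam n' g.
Proof. by move=> nn [h1 h2 h3]; split=> // s sn; apply: h3; exact: leq_trans nn. Qed.

Lemma Fam_pd n g a : Fam n.+1 g -> Fam n (fun u => pd a (g u)).
Proof.
move=> [h1 h2 h3]; split=> [u|u nu|s sn].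
- exact: hol_pd.
- by rewrite h2 // pd_cstE.
- have H := h3 (a :: s) sn; apply: moments_le H => u /=.
  by rewrite Tn_ge0 lerDr Tn_ge0.
Qed.

Lemma Fam_ext n g g' : (forall u, hol (g' u)) -> (forall u, ~ cone u -> g' u = (fun=> 0)) ->
  (forall u y, Wball y -> g u y = g' u y) -> Fam n g -> Fam n g'.
Proof.
move=> h1 h2 E [_ _ h3]; split=> // s sn; have := h3 s sn; congr moments.
by apply: funext => u; rewrite (Tn_ext oW W0 s (E u)).
Qed.

Lemma Fam_mul n g (q : Mz -> V -> C) : Fam n g -> (forall u, hol (q u)) ->
  (forall s, (size s <= n)%N -> exists D p, 0 <= D /\ forall u, cone u ->
     Tn s (q u) <= D * (1 + (mdeg (@cdeg m l) u)%:R) ^+ p) ->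
  Fam n (fun u y => q u y * g u y).
Proof.
move=> [h1 h2 h3] hq hD; split=> [u|u nu|s sn].
- exact: holM.
- by apply: funext => y; rewrite h2 // mulr0.
- have [D [p [D0 Hp]]] := hD s sn.
  pose B u : C := (D * (1 + (mdeg (@cdeg m l) u)%:R) ^+ p)%:C.
  have P0 u : 0 <= D * (1 + (mdeg (@cdeg m l) u)%:R) ^+ p.
    by rewrite mulr_ge0 // exprn_ge0 // addr_ge0.
  have HB u : cabs (B u) <= D * (1 + (mdeg (@cdeg m l) u)%:R) ^+ p.
    by rewrite cabsR ger0_norm.
  have H := moments_mul eps0 D0 HB (h3 s sn).
  have {H} : moments (@cdeg m l) eps
      (fun u => (D * (1 + (mdeg (@cdeg m l) u)%:R) ^+ p * Tn s (g u))%:C).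
    by move: H; congr moments; apply: funext => u; rewrite rmorphM.
  apply: moments_le => u; rewrite Tn_ge0 /=.
  have [cu|ncu] := pselect (cone u).
    apply: le_trans (TnM oW W0 s (hq u) (h1 u)) _.
    by rewrite ler_wpM2r ?Tn_ge0 // Hp.
  rewrite (_ : (fun y => q u y * g u y) = fun=> 0).
    by rewrite Tn_cst cabs0 mulr_ge0 // Tn_ge0.
  by apply: funext => y; rewrite h2 // mulr0.
Qed.

Lemma Fam_shift n g d (c : C) : Fam n g ->
  Fam n (fun u y => (linform (Bform R d) y + ((u d.1 d.2)%:~R + c)) * g u y).
Proof.
move=> hg; apply: Fam_mul => //; first by move=> u; exact: hol_shift.
move=> s sn; exists ((size s)%:R + (1 + cabs c)), 1%N; split.
  by rewrite !addr_ge0 ?cabs_ge0.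
move=> u cu; rewrite expr1.
apply: le_trans (TnD oW W0 s (hol_lin oW _) (hol_cst _ _)) _.
rewrite (Tn_cst _ ((u d.1 d.2)%:~R + c)).
have := Tn_lin s (@cabs_Bform_le1 R m l d); rewrite mulr1 => H1.
have H2 := cabsD ((u d.1 d.2)%:~R) c; rewrite cabs_int in H2.
have H3 : (`|u d.1 d.2|%N)%:R <= (mdeg (@cdeg m l) u)%:R :> R.
  by rewrite ler_nat cone_entry_le.
have := cabs_ge0 c; have s0 : 0 <= (size s)%:R :> R by [].
have N0 : 0 <= (mdeg (@cdeg m l) u)%:R :> R by [].
by move=> c0; rewrite mulrDl !mulrDr !mulr1; nra.
Qed.

Lemma cabs_xpow_le u x : cone u -> U x -> cabs (xpow u x) <= eps ^+ mdeg (@cdeg m l) u.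
Proof.
move=> cu Ux; rewrite xpow_cone //; last by move=> i j; exact: U_neq0.
by apply: mono_le => // k; apply/ltW/U_Zc_lt.
Qed.

(** The logarithms enter only through a factor independent of u, so [la] can be arbitrary; the value
    0 will give the series without logarithms. *)
Lemma Tl_summable (la : I -> C) s g x : Fam (size s) g -> U x ->
  asum (fun u => xpow u x * Tl la s (g u)).
Proof.
move=> [h1 h2 h3] Ux.
have := asumZ (lamnorm la s)%:C (h3 s (leqnn _) 0%N); apply: asum_le => u.
rewrite expr0 mul1r !cabsM !cabsR.
have L0 : 0 <= lamnorm la s by apply: prodr_ge0 => d _; rewrite addr_ge0 ?cabs_ge0.
have e0 : 0 <= eps ^+ mdeg (@cdeg m l) u by rewrite exprn_ge0 // ltW.
rewrite !ger0_norm ?Tn_ge0 //.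
have [cu|ncu] := pselect (cone u); last first.
  by rewrite h2 // Tl_cst0 cabs0 mulr0 !mulr_ge0 // Tn_ge0.
rewrite mulrA [leRHS]mulrC; apply: ler_pM; rewrite ?cabs_ge0 ?Tl_le //.
exact: cabs_xpow_le.
Qed.

Lemma Ser_summable s g x : Fam (size s) g -> U x ->
  asum (fun u => xpow u x * Tl (lam x) s (g u)).
Proof. exact: Tl_summable. Qed.

Lemma Ser_nil g x : (forall u, ~ cone u -> g u = (fun=> 0)) -> U x ->
  Ser [::] g x = series (@cdeg m l) (@Zc R m l) (fun u => g u 0) x.
Proof.
move=> h2 Ux; congr csum; apply: funext => u /=.
have [cu|ncu] := pselect (cone u); last by rewrite h2 // mulr0 mul0r.
by rewrite xpow_cone; [rewrite mulrC|move=> i j; exact: U_neq0|].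
Qed.

(** One letter either differentiates the coefficient or the exponential. By this recursion,
    smoothness and derivatives in x reduce to the empty word, a power series in the x^b. *)
Lemma Ser_cons a s g x : Fam (size s).+1 g -> U x ->
  Ser (a :: s) g x = Ser s (fun u => pd a (g u)) x + lam x a * Ser s g x.
Proof.
move=> hg Ux; rewrite /Ser -csumZ; last exact: Ser_summable (FamW (leqnSn _) hg) Ux.
rewrite -csumD.
- by congr csum; apply: funext => u /=; rewrite mulrDr [lam x a * (_ * _)]mulrCA.
- exact: Ser_summable (Fam_pd a hg) Ux.
- apply: asumZ; exact: Ser_summable (FamW (leqnSn _) hg) Ux.
Qed.

Lemma Ser_ext s g g' x : (forall u y, Wball y -> g u y = g' u y) -> Ser s g x = Ser s g' x.
Proof.
by move=> E; congr csum; apply: funext => u; rewrite (Tl_ext oW W0 (lam x) s (E u)).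
Qed.

Lemma FamD n g g' : Fam n g -> Fam n g' -> Fam n (fun u y => g u y + g' u y).
Proof.
move=> [h1 h2 h3] [k1 k2 k3]; split=> [u|u nu|s sn].
- exact: holD.
- by apply: funext => y; rewrite h2 // k2 // addr0.
- move=> p; apply: asum_le (asumD (h3 s sn p) (k3 s sn p)) => u.
  rewrite -mulrDl -rmorphD !cabsM ler_wpM2r ?cabs_ge0 // !cabsR.
  by rewrite !ger0_norm ?addr_ge0 ?Tn_ge0 // (TnD oW W0).
Qed.

Lemma FamZ n g (c : C) : Fam n g -> Fam n (fun u y => c * g u y).
Proof.
move=> hg; apply: Fam_mul => //; first by move=> u; exact: hol_cst.
move=> s sn; exists (cabs c), 0%N; split; first exact: cabs_ge0.
by move=> u _; rewrite Tn_cst expr0 mulr1.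
Qed.

Lemma SerD s g g' x : Fam (size s) g -> Fam (size s) g' -> U x ->
  Ser s (fun u y => g u y + g' u y) x = Ser s g x + Ser s g' x.
Proof.
move=> hg hg' Ux; rewrite /Ser -csumD; try exact: Ser_summable.
have [h1 _ _] := hg; have [k1 _ _] := hg'.
by congr csum; apply: funext => u; rewrite (TlD oW W0) ?mulrDr.
Qed.

Lemma SerZ s g c x : Fam (size s) g -> U x ->
  Ser s (fun u y => c * g u y) x = c * Ser s g x.
Proof.
move=> hg Ux; rewrite /Ser -csumZ; last exact: Ser_summable.
have [h1 _ _] := hg.
by congr csum; apply: funext => u; rewrite (TlZ oW W0) // mulrCA.
Qed.

Lemma Fam_eval n g : Fam n g -> moments (@cdeg m l) eps (fun u => g u 0).
Proof.
move=> [h1 h2 h3] p; have := h3 [::] (leq0n _) p; apply: asum_le => u /=.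
by rewrite !cabsM !cabsR ler_wpM2r // ger0_norm ?cabs_ge0.
Qed.

Lemma smooth_Ser n s g : Fam (size s) g -> smooth n U (Ser s g).
Proof.
elim: s g => [|a s IH] g hg.
  have H := smooth_series oU eps0 U_logder_Zc U_diff_Zc U_Zc_lt
    (fun x i j => @U_neq0 x i j) n (Fam_eval hg).
  by apply: (smooth_ext oU) H => x Ux; have [_ h2 _] := hg; rewrite Ser_nil.
have H := smoothD oU (IH _ (Fam_pd a hg))
  (smoothM oU (smooth_lam n a) (IH _ (FamW (leqnSn _) hg))).
by apply: (smooth_ext oU) H => x Ux; rewrite Ser_cons.
Qed.

Definition shift d g : Mz -> V -> C :=
  fun u y => (linform (Bform R d) y + (u d.1 d.2)%:~R) * g u y.

Lemma Fam_shift0 n g d : Fam n g -> Fam n (shift d g).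
Proof.
move=> /(Fam_shift d 0); congr (Fam _ _); apply: funext => u; apply: funext => y.
by rewrite addr0.
Qed.

Lemma pd_Ser s g x d : Fam (size s) g -> U x ->
  pd d (Ser s g) x = (x d.1 d.2)^-1 * Ser s (shift d g) x.
Proof.
elim: s g => [|a s IH] g hg Ux.
  have [_ h2 _] := hg.
  rewrite (pd_ext d oU Ux (fun z Uz => Ser_nil h2 Uz)).
  rewrite (proj2 (pd_series eps0 U_logder_Zc U_diff_Zc U_Zc_lt d (Fam_eval hg) Ux)).
  rewrite Ser_nil //; last by case: (Fam_shift0 d hg).
  congr (_ * csum _); apply: funext => u; rewrite /shift lin0 add0r.
  have [cu|ncu] := pselect (cone u); last by rewrite h2 // !mulr0.
  by rewrite mweight_cone.
have hg' := FamW (leqnSn _) hg; have hpg := Fam_pd a hg.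
have D1 : differentiable (Ser s (fun u => pd a (g u))) x.
  exact: smooth_diff (smooth_Ser 0 hpg) Ux.
have D2 : differentiable (Ser s g) x by exact: smooth_diff (smooth_Ser 0 hg') Ux.
have D3 : differentiable (fun z => lam z a) x by exact: smooth_diff (smooth_lam 0 a) Ux.
rewrite (pd_ext d oU Ux (fun z Uz => Ser_cons a hg Uz)).
rewrite (pdD d D1 (differentiableM D3 D2)) (pdM d D3 D2) (IH _ hpg Ux) (IH _ hg' Ux).
rewrite (pd_lam _ _ Ux) (Ser_cons a (Fam_shift0 d hg) Ux).
(* Deriving the factor (Bs+u)_d along s_a leaves the coefficient of s_a in (Bs)_d, which is also
   theta_d of [lam x a]: the extra terms on the two sides agree. *)
have -> : Ser s (fun u => pd a (shift d g u)) x =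
   Bform R d a.1 a.2 * Ser s g x + Ser s (shift d (fun u => pd a (g u))) x.
  rewrite -SerZ // -SerD //; [|exact: FamZ|exact: Fam_shift0].
  apply: Ser_ext => u y Wy; have [h1 _ _] := hg.
  have dl := hol_diff (hol_lin oW (Bform R d)) Wy.
  rewrite (pdM a (hol_diff (hol_shift d _) Wy) (hol_diff (h1 u) Wy)).
  by rewrite (pdD a dl (differentiable_cst _ _)) pd_cst addr0 pd_lin.
by rewrite !mulrDr; ring.
Qed.

Lemma Fam0 n : Fam n (fun (_ : Mz) (_ : V) => 0).
Proof.
split=> // [u|s sn p]; first exact: hol_cst.
have h := @asum0 R Mz; apply: asum_le h => u.
by rewrite Tn_cst cabs0 rmorph0 !(mul0r, mulr0) cabs0.
Qed.

Lemma Ser0 s x : Ser s (fun (_ : Mz) (_ : V) => 0) x = 0.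
Proof.
rewrite /Ser -[RHS](@csum0 R Mz); congr csum; apply: funext => u.
by rewrite Tl_cst0 mulr0.
Qed.

Lemma Ser_sum (T : Type) (t : seq T) (P : pred T) (h : T -> Mz -> V -> C) s :
  (forall d, Fam (size s) (h d)) ->
  Fam (size s) (fun u y => \sum_(d <- t | P d) h d u y) /\
  forall x, U x ->
  \sum_(d <- t | P d) Ser s (h d) x = Ser s (fun u y => \sum_(d <- t | P d) h d u y) x.
Proof.
move=> hF; elim: t => [|d t [IH1 IH2]].
  have -> : (fun (u : Mz) (y : V) => \sum_(d <- [::] | P d) h d u y) = fun _ _ => 0.
    by apply: funext => u; apply: funext => y; rewrite big_nil.
  by split=> [|x Ux]; [exact: Fam0|rewrite Ser0 big_nil].
have -> : (fun u y => \sum_(d <- d :: t | P d) h d u y) = fun u y =>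
    if P d then h d u y + \sum_(d <- t | P d) h d u y else \sum_(d <- t | P d) h d u y.
  by apply: funext => u; apply: funext => y; rewrite big_cons.
case Pd: (P d); last first.
  split; first exact: IH1.
  by move=> x Ux; rewrite big_cons Pd; exact: IH2.
split=> [|x Ux]; first exact: FamD.
by rewrite big_cons Pd IH2 // (SerD (hF d) IH1 Ux).
Qed.

End LogSeries.

(** * The series are solutions *)

Section WeylAction.
Variables (R : realType) (a b : nat) (U : set 'M[R[i]]_(a, b)).
Local Notation C := R[i].
Local Notation X := ('M[C]_(a, b)).
Local Notation J := ('I_a * 'I_b)%type.
Implicit Types (f g : X -> C) (x : X).

Lemma pderivs_ext (ds : seq J) f g : open U -> (forall y, U y -> f y = g y) ->
  forall y, U y -> pderivs ds f y = pderivs ds g y.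
Proof.
move=> oU E; elim: ds => [|d ds IH] y Uy; first exact: E.
by rewrite !pderivs_cons; exact: (pd_ext d oU Uy IH).
Qed.

Lemma pderivs_cat (s t : seq J) f : pderivs (s ++ t) f = pderivs s (pderivs t f).
Proof. by rewrite /pderivs foldr_cat. Qed.

Definition mword (mu : multinom (a * b)) : seq J :=
  flatten [seq flatten [seq nseq (fun_of_multinom mu (mxvec_index i j)) (i, j)
    | j <- index_enum 'I_b] | i <- index_enum 'I_a].

Lemma wact_cst1 f : wact (Wcst 1) f = f.
Proof. by apply: funext => x; rewrite /= mul1r. Qed.

Lemma wact_bigmul (T : Type) (r : seq T) (P : T -> weyl R a b) (w : T -> seq J) f :
  (forall t f, wact (P t) f = pderivs (w t) f) ->
  wact (\big[@Wmul R a b/Wcst 1]_(t <- r) P t) f = pderivs (flatten (map w r)) f.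
Proof.
move=> h; elim: r => [|t r IH]; first by rewrite big_nil wact_cst1.
by rewrite big_cons /= IH h -pderivs_cat.
Qed.

Lemma wact_Wmonom (mu : multinom (a * b)) f : wact (Wmonom R mu) f = pderivs (mword mu) f.
Proof.
apply: wact_bigmul => i {}f; apply: wact_bigmul => j {}f.
elim: (fun_of_multinom mu _) => [|n IH] /=; first exact: wact_cst1.
by rewrite IH.
Qed.

Lemma wact_bigadd (T : Type) (r : seq T) (P : T -> weyl R a b) f x :
  wact (\big[@Wadd R a b/Wcst 0]_(t <- r) P t) f x = \sum_(t <- r) wact (P t) f x.
Proof.
elim: r => [|t r IH]; first by rewrite !big_nil /= mul0r.
by rewrite !big_cons /= IH.
Qed.

Lemma wact_Wpoly (p : mpoly (a * b) C) f x : wact (Wpoly p) f x =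
  \sum_(mu <- msupp p) mcoeff mu p * pderivs (mword mu) f x.
Proof.
by rewrite wact_bigadd; apply: eq_bigr => mu _; rewrite /= wact_Wmonom.
Qed.

Lemma wact_Wd i j f : wact (Wd i j) f = pd (i, j) f.
Proof. by rewrite pdE. Qed.

Lemma wact0 P f : open U -> (forall y, U y -> f y = 0) -> forall y, U y -> wact P f y = 0.
Proof.
move=> oU; elim: P f => [c|i j|i j|P1 IH1 P2 IH2|P1 IH1 P2 IH2] f f0 y Uy.
- by rewrite /= f0 // mulr0.
- by rewrite /= f0 // mulr0.
- by rewrite wact_Wd (pd_ext (i, j) oU Uy f0) pd_cst.
- by rewrite /= IH1 // IH2 // addr0.
- by apply: IH1 => // z Uz; exact: IH2.
Qed.

Lemma sum_mword (mu : multinom (a * b)) :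
  \sum_(d <- mword mu) delta_mx d.1 d.2 =
  \matrix_(i, j) (fun_of_multinom mu (mxvec_index i j))%:Z :> 'M[int]_(a, b).
Proof.
rewrite [RHS]matrix_sum_delta /mword big_flatten /= big_map; apply: eq_bigr => i _.
rewrite big_flatten /= big_map; apply: eq_bigr => j _; rewrite mxE.
by rewrite big_nseq iter_addr_0 -natz scaler_nat.
Qed.

Definition mlin (phi : multinom (a * b) -> C) (p : mpoly (a * b) C) : C :=
  \sum_(mu <- msupp p) mcoeff mu p * phi mu.

Lemma mlinE phi p (s : seq (multinom (a * b))) : uniq s -> {subset msupp p <= s} ->
  mlin phi p = \sum_(mu <- s) mcoeff mu p * phi mu.
Proof.
move=> us ps; rewrite [RHS](bigID (fun mu => mu \in msupp p)) /= [X in _ + X]big1 ?addr0.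
  rewrite -big_filter; apply: perm_big; apply: uniq_perm.
  - exact: msupp_uniq.
  - exact: filter_uniq.
  - by move=> mu; rewrite mem_filter; case: (boolP (mu \in msupp p)) => // /ps ->.
by move=> mu /memN_msupp_eq0 ->; rewrite mul0r.
Qed.

Lemma mlinD phi p q : mlin phi (p + q) = mlin phi p + mlin phi q.
Proof.
pose s := undup (msupp p ++ msupp q); have us : uniq s by exact: undup_uniq.
rewrite !(mlinE phi us) -?big_split /=.
- by apply: eq_bigr => mu _; rewrite mcoeffD mulrDl.
- by move=> mu h; rewrite mem_undup mem_cat h orbT.
- by move=> mu h; rewrite mem_undup mem_cat h.
- by move=> mu /msuppD_le; rewrite mem_undup.
Qed.

Lemma mlin0 phi : mlin phi 0 = 0.
Proof.
rewrite (@mlinE _ _ [::]) ?big_nil // => mu.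
by rewrite mcoeff_msupp mcoeff0 eqxx.
Qed.

Lemma mlinZX phi c mu : mlin phi (c *: mpolyX C mu) = c * phi mu.
Proof.
rewrite (@mlinE _ _ [:: mu]) //.
  by rewrite big_seq1 mcoeffZ mcoeffX eqxx mulr1.
move=> nu; rewrite mcoeff_msupp mcoeffZ mcoeffX inE.
by have [_|_] := eqVneq mu nu; rewrite /= ?mulr0 ?eqxx.
Qed.

Lemma mlinN phi p : mlin phi (- p) = - mlin phi p.
Proof. by apply/eqP; rewrite -addr_eq0 -mlinD addNr mlin0. Qed.

(* A functional that identifies the two monomials of every generator of the ideal, up to
   any common factor, vanishes on the ideal. *)
Lemma mlin_ideal phi (G : set (mpoly (a * b) C)) p :
  (forall q, G q -> exists mu nu, q = mpolyX C mu - mpolyX C nu /\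
     forall k, phi (mnm_add k mu) = phi (mnm_add k nu)) ->
  ideal_gen G p -> mlin phi p = 0.
Proof.
move=> hG [s [hs ->]].
elim: s hs => [|t s IH] hs; first by rewrite big_nil mlin0.
rewrite big_cons mlinD IH ?addr0; last by move=> t' ts; apply: hs; rewrite inE ts orbT.
have [mu [nu [-> E]]] := hG _ (hs t (mem_head _ _)).
rewrite [t.1]mpolyE mulr_suml.
elim: (msupp t.1) => [|k r IHr]; first by rewrite big_nil mlin0.
rewrite big_cons mlinD IHr addr0 mulrBr mlinD mlinN -!mpoly_scaleAl -!mpolyXD !mlinZX.
by rewrite E subrr.
Qed.

End WeylAction.

Section EulerAction.
Variables (S : comNzRingType) (m l : nat).

Lemma acol_sum (F : 'I_m.+1 -> 'I_l.+1 -> S) r :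
  \sum_i \sum_j (acol i j r 0)%:~R * F i j =
  match fintype.split r with inl i => \sum_j F i j | inr j => \sum_i F i j end.
Proof.
case: (split_ordP r) => [i0 ->|j0 ->].
  rewrite (bigD1 i0) //= [X in _ + X]big1 ?addr0.
    by apply: eq_bigr => j _; rewrite !mxE !eqxx eq_lrshift /= addr0 mul1r.
  move=> i ni; apply: big1 => j _.
  by rewrite !mxE (inj_eq (@lshift_inj _ _)) eq_lrshift eq_sym (negPf ni) mul0r.
apply: eq_bigr => i _; rewrite (bigD1 j0) //= big1 ?addr0.
  by rewrite !mxE !eqxx eq_rlshift /= add0r mul1r.
move=> j nj.
by rewrite !mxE (inj_eq (@rshift_inj _ _)) eq_rlshift eq_sym (negPf nj) mul0r.
Qed.

Lemma balanced_acol (F : 'I_m.+1 -> 'I_l.+1 -> S) :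
  balanced F <-> forall r, \sum_i \sum_j (acol i j r 0)%:~R * F i j = 0.
Proof.
split=> [[h1 h2] r|H]; first by rewrite acol_sum; case: fintype.split.
split=> i.
  by have := H (lshift l.+1 i); rewrite acol_sum (unsplitK (inl i)).
by have := H (rshift m.+1 i); rewrite acol_sum (unsplitK (inr i)).
Qed.

Lemma sum_stepco1 n (k : 'I_n) : \sum_(i < n.+1) stepco k i = 0.
Proof.
rewrite /stepco sumrB (bigD1 (widen_ord (leqnSn n) k)) //= eqxx [X in _ + X - _]big1; last first.
  by move=> i; rewrite -val_eqE /= => /negPf->.
rewrite (bigD1 (lift ord0 k)) //= /bump /= add1n eqxx [X in _ - (_ + X)]big1 ?subrr //.
by move=> i; rewrite -val_eqE /= /bump /= add1n => /negPf->.
Qed.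

Lemma balanced_bco (k : 'I_m) (h : 'I_l) : balanced (bco k h).
Proof.
split=> i; rewrite /bco.
  by rewrite -mulr_sumr sum_stepco1 mulr0.
by rewrite -mulr_suml sum_stepco1 mul0r.
Qed.

End EulerAction.

Section SeriesSolutions.
Variables (R : realType) (m l : nat) (eps : R).
Variables (U : set 'M[R[i]]_(m.+1, l.+1)) (lg : 'M[R[i]]_(m.+1, l.+1) -> 'M[R[i]]_(m.+1, l.+1)).
Local Notation C := R[i].
Local Notation X := ('M[C]_(m.+1, l.+1)).
Local Notation V := ('M[C]_(m, l)).
Local Notation I := ('I_m * 'I_l)%type.
Local Notation J := ('I_m.+1 * 'I_l.+1)%type.
Local Notation Mz := ('M[int]_(m.+1, l.+1)).
Hypotheses (eps0 : 0 < eps) (oU : open U) (cU : U `<=` conv_domain eps)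
  (hlg : log_branch U lg).
Implicit Types (x : X) (y : V) (s : seq I) (u mu : Mz).
Local Notation lam := (lam lg).
Local Notation Ser := (Ser lg).
Local Notation Fam := (@Fam R m l eps).

Let oW := @Wball_open R m l.
Let W0 := @Wball0 R m l.

(* Up to the factor x^(- mu), the coefficients of the derivative of F along [mu]. *)
Definition gm mu u : V -> C := if u \in @cone m l then acoef (u - mu) else fun=> 0.

Lemma hol_gm mu u : hol (@Wball R m l) (gm mu u).
Proof. by rewrite /gm; case: ifP => _; [exact: hol_acoef|exact: hol_cst]. Qed.

Lemma gm_out mu u : ~ cone u -> gm mu u = (fun=> 0).
Proof. by rewrite /gm; case: ifP => // /set_mem. Qed.

Lemma Fam_gm0 n : 4 * (Kcoef R m l n * eps) <= 1 -> Fam n (gm 0).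
Proof.
move=> h; split=> [u|u nu|s sn]; [exact: hol_gm|exact: gm_out|].
have K1 := Kcoef_ge1 R m l n.
apply: (@moments_bound _ _ _ _ 1 (Kcoef R m l n) _ 0%N) => //.
- exact: le_trans K1.
- exact: ltW.
- by move=> u nu; rewrite gm_out // Tn_cst cabs0.
- move=> u cu; rewrite /gm mem_set // subr0 expr0 !mul1r cabsR ger0_norm ?Tn_ge0 //.
  exact: Tn_acoef.
Qed.

Lemma gm_step mu d u y : Wball y ->
  (linform (Bform R d) y + ((u d.1 d.2)%:~R + (- (mu d.1 d.2)%:~R))) * gm mu u y =
  gm (mu + delta_mx d.1 d.2) u y.
Proof.
move=> Wy; rewrite /gm; case: ifP => _; last by rewrite mulr0.
by rewrite [in RHS]opprD [in RHS]addrA acoef_pred // !mxE rmorphB.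
Qed.

Lemma Fam_gmS n mu d : Fam n (gm mu) -> Fam n (gm (mu + delta_mx d.1 d.2)).
Proof.
move=> /(Fam_shift eps0 d (- (mu d.1 d.2)%:~R)); apply: Fam_ext.
- by move=> u; exact: hol_gm.
- by move=> u; exact: gm_out.
- by move=> u y Wy; exact: gm_step.
Qed.

Definition dFm s mu x : C := xpow (- mu) x * Ser s (gm mu) x.

(** x^(-mu) contributes - mu_d and the series (Bs+u)_d; together they form the exponent of the term
    u - mu, to which [gm_step] applies. *)
Lemma pd_dFm s mu d x : Fam (size s) (gm mu) -> U x ->
  pd d (dFm s mu) x = dFm s (mu + delta_mx d.1 d.2) x.
Proof.
move=> hF Ux; have x0 i j : x i j != 0 by exact: (log_branch_neq0 hlg).
have [D1 E1] := logder_xpow d (- mu) x0.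
have D2 := smooth_diff (smooth_Ser eps0 oU cU hlg 0 hF) Ux.
have D3 := pd_Ser eps0 oU cU hlg d hF Ux.
rewrite (pdM d D1 D2) E1 D3 /dFm.
have -> : Ser s (gm (mu + delta_mx d.1 d.2)) x =
    Ser s (shift d (gm mu)) x + (- (mu d.1 d.2)%:~R) * Ser s (gm mu) x.
  rewrite -(SerZ eps0 cU hlg _ hF Ux) -(SerD eps0 cU hlg _ _ Ux).
  - apply: Ser_ext => u y Wy; rewrite -gm_step // /shift.
    by rewrite !mulrDl addrA.
  - exact: Fam_shift0.
  - exact: FamZ.
rewrite opprD xpowD // xpowN // [xpow (- delta_mx _ _) x]xpowN // xpow_delta mxE rmorphN /=.
ring.
Qed.

Lemma Fam_gm_word n mu (w : seq J) : Fam n (gm mu) ->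
  Fam n (gm (mu + \sum_(d <- w) delta_mx d.1 d.2)).
Proof.
move=> h; elim/last_ind: w => [|w d IH]; first by rewrite big_nil addr0.
by rewrite big_rcons /= addrA; exact: Fam_gmS.
Qed.

Lemma pderivs_dFm s mu (w : seq J) : Fam (size s) (gm mu) ->
  forall x, U x -> pderivs w (dFm s mu) x = dFm s (mu + \sum_(d <- w) delta_mx d.1 d.2) x.
Proof.
elim/last_ind: w mu => [|w d IH] mu hF x Ux; first by rewrite big_nil addr0.
rewrite pderivs_rcons (pderivs_ext w oU (fun z Uz => pd_dFm d hF Uz) Ux).
by rewrite (IH _ (Fam_gmS d hF) _ Ux) big_rcons /= addrAC -addrA.
Qed.

Lemma strict_sub u mu : (forall i j, 0 <= mu i j) -> strict u -> strict (u - mu).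
Proof.
move=> mu0 /strictP[i [j [p [q [h1 h2 h3 h4]]]]]; apply/strictP; exists i, j, p, q.
by split=> //; rewrite !mxE subr_lt0; [exact: lt_le_trans h3 _|exact: lt_le_trans h4 _].
Qed.

(* Translation by mu' - mu, which lies in L, permutes the terms of the two series; outside
   the cone the terms vanish. *)
Lemma dFm_toric s mu mu' x : antichain s -> Fam (size s) (gm mu) -> Fam (size s) (gm mu') ->
  (forall i j, 0 <= mu i j) -> (forall i j, 0 <= mu' i j) -> Llat (mu' - mu) -> U x ->
  dFm s mu x = dFm s mu' x.
Proof.
move=> as_ hF hF' p p' Lm Ux; have x0 i j : x i j != 0 by exact: (log_branch_neq0 hlg).
pose f (nu : Mz) u : C := if u \in @Llat m l then
  xpow (u - nu) x * Tl (lam x) s (acoef (u - nu)) else 0.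
have E (nu : Mz) : (forall i j, 0 <= nu i j) -> Fam (size s) (gm nu) ->
    asum (f nu) /\ dFm s nu x = csum (f nu).
  move=> nu0 hN.
  have fE : f nu = fun u => xpow (- nu) x * (xpow u x * Tl (lam x) s (gm nu u)).
    apply: funext => u; rewrite /f mulrA -xpowD // [- nu + u]addrC /gm.
    have [cu|ncu] := boolP (u \in @cone m l).
      by have [Lu _] := set_mem cu; rewrite (mem_set Lu).
    rewrite Tl_cst0 mulr0; case: ifP => // /set_mem Lu.
    have su : strict u.
      by apply: contraNT ncu => ns; apply/mem_set; exact: nonstrict_cone.
    have := Tl_acoef_strict (lam x) as_ (@hol_cst R m l _ 1) (strict_sub nu0 su).
    have -> : (fun y => acoef (u - nu) y * 1) = @acoef R m l (u - nu).
      by apply: funext => y; rewrite mulr1.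
    by move=> ->; rewrite mulr0.
  have a := Ser_summable eps0 cU hlg hN Ux.
  by rewrite fE; split; [exact: asumZ|rewrite csumZ].
have [a1 ->] := E mu p hF; have [a2 ->] := E mu' p' hF'.
rewrite -(@csum_bij _ _ (fun u => u - (mu' - mu)) (fun u => u + (mu' - mu))) //.
- congr csum; apply: funext => u; rewrite /f.
  have -> : (u - (mu' - mu) \in @Llat m l) = (u \in @Llat m l).
    apply/idP/idP => /set_mem h; apply/mem_set.
      by rewrite -[u](subrK (mu' - mu)); exact: LlatD.
    by apply: LlatD => //; exact: LlatN.
  by have -> : u - (mu' - mu) - mu = u - mu' by rewrite opprB addrA addrAC addrK.
- by move=> u; rewrite subrK.
- by move=> u; rewrite addrK.
Qed.

(** If u belongs to only one of [Lprime] and [cone], it is strict and both sides vanish by the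
    antichain property. *)
Lemma dFterm_eq sigma x u : sigma_index sigma -> U x ->
  dFterm lg sigma x u = xpow u x * Tl (lam x) (rev sigma) (gm 0 u).
Proof.
move=> si Ux.
have ac := antichain_rev (sigma_antichain si).
have TE : pderivs sigma (Fterm x (lg x) u) 0 = xpow u x * Tl (lam x) (rev sigma) (acoef u).
  rewrite -(TlZ oW W0); last exact: hol_acoef.
  rewrite -(@pderivs_exp _ _ _ _ oW W0 (lamx lg x)); last by apply: holZ => //; exact: hol_acoef.
  congr pderivs; apply: funext => y; rewrite /Fterm acoefE -linform_lamx /xpow.
  by rewrite mulrA [_ * acoef u y]mulrC.
have Tst : strict u -> Tl (lam x) (rev sigma) (acoef u) = 0.
  move=> su; rewrite -(Tl_acoef_strict (lam x) ac (@hol_cst R m l _ 1) su).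
  by congr Tl; apply: funext => y; rewrite mulr1.
rewrite /dFterm /gm subr0 TE.
have [cu|ncu] := boolP (u \in @cone m l).
  case: ifPn => // nLu; rewrite Tst ?mulr0 //.
  have [Lu _] := set_mem cu.
  by apply: contraNT nLu => ns; apply/mem_set; exact: nonstrict_Lprime.
rewrite Tl_cst0 mulr0; case: ifPn => // /set_mem[Lu _]; rewrite Tst ?mulr0 //.
by apply: contraNT ncu => ns; apply/mem_set; exact: nonstrict_cone.
Qed.

Lemma dF_eq sigma x : sigma_index sigma -> U x -> dF lg sigma x = Ser (rev sigma) (gm 0) x.
Proof.
by move=> si Ux; congr summability.sum; apply: funext => u; exact: dFterm_eq.
Qed.

Lemma dF_summable sigma x : Fam (size sigma) (gm 0) -> sigma_index sigma -> U x ->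
  summable [set: Mz] (fun u => (complex.Re `|dFterm lg sigma x u|)%:E).
Proof.
move=> hF si Ux; rewrite -size_rev in hF.
have [M hM] := Ser_summable eps0 cU hlg hF Ux.
rewrite /esum.summable; apply: (@le_lt_trans _ _ M%:E); last exact: ltry.
apply: ub_ereal_sup => _ [A [finA _] <-].
rewrite fsbig_finite //= sumEFin lee_fin.
apply: le_trans (hM (fset_set A)); apply: ler_sum => u _.
by rewrite dFterm_eq // ger0_norm // cabs_ge0.
Qed.

Lemma dF_solution sigma : Fam (size sigma) (gm 0) -> sigma_index sigma ->
  solution_on U (dF lg sigma).
Proof.
move=> hF si; set s := rev sigma; rewrite -(size_rev sigma) -/s in hF.
have ac : antichain s := antichain_rev (sigma_antichain si).
have E x : U x -> dF lg sigma x = Ser s (gm 0) x by exact: dF_eq.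
have E0 x : U x -> dF lg sigma x = dFm s 0 x.
  by move=> Ux; rewrite E // /dFm oppr0 xpow0 mul1r.
split.
  apply/holomorphic_onP => n; apply: (smooth_ext oU) (smooth_Ser eps0 oU cU hlg n hF).
  by move=> x Ux; rewrite E.
move=> P; elim=> {P} [p hp|r|P Q _ IHP _ IHQ|P Q _ IHQ] x Ux.
- rewrite wact_Wpoly.
  (* The toric equations follow from [mlin_ideal] for the functional that derives the series along a
     monomial and evaluates at x: two exponents with the same image under A differ by an element of
     L, where [dFm_toric] applies. *)
  pose phi (nu : multinom (m.+1 * l.+1)) := pderivs (mword nu) (dF lg sigma) x.
  pose mat (nu : multinom (m.+1 * l.+1)) : Mz :=
    \matrix_(i, j) (fun_of_multinom nu (mxvec_index i j))%:Z.
  have phiE nu : phi nu = dFm s (mat nu) x.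
    rewrite /phi (pderivs_ext _ oU E0 Ux) (pderivs_dFm _ hF Ux) add0r.
    by rewrite sum_mword.
  have FM nu : Fam (size s) (gm (mat nu)).
    by have := Fam_gm_word (mword nu) hF; rewrite add0r sum_mword.
  rewrite -/(mlin phi p); apply: mlin_ideal hp => q [u [u' [AE ->]]].
  exists (monom u), (monom u'); split=> // k; rewrite !phiE.
  apply: dFm_toric => //; try by move=> i j; rewrite mxE.
  have -> : mat (mnm_add k (monom u')) - mat (mnm_add k (monom u)) =
      map_mx Posz u' - map_mx Posz u.
    apply/matrixP => i j; rewrite !mxE !mnmDE !mnmE !mxvecE; lia.
  exact: Amul_eq_Llat.
- rewrite /Weuler wact_bigadd.
  have -> : \sum_i wact (\big[Wadd (l:=l.+1)/Wcst 0]_j Wmul (Wcst (acol i j r 0)%:~R)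
      (Wmul (Wx i j) (Wd i j))) (dF lg sigma) x =
      \sum_i \sum_j (acol i j r 0)%:~R * Ser s (shift (i, j) (gm 0)) x.
    apply: eq_bigr => i _; rewrite wact_bigadd; apply: eq_bigr => j _.
    rewrite /= -[X in _ * (_ * X)]/(wact (Wd i j) _ x) wact_Wd (pd_ext (i, j) oU Ux E).
    rewrite (pd_Ser eps0 oU cU hlg (i, j) hF Ux) mulVKf //.
    exact: (log_branch_neq0 hlg).
  rewrite pair_bigA /=.
  pose cf (d : J) : C := (acol d.1 d.2 r 0)%:~R.
  have hF' d : Fam (size s) (fun u y => cf d * shift d (gm 0) u y).
    exact: FamZ (Fam_shift0 eps0 d hF).
  transitivity (\sum_(d : J) Ser s (fun u y => cf d * shift d (gm 0) u y) x).
    apply: eq_bigr => d _; exact: esym (SerZ eps0 cU hlg _ (Fam_shift0 eps0 d hF) Ux).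
  have [_ E1] := Ser_sum eps0 cU hlg (index_enum J) xpredT hF'.
  rewrite (E1 x Ux).
  transitivity (Ser s (fun u y => 0 * gm 0 u y) x); last first.
    by rewrite (SerZ eps0 cU hlg _ hF Ux) mul0r.
  apply: Ser_ext => u y Wy; rewrite mul0r.
  have [cu|ncu] := pselect (cone u); last first.
    by apply: big1 => d _; rewrite /shift gm_out // !mulr0.
  under eq_bigr do rewrite /shift mulrA.
  rewrite -mulr_suml.
  (* An Euler operator multiplies the coefficient of x^(Bs+u) by a row or column sum of Bs + u,
     which is 0 since B and u come from L. *)
  have bal : balanced (fun i j => linform (Bform R (i, j)) y + (u i j)%:~R : C).
    have bl : balanced (fun i j => linform (Bform R (i, j)) y : C).
      split=> i; rewrite /linform exchange_big /= big1 // => k _; rewrite -mulr_suml.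
        under eq_bigr do rewrite mxE.
        by rewrite -rmorph_sum (proj1 (balanced_bco _ _)) mul0r.
      under eq_bigr do rewrite mxE.
      by rewrite -rmorph_sum (proj2 (balanced_bco _ _)) mul0r.
    have [/LlatP[b1 b2] _] := cu; have [b3 b4] := bl.
    by split=> i; rewrite big_split /= -rmorph_sum ?b3 ?b4 ?b1 ?b2 addr0.
  have /balanced_acol/(_ r) := bal; rewrite pair_bigA /= => H.
  by rewrite (_ : \sum_(i <- _) _ = 0) ?mul0r.
- by rewrite /= IHP // IHQ // addr0.
- by rewrite /=; apply: (wact0 P oU) => // z Uz; exact: IHQ.
Qed.

End SeriesSolutions.

(** * Uniqueness of solutions *)

Section RealLines.
Variables (R : realType) (a b : nat).
Local Notation C := R[i].
Local Notation X := ('M[C]_(a, b)).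
Local Notation J := ('I_a * 'I_b)%type.
Implicit Types (f g : X -> C) (x z v h : X).

Lemma vnormD h k : vnorm (h + k) <= vnorm h + vnorm k.
Proof. by rewrite -lecR rmorphD /= -!vnormE ler_normD. Qed.

Lemma is_derive_line f z v (t : R) : differentiable f (z + t%:C *: v) ->
  is_derive t (1 : R) (fun s : R => complex.Re (f (z + s%:C *: v)))
    (complex.Re ('d f (z + t%:C *: v) v)).
Proof.
move=> df; set c := complex.Re _.
have [D E] : differentiable (fun s : R => complex.Re (f (z + s%:C *: v))) t /\
   'd (fun s : R => complex.Re (f (z + s%:C *: v))) t = ( *:%R c : R -> R) :> (R -> R).
  apply: (@diff_crit R R R _ ( *:%R c : {linear R -> R})).
    exact: scaler_continuous.
  move=> e e0; have v1 : 0 < vnorm v + 1 by rewrite ltr_wpDl // vnorm_ge0.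
  have e1 : 0 < e / (vnorm v + 1) by rewrite divr_gt0.
  have [r r0 Hr] := diff_remainder df e1.
  apply/nbhs_normP; exists (r / (vnorm v + 1)); first by rewrite /= divr_gt0.
  move=> s /=; rewrite sub0r normrN ltr_pdivlMr // => sr.
  have vs : vnorm (s%:C *: v) <= `|s| * (vnorm v + 1).
    by rewrite vnormZ cabsR ler_wpM2l // lerDl.
  have := Hr _ (le_lt_trans vs sr).
  have -> : z + t%:C *: v + s%:C *: v = z + (t + s)%:C *: v.
    by rewrite rmorphD scalerDl addrA.
  move=> H; have := le_trans (Re_le_cabs _) H.
  have -> : complex.Re (f (z + (t + s)%:C *: v) - f (z + t%:C *: v) -
      'd f (z + t%:C *: v) (s%:C *: v)) =
    complex.Re (f (z + (t + s)%:C *: v)) - complex.Re (f (z + t%:C *: v)) - c *: s.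
    rewrite linearZ /c; move: (f _) (f _) ('d f _ v) => [p1 p2] [q1 q2] [d1 d2].
    by rewrite /GRing.scale /= mul0r subr0 mulrC.
  move=> {}H; apply: le_trans H _.
  apply: le_trans (ler_wpM2l (ltW e1) vs) _.
  by rewrite mulrCA divfK ?gt_eqF // mulrC.
split; first exact: diff_derivable.
by rewrite deriveE // E /GRing.scale /= mulr1.
Qed.

Lemma is_derive_line_pd f z (d : J) (t : R) : differentiable f (z + t%:C *: delta_mx d.1 d.2) ->
  is_derive t (1 : R) (fun s : R => complex.Re (f (z + s%:C *: delta_mx d.1 d.2)))
    (complex.Re (pd d f (z + t%:C *: delta_mx d.1 d.2))).
Proof. by move=> df; rewrite (pd_diff d df); exact: is_derive_line. Qed.

Lemma mvt_line (F F' : R -> R) (s : R) : 0 <= s ->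
  (forall t, 0 <= t <= s -> is_derive t (1 : R) F (F' t)) ->
  exists2 t, 0 <= t <= s & F s - F 0 = F' t * s.
Proof.
move=> s0 H.
have [||t ts E] := @MVT_segment R F F' 0 s s0.
- move=> t; rewrite in_itv /= => /andP[t0 ts]; apply: H.
  by rewrite !ltW.
- apply: derivable_within_continuous => t; rewrite in_itv /= => ts.
  by have [] := H t ts.
- by exists t; [rewrite in_itv /= in ts|rewrite E subr0].
Qed.

Lemma sub_swap (A A' B D G : R) : A = A' -> A - B - (D - G) = A' - D - (B - G).
Proof. by move=> ->; ring. Qed.

(** The second difference over a square is the increment of p -> F p s - F p 0; one mean value
    theorem in p and one in q turn it into a mixed derivative. *)
Lemma mixed_real (F G H : R -> R -> R) (s : R) : 0 <= s ->
  (forall p q, 0 <= p <= s -> 0 <= q <= s -> is_derive p (1 : R) (F^~ q) (G p q)) ->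
  (forall p q, 0 <= p <= s -> 0 <= q <= s -> is_derive q (1 : R) (G p) (H p q)) ->
  exists p q, [/\ 0 <= p <= s, 0 <= q <= s &
    F s s - F s 0 - (F 0 s - F 0 0) = H p q * s * s].
Proof.
move=> s0 hF hG; have ss : 0 <= s <= s by rewrite s0 lexx.
have z0 : 0 <= (0 : R) <= s by rewrite lexx.
have [p hp E1] := @mvt_line (fun p => F p s - F p 0) (fun p => G p s - G p 0) s s0
  (fun p hp => is_deriveB (hF p s hp ss) (hF p 0 hp z0)).
have [q hq E2] := mvt_line s0 (hG p ^~ hp).
exists p, q; split=> //; rewrite -E2 -E1; ring.
Qed.

(** Intermediate points exist only for real functions, so f and - i f are treated separately through
    their real parts; this doubles the bound. *)
Lemma mvt_complex f z v (M : R) :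
  (forall t : R, 0 <= t <= 1 -> differentiable f (z + t%:C *: v) /\
     cabs ('d f (z + t%:C *: v) v) <= M) ->
  cabs (f (z + v) - f z) <= M + M.
Proof.
move=> H.
have part (c : C) : cabs c = 1 ->
    `|complex.Re (c * f (z + v)) - complex.Re (c * f z)| <= M.
  move=> c1; pose g y := c * f y.
  have dg y : differentiable f y -> differentiable g y /\
      forall h, 'd g y h = c * 'd f y h.
    move=> df; have D : differentiable g y.
      by apply: differentiableM; [exact: differentiable_cst|exact: df].
    split; first exact: D.
    move=> h; apply: (eq_trans (diff_pdE h D)).
    apply: (eq_trans _ (congr1 ( *%R c) (esym (diff_pdE h df)))).
    rewrite mulr_sumr; apply: eq_bigr => d _.
    by rewrite /g (pdM d (differentiable_cst (c : C) y) df) pd_cst mul0r add0r mulrA.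
  have [t t01 E] := @mvt_line (fun t : R => complex.Re (g (z + t%:C *: v)))
     (fun t => complex.Re ('d g (z + t%:C *: v) v)) 1 ler01
     (fun t ht => is_derive_line (proj1 (dg _ (proj1 (H t ht))))).
  move: E; rewrite mulr1 scale0r addr0 scale1r => ->.
  have [df hM] := H t t01; rewrite (proj2 (dg _ df)).
  by apply: le_trans (Re_le_cabs _) _; rewrite cabsM c1 mul1r.
apply: le_trans (cabs_le_ReIm _) _; apply: lerD.
  have := part 1 (cabs1 R); rewrite !mul1r; congr (`|_| <= _).
  by move: (f _) (f _) => [? ?] [? ?].
have := part (- 'i) _; rewrite cabsN; have -> : cabs ('i : C) = 1.
  by rewrite /cabs normc_def /= expr0n expr1n add0r sqrtr1.
move=> /(_ erefl); congr (`|_| <= _).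
by move: (f _) (f _) => [? ?] [? ?]; rewrite /= !(oppr0, mul0r, mulN1r, sub0r, opprK, add0r).
Qed.

Section Schwarz.
Variable U : set X.
Hypothesis oU : open U.

Lemma open_vnorm x : U x -> exists2 r : R, 0 < r & forall h, vnorm h < r -> U (x + h).
Proof.
move=> Ux; have N : \forall y \near x, U y by exact: near_open oU Ux _.
exact/near0_vnorm/near_translate.
Qed.

Lemma vcontinuous f x : differentiable f x -> forall e : R, 0 < e ->
  exists2 r : R, 0 < r & forall h, vnorm h < r -> cabs (f (x + h) - f x) < e.
Proof.
move=> /differentiable_continuous /cvgrPdist_lt cf e e0.
have e0' : (0 : C) < e%:C by rewrite ltcR.
have := cf _ e0' => /near_translate /near0_vnorm[r r0 H].
by exists r => // h /H; rewrite -cabs_lt cabsC.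
Qed.

Lemma addr_scale0 z v : z + (0 : R)%:C *: v = z.
Proof. by have -> : (0 : R)%:C = 0 :> C by []; rewrite scale0r addr0. Qed.

Lemma mixed_difference f x (d e : J) (r : R) : (forall n, smooth n U f) -> 0 < r ->
  (forall h, vnorm h < r -> U (x + h)) ->
    forall s : R, 0 < s -> s * (vnorm (delta_mx d.1 d.2 : X) + vnorm (delta_mx e.1 e.2 : X)) < r ->
    exists2 h, vnorm h < r &
    complex.Re (f (x + s%:C *: delta_mx d.1 d.2 + s%:C *: delta_mx e.1 e.2))
    - complex.Re (f (x + s%:C *: delta_mx d.1 d.2))
    - (complex.Re (f (x + s%:C *: delta_mx e.1 e.2)) - complex.Re (f x))
    = complex.Re (pd e (pd d f) (x + h)) * s * s.
Proof.
move=> sf r0 Ur s s0; set u : X := delta_mx _ _; set v : X := delta_mx _ _ => sr.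
have s00 := ltW s0; have vu := vnorm_ge0 u; have vv := vnorm_ge0 v.
have small (p q : R) : 0 <= p <= s -> 0 <= q <= s -> vnorm (p%:C *: u + q%:C *: v) < r.
  move=> /andP[p0 ps] /andP[q0 qs]; apply: le_lt_trans (vnormD _ _) _.
  rewrite !vnormZ !cabsR !ger0_norm //; apply: le_lt_trans sr.
  by rewrite mulrDr lerD // ler_wpM2r.
have inU (p q : R) : 0 <= p <= s -> 0 <= q <= s -> U (x + q%:C *: v + p%:C *: u).
  by move=> hp hq; rewrite -addrA [_ *: v + _]addrC; apply: Ur; exact: small.
have ss : 0 <= s <= s by rewrite s00 lexx.
have z0 : 0 <= (0 : R) <= s by rewrite lexx.
have inU0 (p : R) : 0 <= p <= s -> U (x + p%:C *: u).
  by move=> hp; have := inU p 0 hp z0; rewrite scale0r addr0.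
have df y : U y -> differentiable f y by move=> Uy; exact: smooth_diff (sf 0%N) Uy.
have dpf y : U y -> differentiable (pd d f) y.
  by move=> Uy; exact: smooth_diff (smooth_pd d (sf 1%N)) Uy.
have PE p q : x + p%:C *: u + q%:C *: v = x + q%:C *: v + p%:C *: u by exact: addrAC.
have [p [q [hp hq E]]] := @mixed_real
  (fun p q => complex.Re (f (x + p%:C *: u + q%:C *: v)))
  (fun p q => complex.Re (pd d f (x + p%:C *: u + q%:C *: v)))
  (fun p q => complex.Re (pd e (pd d f) (x + p%:C *: u + q%:C *: v))) s s00
  (fun p q hp hq => eq_ind_r (fun F => is_derive p (1 : R) F _)
    (eq_ind_r (fun z => is_derive p (1 : R) _ (complex.Re (pd d f z)))
      (is_derive_line_pd (df _ (inU p q hp hq))) (PE p q))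
    (funext (fun p => congr1 (fun z => complex.Re (f z)) (PE p q))))
  (fun p q hp hq => is_derive_line_pd (dpf _ (eq_ind_r U (inU p q hp hq) (PE p q)))).
exists (p%:C *: u + q%:C *: v); first exact: small.
have Q0 : x + (p%:C *: u + q%:C *: v) = x + p%:C *: u + q%:C *: v by exact: addrA.
apply: (eq_trans _ (eq_trans E
  (congr1 (fun z => complex.Re (pd e (pd d f) z) * s * s) (esym Q0)))).
exact: (f_equal3 (fun z1 z2 z3 => complex.Re (f (x + s%:C *: u + s%:C *: v)) -
  complex.Re (f z1) - (complex.Re (f z2) - complex.Re (f z3)))
  (esym (addr_scale0 _ v)) (congr1 (fun t => t + s%:C *: v) (esym (addr_scale0 x u)))
  (eq_trans (esym (addr_scale0 x u)) (esym (addr_scale0 _ v)))).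
Qed.

(** The second difference over a small square is symmetric in the two directions, so the two mixed
    derivatives coincide at points near x; continuity brings these to x. *)
Lemma schwarz_re f x (d e : J) : (forall n, smooth n U f) -> U x ->
  complex.Re (pd e (pd d f) x) = complex.Re (pd d (pd e f) x).
Proof.
move=> sf Ux; apply/eqP; rewrite -subr_eq0 -normr_le0; apply/ler_addgt0Pr => k k0; rewrite add0r.
have [r0 r00 Ur0] := open_vnorm Ux.
have D1 : differentiable (pd e (pd d f)) x.
  exact: smooth_diff (smooth_pd e (smooth_pd d (sf 2%N))) Ux.
have D2 : differentiable (pd d (pd e f)) x.
  exact: smooth_diff (smooth_pd d (smooth_pd e (sf 2%N))) Ux.
have k2 : 0 < k / 2 by rewrite divr_gt0.
have [r1 r10 H1] := vcontinuous D1 k2; have [r2 r20 H2] := vcontinuous D2 k2.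
pose r := Num.min r0 (Num.min r1 r2).
have rr : 0 < r by rewrite !lt_min r00 r10 r20.
have Ur h : vnorm h < r -> U (x + h) by rewrite !lt_min => /andP[/Ur0].
have K1 := mixed_difference (d := d) (e := e) sf rr Ur.
have K2 := mixed_difference (d := e) (e := d) sf rr Ur.
set u : X := delta_mx d.1 d.2 in K1 K2; set v : X := delta_mx e.1 e.2 in K1 K2.
set n1 := vnorm u in K1; set n2 := vnorm v in K1.
have n0 : 0 < n1 + n2 + 1 by rewrite ltr_wpDl // addr_ge0 // vnorm_ge0.
pose s := r / (n1 + n2 + 1).
have s0 : 0 < s by rewrite divr_gt0.
have sr : s * (n1 + n2) < r.
  by rewrite /s mulrAC ltr_pdivrMr // ltr_pM2l // ltrDl.
have [h1 h1r E1] := K1 s s0 sr.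
have [h2 h2r E2] := K2 s s0 (eq_ind _ (fun t => s * t < r) sr _ (addrC _ _)).
have E : complex.Re (pd e (pd d f) (x + h1)) = complex.Re (pd d (pd e f) (x + h2)).
  apply: (@mulIf _ s); first by rewrite gt_eqF.
  apply: (@mulIf _ s); first by rewrite gt_eqF.
  apply: (eq_trans (esym E1) (eq_trans _ E2)).
  have Q := congr1 (fun z => complex.Re (f z)) (addrAC x (s%:C *: u) (s%:C *: v)).
  exact: sub_swap Q.
move: h1r h2r; rewrite !lt_min => /and3P[_ /H1 h1r _] /and3P[_ _ /H2 h2r].
have c1 := le_lt_trans (Re_le_cabs _) h1r; have c2 := le_lt_trans (Re_le_cabs _) h2r.
move: c1 c2 E; move: (pd e (pd d f) x) (pd d (pd e f) x) (pd e (pd d f) _) (pd d (pd e f) _).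
move=> [a1 b1] [a2 b2] [a3 b3] [a4 b4] /= c1 c2 E.
have -> : a1 - a2 = (a4 - a2) - (a3 - a1) by rewrite E; ring.
by move: c1 c2; clear => c1 c2; apply: le_trans (ler_normB _ _) _; lra.
Qed.

Lemma schwarz f x (d e : J) : (forall n, smooth n U f) -> U x ->
  pd e (pd d f) x = pd d (pd e f) x.
Proof.
move=> sf Ux; apply/eqP; rewrite eq_complex schwarz_re // eqxx /=.
(* The imaginary part of f is the real part of - i f. *)
have sg n : smooth n U (fun y => (- 'i) * f y) by apply: smoothM => //; exact: smooth_cst.
have := schwarz_re d e sg Ux.
have E (d1 d2 : J) : pd d2 (pd d1 (fun y => (- 'i) * f y)) x = (- 'i) * pd d2 (pd d1 f) x.
  have E1 y : U y -> pd d1 (fun y => (- 'i) * f y) y = (- 'i) * pd d1 f y.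
    move=> Uy; have dfy := smooth_diff (sf 0%N) Uy.
    by rewrite (pdM d1 (differentiable_cst (- 'i : C) y) dfy) pd_cst mul0r add0r.
  rewrite (pd_ext d2 oU Ux E1).
  have dfy := smooth_diff (smooth_pd d1 (sf 1%N)) Ux.
  by rewrite (pdM d2 (differentiable_cst (- 'i : C) x) dfy) pd_cst mul0r add0r.
rewrite !E; move: (pd e _ x) (pd d _ x) => [a1 b1] [a2 b2].
by rewrite /= !(oppr0, mul0r, mulN1r, sub0r, opprK) => ->.
Qed.

End Schwarz.
End RealLines.

(** * Theta and corner operators acting on solutions *)

Section ThetaOperators.
Variables (R : realType) (m l : nat) (U : set 'M[R[i]]_(m.+1, l.+1)).
Local Notation C := R[i].
Local Notation X := ('M[C]_(m.+1, l.+1)).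
Local Notation I := ('I_m * 'I_l)%type.
Local Notation J := ('I_m.+1 * 'I_l.+1)%type.
Hypotheses (oU : open U) (x0 : forall x i j, U x -> x i j != 0).
Implicit Types (f g : X -> C) (x y : X) (d e : J) (a b : I) (w : seq I).
Local Notation hol := (hol U).

Definition th d f x : C := x d.1 d.2 * pd d f x.
Definition et a f x : C := \sum_(d : J | (d.1 <= a.1)%N && (d.2 <= a.2)%N) th d f x.

Lemma etE a f x : et a f x = corner (fun i j => th (i, j) f x) a.1 a.2.
Proof.
rewrite /corner pair_big_dep /et; apply: eq_bigr => -[i j] _ //.
Qed.

Lemma hol_th d f : hol f -> hol (th d f).
Proof.
by move=> hf n; apply: smoothM; [exact: oU|exact: smooth_coord|exact: hol_pd].
Qed.

Lemma hol_sum (T : Type) (r : seq T) (P : pred T) (F : T -> X -> C) :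
  (forall t, hol (F t)) -> hol (fun y => \sum_(t <- r | P t) F t y).
Proof. by move=> hF n; apply: smooth_sum; [exact: oU|move=> t _; exact: hF]. Qed.

Lemma hol_et a f : hol f -> hol (et a f).
Proof. by move=> hf; apply: hol_sum => d; exact: hol_th. Qed.

Lemma th_ext d f g : (forall y, U y -> f y = g y) -> forall y, U y -> th d f y = th d g y.
Proof. by move=> E y Uy; rewrite /th (pd_ext d oU Uy E). Qed.

Lemma et_ext a f g : (forall y, U y -> f y = g y) -> forall y, U y -> et a f y = et a g y.
Proof. by move=> E y Uy; apply: eq_bigr => d _; exact: th_ext. Qed.

Lemma th_sum (T : Type) (r : seq T) (P : pred T) (F : T -> X -> C) d x :
  (forall t, hol (F t)) -> U x ->
  th d (fun y => \sum_(t <- r | P t) F t y) x = \sum_(t <- r | P t) th d (F t) x.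
Proof.
move=> hF Ux; rewrite /th (proj1 (pd_sum _ _ _)) ?mulr_sumr // => t _.
exact: hol_diff (hF t) Ux.
Qed.

Lemma thM d f g x : hol f -> hol g -> U x ->
  th d (fun y => f y * g y) x = th d f x * g x + f x * th d g x.
Proof.
move=> hf hg Ux; rewrite /th (pdM d (hol_diff hf Ux) (hol_diff hg Ux)); ring.
Qed.

Lemma th_th d e f x : hol f -> U x -> th d (th e f) x =
  (d == e)%:R * th d f x + x d.1 d.2 * x e.1 e.2 * pd d (pd e f) x.
Proof.
move=> hf Ux; rewrite {1}/th /th (pdM d (diff_coord _ _ _) (hol_diff (hol_pd e hf) Ux)).
rewrite pd_coord -surjective_pairing eq_sym.
by case: eqP => [->|_] /=; ring.
Qed.

Lemma th_comm d e f x : hol f -> U x -> th d (th e f) x = th e (th d f) x.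
Proof.
move=> hf Ux; rewrite !th_th // (schwarz oU e d hf Ux) [e == d]eq_sym.
by case: eqP => [->|_]; rewrite ?mul0r // [x d.1 d.2 * _]mulrC.
Qed.

Lemma th_et d a f x : hol f -> U x -> th d (et a f) x = et a (th d f) x.
Proof.
move=> hf Ux; rewrite /et th_sum //; last by move=> e; exact: hol_th.
by apply: eq_bigr => e _; exact: th_comm.
Qed.

Lemma et_comm a b f x : hol f -> U x -> et a (et b f) x = et b (et a f) x.
Proof.
move=> hf Ux; rewrite {1}/et; under eq_bigr => d _ do rewrite th_et //.
rewrite /et exchange_big /=; apply: eq_bigr => e _; rewrite th_sum // => d.
exact: hol_th.
Qed.

Definition ew w f : X -> C := foldr et f w.

Lemma hol_ew w f : hol f -> hol (ew w f).
Proof. by move=> hf; elim: w => [|a w IH] //=; exact: hol_et. Qed.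

Lemma ew_ext w f g : (forall y, U y -> f y = g y) -> forall y, U y -> ew w f y = ew w g y.
Proof. by move=> E; elim: w => [|a w IH] //= y Uy; exact: et_ext. Qed.

Lemma ew_move a w f x : hol f -> U x -> ew (rcons w a) f x = ew (a :: w) f x.
Proof.
move=> hf; elim: w x => [|b w IH] x Ux //=.
by rewrite (et_ext b IH Ux) /= et_comm //; exact: hol_ew.
Qed.

Lemma ew_cat w w' f : ew (w ++ w') f = ew w (ew w' f).
Proof. by rewrite /ew foldr_cat. Qed.

Lemma ew_perm w w' f x : hol f -> perm_eq w w' -> U x -> ew w f x = ew w' f x.
Proof.
move=> hf; elim: w w' x => [|a w IH] w' x pw Ux.
  by have /nilP -> : nilp w' by rewrite /nilp -(perm_size pw).
have aw' : a \in w' by rewrite -(perm_mem pw) mem_head.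
case/splitPr: aw' pw => w1 w2 pw.
rewrite -cat_rcons ew_cat (ew_move _ _ (hol_ew w2 hf) Ux) /= -ew_cat.
apply: (et_ext a _ Ux) => y Uy; apply: IH => //.
by rewrite -(perm_cons a) (permPl pw) perm_catC /= perm_cons perm_catC.
Qed.

(** The expansion of (1 + sum_d theta_d)^k applied to f, with moduli taken word by word. The
    multiplicities make it submultiplicative, see [BnM]. *)
Fixpoint Bn (k : nat) f x : R :=
  if k is k'.+1 then Bn k' f x + \sum_(d : J) Bn k' (th d f) x else cabs (f x).

Lemma Bn_ge0 k f x : 0 <= Bn k f x.
Proof.
elim: k f => [|k IH] f /=; first exact: cabs_ge0.
by rewrite addr_ge0 // sumr_ge0.
Qed.

Lemma Bn_ext k f g x : (forall y, U y -> f y = g y) -> U x -> Bn k f x = Bn k g x.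
Proof.
move=> + Ux; elim: k f g => [|k IH] f g E /=; first by rewrite E.
rewrite (IH f g E); congr (_ + _); apply: eq_bigr => d _.
by apply: IH; exact: th_ext.
Qed.

Lemma BnS k f x : Bn k f x <= Bn k.+1 f x.
Proof. by rewrite /= lerDl sumr_ge0 // => d _; exact: Bn_ge0. Qed.

Lemma Bn_mono k k' f x : (k <= k')%N -> Bn k f x <= Bn k' f x.
Proof.
move=> /subnK <-; elim: (k' - k)%N => [|n IH] //.
by rewrite addSn; apply: le_trans IH _; exact: BnS.
Qed.

Lemma Bn_th k d f x : Bn k (th d f) x <= Bn k.+1 f x.
Proof.
rewrite /= (bigD1 d) //= addrCA lerDl addr_ge0 ?Bn_ge0 // sumr_ge0 // => e _.
exact: Bn_ge0.
Qed.

Lemma Bn_sum (T : Type) (r : seq T) (P : pred T) (F : T -> X -> C) k x :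
  (forall t, hol (F t)) -> U x ->
  Bn k (fun y => \sum_(t <- r | P t) F t y) x <= \sum_(t <- r | P t) Bn k (F t) x.
Proof.
move=> + Ux; elim: k F => [|k IH] F hF /=; first exact: cabs_sum.
rewrite big_split /= lerD ?IH // exchange_big /=; apply: ler_sum => d _.
have H t : hol (th d (F t)) by exact: hol_th.
by rewrite (Bn_ext k (fun y Uy => th_sum r P d hF Uy) Ux) IH.
Qed.

Lemma Bn_et k a f x : hol f -> U x -> Bn k (et a f) x <= Bn k.+1 f x.
Proof.
move=> hf Ux; apply: le_trans (Bn_sum _ _ _ _ Ux) _; first by move=> d; exact: hol_th.
rewrite /= [X in _ <= _ + X](bigID (fun d : J => (d.1 <= a.1)%N && (d.2 <= a.2)%N)) /=.
by rewrite addrCA lerDl addr_ge0 ?Bn_ge0 // sumr_ge0 // => d _; exact: Bn_ge0.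
Qed.

Lemma Bn_ew k w f x : hol f -> U x -> Bn k (ew w f) x <= Bn (k + size w) f x.
Proof.
move=> hf Ux; elim: w k => [|a w IH] k /=; first by rewrite addn0.
apply: le_trans (Bn_et k a (hol_ew w hf) Ux) _.
by apply: le_trans (IH k.+1) _; rewrite addnS addSn.
Qed.

Lemma BnD k f g x : hol f -> hol g -> U x ->
  Bn k (fun y => f y + g y) x <= Bn k f x + Bn k g x.
Proof.
move=> hf hg Ux; pose F (t : bool) := if t then f else g.
have hF t : hol (F t) by case: t.
have := Bn_sum [:: true; false] xpredT k hF Ux; rewrite !big_cons !big_nil !addr0.
by under [X in Bn _ X _]eq_fun do rewrite !big_cons !big_nil addr0.
Qed.

Lemma BnM k f g x : hol f -> hol g -> U x ->
  Bn k (fun y => f y * g y) x <= Bn k f x * Bn k g x.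
Proof.
move=> + + Ux; elim: k f g => [|k IH] f g hf hg /=; first by rewrite cabsM.
set Sf := \sum_d Bn k (th d f) x; set Sg := \sum_d Bn k (th d g) x.
have f0 := Bn_ge0 k f x; have g0 := Bn_ge0 k g x.
have Sf0 : 0 <= Sf by apply: sumr_ge0 => d _; exact: Bn_ge0.
have Sg0 : 0 <= Sg by apply: sumr_ge0 => d _; exact: Bn_ge0.
have H : \sum_d Bn k (th d (fun y => f y * g y)) x <= Sf * Bn k g x + Bn k f x * Sg.
  rewrite mulr_suml mulr_sumr -big_split /=; apply: ler_sum => d _.
  rewrite (Bn_ext k (fun y Uy => thM d hf hg Uy) Ux).
  have h1 := hol_th d hf; have h2 := hol_th d hg.
  apply: le_trans (BnD k (holM oU h1 hg) (holM oU hf h2) Ux) _.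
  by rewrite lerD // IH.
have := IH f g hf hg; nra.
Qed.

Definition euler_balanced f :=
  forall x, U x -> balanced (fun i j => th (i, j) f x).

(** The theta operators commute, so theta-derivatives inherit the Euler equations. *)
Lemma balanced_th d f : hol f -> euler_balanced f -> euler_balanced (th d f).
Proof.
move=> hf bf x Ux.
have H (T : finType) (F : T -> J) : (forall y, U y -> \sum_t th (F t) f y = 0) ->
    \sum_t th (F t) (th d f) x = 0.
  move=> E; under eq_bigr => t _ do rewrite (th_comm _ _ hf Ux).
  rewrite -(th_sum (index_enum T) xpredT d (fun t => hol_th (F t) hf) Ux).
  by rewrite (th_ext d E Ux) /th pd_cst mulr0.
split=> i.
  by apply: (H _ (fun j => (i, j))) => y Uy; exact: (proj1 (bf y Uy)).
by apply: (H _ (fun j => (j, i))) => y Uy; exact: (proj2 (bf y Uy)).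
Qed.

Lemma balanced_et a f : hol f -> euler_balanced f -> euler_balanced (et a f).
Proof.
move=> hf bf x Ux.
have E d : th d (et a f) x = \sum_(e : J | (e.1 <= a.1)%N && (e.2 <= a.2)%N) th d (th e f) x.
  by rewrite /et th_sum // => e; exact: hol_th.
split=> i; under eq_bigr do rewrite E; rewrite exchange_big /= big1 // => e _.
  exact: (proj1 (balanced_th e hf bf Ux)).
exact: (proj2 (balanced_th e hf bf Ux)).
Qed.

Lemma th_et_decomp d f x : euler_balanced f -> U x ->
  th d f x = \sum_a et a f x * (bco a.1 a.2 d.1 d.2)%:~R.
Proof.
move=> bf Ux; case: d => i j /=; rewrite (corner_decomp i j (bf x Ux)) pair_bigA /=.
by apply: eq_bigr => a _; rewrite etE.
Qed.

Fixpoint Be (k : nat) f x : R :=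
  if k is k'.+1 then Be k' f x + \sum_(a : I) Be k' (et a f) x else cabs (f x).

Definition cJ : R := 1 + (#|{: J}|)%:R.
Definition cI : R := 1 + (#|{: I}|)%:R.

Lemma cJ_ge0 : 0 <= cJ. Proof. by rewrite addr_ge0. Qed.
Lemma cI_ge0 : 0 <= cI. Proof. by rewrite addr_ge0. Qed.

(** By the Euler equations theta_d is a combination of the eta_a with coefficients -1, 0, 1;
    exchanging one letter costs at most the number of pairs d. *)
Lemma Bn_le_Be k f x : hol f -> euler_balanced f -> U x -> Bn k f x <= cJ ^+ k * Be k f x.
Proof.
move=> + + Ux; elim: k f => [|k IH] f hf bf /=; first by rewrite expr0 mul1r.
have H d : Bn k (th d f) x <= \sum_a Bn k (et a f) x.
  rewrite (Bn_ext k (fun y Uy => th_et_decomp d bf Uy) Ux).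
  have hc a : hol (fun y => et a f y * (bco a.1 a.2 d.1 d.2)%:~R).
    by apply: (holM oU); [exact: hol_et|exact: hol_cst].
  apply: le_trans (Bn_sum _ _ _ hc Ux) _; apply: ler_sum => a _.
  apply: le_trans (BnM k (hol_et a hf) (hol_cst _ _) Ux) _.
  have cst c : Bn k (fun=> c) x = cabs c.
    elim: k {IH} c => [|k IH] c //=; rewrite IH big1 ?addr0 // => e _.
    rewrite (@Bn_ext k _ (fun=> 0) x _ Ux) ?IH ?cabs0 // => y Uy.
    by rewrite /th pd_cst mulr0.
  by rewrite cst cabs_int ler_piMr ?Bn_ge0 // lern1 absz_bco_le1.
have S0 : 0 <= \sum_a Bn k (et a f) x by apply: sumr_ge0 => a _; exact: Bn_ge0.
have HJ : \sum_(d : J) Bn k (th d f) x <= (#|{: J}|)%:R * \sum_a Bn k (et a f) x.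
  by apply: le_trans (ler_sum _ (fun d _ => H d)) _; rewrite sumr_const mulr_natl.
have HS : \sum_a Bn k (et a f) x <= cJ ^+ k * \sum_a Be k (et a f) x.
  rewrite mulr_sumr; apply: ler_sum => a _; apply: IH; first exact: hol_et.
  exact: balanced_et.
have c0 : 0 <= cJ ^+ k by rewrite exprn_ge0 // cJ_ge0.
have H1 := IH f hf bf; have B0 := Bn_ge0 k f x.
have N0 : 0 <= (#|{: J}|)%:R :> R by [].
rewrite exprSr -mulrA; rewrite {2}/cJ.
move: (Bn k f x) (\sum_d Bn k (th d f) x) (\sum_a Bn k (et a f) x) (Be k f x)
  (\sum_a Be k (et a f) x) (cJ ^+ k) (#|{: J}|)%:R H1 HJ HS S0 c0 B0 N0.
move=> p q r s t c n H1 HJ HS S0 c0 B0 N0.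
have : n * r <= n * (c * t) by rewrite ler_wpM2l.
nra.
Qed.

Lemma Be_le k f x (Y : R) : hol f -> U x -> 0 <= Y ->
  (forall w, (size w <= k)%N -> cabs (ew w f x) <= Y) -> Be k f x <= cI ^+ k * Y.
Proof.
move=> + Ux Y0; elim: k f => [|k IH] f hf H /=.
  by rewrite expr0 mul1r; exact: (H [::]).
have H1 : Be k f x <= cI ^+ k * Y by apply: IH => // w wk; apply: H; exact: leqW.
have H2 a : Be k (et a f) x <= cI ^+ k * Y.
  apply: IH; first exact: hol_et.
  move=> w wk; have := H (rcons w a); rewrite size_rcons => /(_ wk).
  by rewrite -cats1 ew_cat.
rewrite exprSr -mulrA [cI * _]mulrDl mul1r mulrDr lerD //.
apply: le_trans (ler_sum _ (fun a _ => H2 a)) _.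
by rewrite sumr_const mulrCA mulr_natl.
Qed.

Section Solution.
Variables (f : X -> C) (eps : R).
Hypotheses (hf : hol f) (cU : U `<=` conv_domain eps) (eps0 : 0 < eps)
  (sf : forall P, HA P -> forall x, U x -> wact P f x = 0).

Lemma solution_balanced : euler_balanced f.
Proof.
move=> x Ux; apply/balanced_acol => r.
etransitivity; last exact: (sf (HA_euler R r) Ux).
rewrite /Weuler wact_bigadd; apply: eq_bigr => i _.
by rewrite wact_bigadd; apply: eq_bigr => j _; rewrite /th -wact_Wd.
Qed.

Lemma mword_perm i j p q (u : 'M[nat]_(m.+1, l.+1)) : u = delta_mx i j + delta_mx p q ->
  (i, j) != (p, q) -> perm_eq (mword (monom u)) [:: (i, j); (p, q)].
Proof.
move=> -> ne; apply/allP => -[k h] _ /=; apply/eqP; rewrite /mword.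
rewrite count_flatten sumnE !big_map.
have inner k' : count_mem (k, h) (flatten [seq nseq (fun_of_multinom
     (monom (delta_mx i j + delta_mx p q)) (mxvec_index k' j')) (k', j') | j' <- index_enum 'I_l.+1])
   = ((k == k') * ((k', h) == (i, j)) + (k == k') * ((k', h) == (p, q)))%N.
  rewrite count_flatten sumnE !big_map (bigD1 h) //= big1 ?addn0; last first.
    move=> j' nj; rewrite count_nseq /= xpair_eqE [j' == h](negPf nj) andbF mul0n //.
  rewrite count_nseq mnmE mxvecE !mxE /= !xpair_eqE eqxx andbT [k' == k]eq_sym.
  by rewrite !natn; exact: mulnDr.
under eq_bigr do rewrite inner.
rewrite (bigD1 k) //= eqxx !mul1n big1 ?addn0; last first.
  by move=> k' /negPf nk; rewrite [k == k']eq_sym nk.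
by rewrite ?addn0 [(i, j) == _]eq_sym [(p, q) == _]eq_sym.
Qed.

Lemma solution_toric (i p : 'I_m.+1) (j q : 'I_l.+1) x : (i < p)%N -> (j < q)%N -> U x ->
  pd (i, j) (pd (p, q) f) x = pd (i, q) (pd (p, j) f) x.
Proof.
move=> ip jq Ux.
pose u : 'M[nat]_(m.+1, l.+1) := delta_mx i j + delta_mx p q.
pose u' : 'M[nat]_(m.+1, l.+1) := delta_mx i q + delta_mx p j.
have hp : @toric_ideal R m l (mpolyX C (monom u) - mpolyX C (monom u')).
  exists [:: (1, mpolyX C (monom u) - mpolyX C (monom u'))]; split; last first.
    by rewrite big_seq1 mul1r.
  move=> t; rewrite inE => /eqP -> /=; exists u, u'; split=> //.
  have Z (i' p' : 'I_m.+1) (j' q' : 'I_l.+1) : map_mx Posz (delta_mx i' j' + delta_mx p' q') =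
     delta_mx i' j' + delta_mx p' q' :> 'M[int]_(m.+1, l.+1).
    by apply/matrixP => k h; rewrite !mxE PoszD; do 2!case: (_ && _).
  have AB (v v' : 'M[int]_(m.+1, l.+1)) : Amul (v - v') = Amul v - Amul v'.
    rewrite /Amul -sumrB; apply: eq_bigr => k _; rewrite -sumrB.
    by apply: eq_bigr => h _; rewrite !mxE scalerBl.
  apply/eqP; rewrite !Z -subr_eq0 -AB; apply/eqP; apply/LlatP.
  have dsum (n : nat) (k : 'I_n) (B : bool) : \sum_(h < n) ((B && (h == k))%:R : int) = B%:R.
    by rewrite (bigD1 k) //= eqxx andbT big1 ?addr0 // => h /negPf->; rewrite andbF.
  have dsum' (n : nat) (k : 'I_n) (B : bool) : \sum_(h < n) (((h == k) && B)%:R : int) = B%:R.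
    by under eq_bigr do rewrite andbC; exact: dsum.
  split=> k; under eq_bigr do rewrite !mxE.
    by rewrite big_split /= sumrN !big_split /= !dsum subrr.
  rewrite big_split /= sumrN !big_split /= !dsum'; ring.
have word (v : 'M[nat]_(m.+1, l.+1)) i' j' p' q' : v = delta_mx i' j' + delta_mx p' q' ->
    (i', j') != (p', q') -> pderivs (mword (monom v)) f x = pd (i', j') (pd (p', q') f) x.
  move=> vE ne; have := mword_perm vE ne; move: (mword (monom v)) => w pw.
  have sz := perm_size pw; case: w pw sz => [|c1 [|c2 [|c3 w]]] // pw _.
  have one (c c' : J) : perm_eq [:: c] [:: c'] -> c = c'.
    by move=> /perm_mem/(_ c); rewrite !inE eqxx => /esym/eqP.
  rewrite !pderivs_cons.
  have -> : pderivs [::] f = f by [].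
  have := perm_mem pw c1; rewrite !inE eqxx /= => /esym/orP[/eqP c1E|/eqP c1E].
    by move: pw; rewrite c1E perm_cons => /one ->.
  move: pw; rewrite c1E => pw.
  have : perm_eq [:: (p', q'); c2] [:: (p', q'); (i', j')].
    apply: perm_trans pw _; by apply/permP => P /=; rewrite !addn0 addnC.
  by rewrite perm_cons => /one ->; exact: (schwarz oU _ _ hf Ux).
have := sf (HA_toric hp) Ux; rewrite wact_Wpoly.
pose phi mu := pderivs (mword mu) f x.
rewrite -/(mlin phi _) mlinD mlinN -[mpolyX C (monom u)]scale1r -[mpolyX C (monom u')]scale1r.
rewrite !mlinZX !mul1r /phi => /eqP; rewrite subr_eq0 => /eqP.
rewrite (word u i j p q) //; last by rewrite xpair_eqE -val_eqE (ltn_eqF ip).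
by rewrite (word u' i q p j) // xpair_eqE -val_eqE (ltn_eqF ip).
Qed.

Lemma solution_theta (i p : 'I_m.+1) (j q : 'I_l.+1) x : (i < p)%N -> (j < q)%N -> U x ->
  th (i, j) (th (p, q) f) x = xpow (gvec i j p q) x * th (i, q) (th (p, j) f) x.
Proof.
move=> ip jq Ux; rewrite !th_th // !xpair_eqE -!val_eqE (ltn_eqF ip) /= !mul0r !add0r.
rewrite solution_toric // xpow_gvec; last by move=> *; exact: x0.
by field; rewrite !x0.
Qed.

(** The Euler equations let eta_b be summed over the opposite corner, beyond b. Every d in the
    corner of a and every e beyond b are then in strictly increasing position, since a <= b, and the
    quadratic binomials apply to each pair. *)
Lemma solution_et2 a b x : (a.1 <= b.1)%N -> (a.2 <= b.2)%N -> U x ->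
  et a (et b f) x = \sum_(d : J | (d.1 <= a.1)%N && (d.2 <= a.2)%N)
    \sum_(e : J | (b.1 < e.1)%N && (b.2 < e.2)%N)
      xpow (gvec d.1 d.2 e.1 e.2) x * th (d.1, e.2) (th (e.1, d.2) f) x.
Proof.
move=> ab1 ab2 Ux.
have E y : U y -> et b f y = \sum_(e : J | (b.1 < e.1)%N && (b.2 < e.2)%N) th e f y.
  move=> Uy; rewrite etE corner_compl; last exact: solution_balanced.
  by rewrite pair_big_dep; apply: eq_bigr => -[].
rewrite (et_ext a E Ux); apply: eq_bigr => d /andP[d1 d2].
rewrite th_sum //; last by move=> e; exact: hol_th.
apply: eq_bigr => e /andP[e1 e2]; rewrite -solution_theta -?surjective_pairing //.
- by apply: leq_ltn_trans e1; exact: leq_trans d1 ab1.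
- by apply: leq_ltn_trans e2; exact: leq_trans d2 ab2.
Qed.

(** Growth per order of [Bn] on x^g: theta_c multiplies x^g by the entry g_c, of absolute value at
    most 4. *)
Definition cg : R := 1 + (#|{: J}| * 4)%:R.

Lemma cg_ge1 : 1 <= cg. Proof. by rewrite lerDl. Qed.

Lemma gvec_le4 (d e c : J) : (`|gvec d.1 d.2 e.1 e.2 c.1 c.2| <= 4)%N.
Proof.
by rewrite /gvec !mxE; do 4!case: (_ && _).
Qed.

Lemma Bn_xpow k (d e : J) x : U x -> (d.1 < e.1)%N -> (d.2 < e.2)%N ->
  hol (xpow (gvec d.1 d.2 e.1 e.2)) /\
  Bn k (xpow (gvec d.1 d.2 e.1 e.2)) x <= cg ^+ k * eps.
Proof.
move=> Ux de1 de2; set z := xpow _.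
have xz y : U y -> forall c, logder y c z (gvec d.1 d.2 e.1 e.2 c.1 c.2)%:~R.
  by move=> Uy c; apply: logder_xpow => i j; exact: x0.
have hz : hol z.
  have dz y : U y -> differentiable z y by move=> Uy; case: (xz y Uy (ord0, ord0)).
  elim=> [|n IH]; split.
  - exact: dz.
  - by [].
  - exact: dz.
  - move=> c; have H := smoothM oU (smoothM oU (smooth_cst n U
      ((gvec d.1 d.2 e.1 e.2 c.1 c.2)%:~R : C))
      (smoothV oU (fun y => @x0 y c.1 c.2) (smooth_coord n U c.1 c.2))) IH.
    by apply: (smooth_ext oU) H => y Uy; case: (xz y Uy c) => _ ->.
split; first exact: hz.
have thz c y : U y -> th c z y = (gvec d.1 d.2 e.1 e.2 c.1 c.2)%:~R * z y.
  move=> Uy; rewrite /th; case: (xz y Uy c) => _ ->.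
  by rewrite -mulrA mulrCA mulVKf //; exact: x0.
elim: k => [|k IH] /=.
  by rewrite expr0 mul1r; apply/ltW/gvec_lt; [move=> i j; exact: x0|exact: cU| |].
rewrite exprS -mulrA {1}/cg mulrDl mul1r lerD //.
have B0 := Bn_ge0 k z x.
have H c : Bn k (th c z) x <= 4%:R * (cg ^+ k * eps).
  rewrite (Bn_ext k (thz c) Ux).
  apply: le_trans (BnM k (hol_cst _ _) hz Ux) _.
  have cst (c' : C) : Bn k (fun=> c') x = cabs c'.
    elim: k {IH B0} c' => [|k IH] c' //=; rewrite IH big1 ?addr0 // => e' _.
    rewrite (@Bn_ext k _ (fun=> 0) x _ Ux) ?IH ?cabs0 // => y Uy.
    by rewrite /th pd_cst mulr0.
  by rewrite cst cabs_int ler_pM // ler_nat gvec_le4.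
apply: le_trans (ler_sum _ (fun c _ => H c)) _.
by rewrite sumr_const -[leLHS]mulr_natl natrM -!mulrA.
Qed.

(* The last two letters a <= b make the value of order eps, by [solution_et2]. *)
Lemma bad_word k w a b v x : (size v + 2 <= k)%N -> perm_eq w (v ++ [:: a; b]) ->
  (a.1 <= b.1)%N -> (a.2 <= b.2)%N -> U x ->
  cabs (ew w f x) <= ((#|{: J}| * #|{: J}|)%:R * cg ^+ k) * eps * Bn k f x.
Proof.
move=> vk pw ab1 ab2 Ux.
rewrite (ew_perm hf pw Ux) ew_cat /=.
rewrite (ew_ext v (fun y Uy => solution_et2 ab1 ab2 Uy) Ux).
set F := fun y => _; pose k' := (k - 2)%N.
have kk : k = k'.+2 by rewrite /k'; lia.
have hterm (d e : J) : (d.1 < e.1)%N -> (d.2 < e.2)%N ->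
  hol (fun y => xpow (gvec d.1 d.2 e.1 e.2) y * th (d.1, e.2) (th (e.1, d.2) f) y).
  move=> h1 h2; apply: (holM oU); first by case: (Bn_xpow 0 Ux h1 h2).
  by do 2!apply: hol_th.
pose P (d : J) := (d.1 <= a.1)%N && (d.2 <= a.2)%N.
pose Q (e : J) := (b.1 < e.1)%N && (b.2 < e.2)%N.
(* The terms are extended by 0 to all pairs, since x^g is small only for d and e in increasing
   position. *)
pose T (d e : J) y : C := if P d && Q e then
  xpow (gvec d.1 d.2 e.1 e.2) y * th (d.1, e.2) (th (e.1, d.2) f) y else 0.
have lt (d e : J) : P d && Q e -> (d.1 < e.1)%N /\ (d.2 < e.2)%N.
  by rewrite /P /Q => /andP[/andP[h1 h2] /andP[h3 h4]]; split; lia.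
have hT (d e : J) : hol (T d e).
  rewrite /T; case E: (P d && Q e); last exact: hol_cst.
  by have [h1 h2] := lt _ _ E; exact: hterm.
have FE : F = fun y => \sum_(d : J) \sum_(e : J) T d e y.
  apply: funext => y; rewrite /F big_mkcond; apply: eq_bigr => d _ /=.
  rewrite -/(P d) /T; case: (P d) => /=; last by rewrite big1.
  by rewrite big_mkcond.
have hF : hol F by rewrite FE; apply: hol_sum => d; apply: hol_sum => e; exact: hT.
have vk' : (size v <= k')%N by lia.
apply: le_trans (_ : Bn k' F x <= _).
  apply: le_trans (_ : Bn 0 (ew v F) x <= _); first exact: lexx.
  apply: le_trans (Bn_ew 0 v hF Ux) _; exact: Bn_mono.
have TB (d e : J) : Bn k' (T d e) x <= cg ^+ k * eps * Bn k f x.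
  have c0 : 0 <= cg ^+ k * eps * Bn k f x.
    by rewrite !mulr_ge0 ?Bn_ge0 ?(ltW eps0) // exprn_ge0 // (le_trans ler01 cg_ge1).
  have cst : Bn k' (fun=> 0) x = 0.
    elim: (k') => [|n IH] /=; rewrite ?cabs0 // IH add0r big1 // => c _.
    rewrite (@Bn_ext n _ (fun=> 0) x _ Ux) ?IH // => y Uy.
    by rewrite /th pd_cst mulr0.
  rewrite /T; case E: (P d && Q e); last by rewrite cst.
  have [h1 h2] := lt _ _ E; have [hz Bz] := Bn_xpow k' Ux h1 h2.
  apply: le_trans (BnM k' hz (hol_th _ (hol_th _ hf)) Ux) _.
  apply: ler_pM; rewrite ?Bn_ge0 //.
    apply: le_trans Bz _; rewrite ler_wpM2r ?(ltW eps0) //.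
    by rewrite ler_weXn2l ?cg_ge1 // kk; lia.
  by rewrite kk; apply: le_trans (Bn_th _ _ _ _) _; exact: Bn_th.
rewrite FE; apply: le_trans (Bn_sum _ _ _ _ Ux) _; first by move=> d; apply: hol_sum => e.
apply: le_trans (_ : \sum_(d : J) \sum_(e : J) cg ^+ k * eps * Bn k f x <= _).
  apply: ler_sum => d _; apply: le_trans (Bn_sum _ _ _ _ Ux) _; first by move=> e.
  by apply: ler_sum => e _.
by rewrite !sumr_const -mulrnA -[leLHS]mulr_natl !mulrA.
Qed.

End Solution.
End ThetaOperators.

(** The offending pair is moved to the end of the word, where its operators act first on f, as in
    [bad_word]. *)
Lemma not_pairwiseP (T : eqType) (r : rel T) (w : seq T) : ~~ pairwise r w ->
  exists (a b : T) (v : seq T), ~~ r a b /\ perm_eq w (v ++ [:: a; b]).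
Proof.
elim: w => //= c t IH; rewrite negb_and => /orP[/allPn[b bt rcb]|/IH[a [b [v [rab pv]]]]].
  exists c, b, (rem b t); split=> //.
  rewrite perm_sym; apply/permP => P; rewrite count_cat /= addn0.
  by rewrite (permP (perm_to_rem bt)) /= ; lia.
by exists a, b, (c :: v); rewrite /= perm_cons.
Qed.

(** * Words with comparable letters and sorted antichains *)

Section IndexWords.
Variables (m l : nat).
Local Notation I := ('I_m * 'I_l)%type.
Implicit Types (w s : seq I) (a b : I).

Definition comparable_idx a b :=
  ((a.1 <= b.1)%N && (a.2 <= b.2)%N) || ((b.1 <= a.1)%N && (b.2 <= a.2)%N).

(** A repeated letter counts as comparable with itself. If no two letters are comparable, sorting by
    the first coordinate makes the second one decrease. *)
Lemma word_dichotomy w :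
  (exists a b (v : seq I), [/\ (a.1 <= b.1)%N, (a.2 <= b.2)%N & perm_eq w (v ++ [:: a; b])]) \/
  (exists s : seq I, sigma_index s /\ perm_eq w s).
Proof.
case: (boolP (pairwise (fun a b => ~~ comparable_idx a b) w)) => pw; last first.
  left; have [a [b [v [/negPn/orP[]/andP[h1 h2] pv]]]] := not_pairwiseP pw.
    by exists a, b, v.
  exists b, a, v; split=> //; apply: perm_trans pv _.
  by rewrite perm_cat2l; apply/permP => P /=; rewrite !addn0 addnC.
right; pose le1 := [rel a b : I | (a.1 <= b.1)%N].
have us : uniq w.
  apply: pairwise_uniq pw => a; rewrite /comparable_idx !leqnn //.
have inc : {in w &, forall a b, a != b -> ~~ comparable_idx a b}.
  elim: w {us} pw => // c t IH /= /andP[/allP hc /IH ht] a b.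
  have sym a' b' : comparable_idx a' b' = comparable_idx b' a' by rewrite /comparable_idx orbC.
  rewrite !inE => /orP[/eqP->|at_] /orP[/eqP->|bt] ab.
  - by rewrite eqxx in ab.
  - exact: hc.
  - by rewrite sym; exact: hc.
  - exact: ht.
exists (sort le1 w); split; last by rewrite perm_sym perm_sort.
have tr : transitive le1 by move=> b a c /=; exact: leq_trans.
have tot : total le1 by move=> a b /=; exact: leq_total.
have H : pairwise [rel a b | le1 a b && (a != b)] (sort le1 w).
  rewrite pairwise_relI -sorted_pairwise // sort_sorted //=.
  by rewrite -uniq_pairwise sort_uniq.
apply: pairwise_sorted.
apply: (@sub_in_pairwise _ (mem w) _ _ _ _ _ H); last first.
  by apply/allP => a; rewrite mem_sort.
move=> a b aw bw /andP[/= ab ne]; have := inc a b aw bw ne.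
by rewrite /comparable_idx; lia.
Qed.

(** An antichain repeats no letter, so its length is at most the number of indices and the words can
    be listed. *)
Definition index_words : seq (seq I) :=
  undup [seq s <- flatten [seq [seq tval t | t <- enum {: k.-tuple I}] | k <- iota 0 #|{: I}|.+1]
    | sigma_index s].

Lemma sigma_index_size s : sigma_index s -> (size s <= #|{: I}|)%N.
Proof.
move=> /sigma_antichain[us _]; rewrite -(card_uniqP us); exact: max_card.
Qed.

Lemma mem_index_words s : (s \in index_words) = sigma_index s.
Proof.
rewrite /index_words mem_undup mem_filter; apply/idP/idP => [/andP[] //|si].
rewrite si andTb; apply/flatten_mapP; exists (size s).
  by rewrite mem_iota /= add0n ltnS sigma_index_size.
apply/mapP; exists (in_tuple s) => //; exact: mem_enum.
Qed.

End IndexWords.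

(** * A differential inequality and its propagation along U *)

Section Uniqueness.
Variables (R : realType) (m l : nat) (U : set 'M[R[i]]_(m.+1, l.+1)).
Local Notation C := R[i].
Local Notation X := ('M[C]_(m.+1, l.+1)).
Local Notation I := ('I_m * 'I_l)%type.
Local Notation J := ('I_m.+1 * 'I_l.+1)%type.
Local Notation hol := (hol U).
Local Notation words := (@index_words m l).
Hypotheses (oU : open U) (x0 : forall x i j, U x -> x i j != 0).
Implicit Types (x y h : X).

(** One more than the bound for the length of an index word, leaving room for one derivative of
    eta^sigma f. *)
Definition maxlen : nat := #|{: I}|.+1.

Definition Gsum_const : R := (cJ R m l) ^+ maxlen * (cI R m l) ^+ maxlen.
Definition bad_const : R := (#|{: J}| * #|{: J}|)%:R * (cg R m l) ^+ maxlen.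

Variables (f : X -> C) (eps : R).
Hypotheses (hf : hol f) (cU : U `<=` conv_domain eps) (eps0 : 0 < eps)
  (sf : forall P, HA P -> forall x, U x -> wact P f x = 0)
  (small : Gsum_const * bad_const * eps <= 2^-1).

Definition Gsum x : R := \sum_(s <- words) cabs (ew s f x).

Lemma Gsum_ge0 x : 0 <= Gsum x.
Proof. by apply: sumr_ge0 => s _; exact: cabs_ge0. Qed.

Lemma Gsum_const_ge0 : 0 <= Gsum_const.
Proof. by rewrite mulr_ge0 // exprn_ge0 // ?cJ_ge0 ?cI_ge0. Qed.

Lemma bad_const_ge0 : 0 <= bad_const.
Proof. by rewrite mulr_ge0 // exprn_ge0 // (le_trans ler01 (cg_ge1 _ _ _)). Qed.

(** Words of corner operators are either index words, counted by [Gsum], or have a comparable pair,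
    and then cost eps times [Bn] itself. For small eps that term is absorbed on the left. *)
Lemma Bn_le_Gsum x : U x -> Bn maxlen f x <= 2 * Gsum_const * Gsum x.
Proof.
move=> Ux; have B0 := Bn_ge0 maxlen f x; have G0 := Gsum_ge0 x.
have bf := solution_balanced sf.
have H : Bn maxlen f x <= Gsum_const * (Gsum x + bad_const * eps * Bn maxlen f x).
  apply: le_trans (Bn_le_Be oU maxlen hf bf Ux) _.
  rewrite /Gsum_const -mulrA ler_wpM2l ?exprn_ge0 ?cJ_ge0 //.
  have Y0 : 0 <= Gsum x + bad_const * eps * Bn maxlen f x.
    by rewrite addr_ge0 // mulr_ge0 // mulr_ge0 ?bad_const_ge0 // ltW.
  apply: (Be_le oU hf Ux Y0) => w wk; have [[a [b [v [h1 h2 pw]]]]|[s [si pw]]] := word_dichotomy w.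
    have vk : (size v + 2 <= maxlen)%N by have := perm_size pw; rewrite size_cat /= => <-.
    apply: le_trans (bad_word oU x0 hf cU eps0 sf vk pw h1 h2 Ux) _.
    by rewrite -/bad_const lerDr.
  rewrite (ew_perm oU hf pw Ux) /Gsum (big_rem s) ?mem_index_words //=.
  rewrite -addrA lerDl addr_ge0 ?sumr_ge0 // => [t _|]; first exact: cabs_ge0.
  by rewrite mulr_ge0 // mulr_ge0 ?bad_const_ge0 // ltW.
move: H; rewrite mulrDr => H.
have : Gsum_const * (bad_const * eps * Bn maxlen f x) <= 2^-1 * Bn maxlen f x.
  by rewrite mulrA [Gsum_const * _]mulrA ler_wpM2r.
lra.
Qed.

(** The first derivatives of the values eta^sigma f are bounded by these values: the differential
    inequality that drives uniqueness. *)
Lemma pd_ew_le s d x : s \in words -> U x ->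
  cabs (pd d (ew s f) x) <= cabs (x d.1 d.2)^-1 * (2 * Gsum_const * Gsum x).
Proof.
rewrite mem_index_words => si Ux.
have -> : pd d (ew s f) x = (x d.1 d.2)^-1 * th d (ew s f) x.
  by rewrite /th mulKf // x0.
rewrite cabsM ler_wpM2l ?cabs_ge0 //; apply: le_trans (Bn_le_Gsum Ux).
apply: le_trans (_ : Bn 0 (th d (ew s f)) x <= _); first exact: lexx.
apply: le_trans (Bn_th _ _ _ _) _; apply: le_trans (Bn_ew oU _ _ hf Ux) _.
by apply: Bn_mono; rewrite add1n ltnS; exact: sigma_index_size.
Qed.

Lemma near_forall_in (T : eqType) (s : seq T) (P : T -> X -> Prop) :
  (forall t, \forall h \near (0 : X), P t h) ->
  \forall h \near (0 : X), forall t, t \in s -> P t h.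
Proof.
move=> H; elim: s => [|t s IH]; first by apply: filterE.
apply: filterS2 (H t) IH => h h1 h2 u; rewrite inE => /orP[/eqP->|] //; exact: h2.
Qed.

Lemma le_pow2_eq0 (z : C) : (forall n, cabs z <= 2^-1 ^+ n) -> z = 0.
Proof.
move=> H; apply/eqP; rewrite -cabs_eq0; apply/negPn/negP => z0.
have zp : 0 < cabs z by rewrite lt_def z0 cabs_ge0.
have [n hn] : exists n, (cabs z)^-1 < n%:R :> R.
  by exists (Num.bound (cabs z)^-1); apply: archi_boundP; rewrite invr_ge0 ltW.
have := H n; apply/negP; rewrite -ltNge exprVn.
rewrite -[ltRHS]invrK ltf_pV2 ?posrE ?invr_gt0 ?exprn_gt0 //.
by apply: lt_le_trans hn _; rewrite -natrX ler_nat ltnW // ltn_expl.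
Qed.

(** An iterated mean value estimate in the manner of Gronwall: on a small ball around a common zero,
    any bound on the values improves by a factor 1/2, hence they vanish. *)
Lemma Gsum_local x : U x -> (forall s, s \in words -> ew s f x = 0) ->
  \forall h \near (0 : X), forall s, s \in words -> ew s f (x + h) = 0.
Proof.
move=> Ux Gx.
have hY s : hol (ew s f) by exact: hol_ew.
have dY s y : U y -> differentiable (ew s f) y by move=> Uy; exact: hol_diff (hY s) Uy.
(* The added 1 leaves room for the variation of the inverse coordinates near x. *)
pose Lam : R := \sum_(d : J) (cabs (x d.1 d.2)^-1 + 1).
have Lam1 (d : J) : cabs (x d.1 d.2)^-1 + 1 <= Lam.
  rewrite /Lam (bigD1 d) //= lerDl sumr_ge0 // => e _.
  by rewrite addr_ge0 ?cabs_ge0.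
have N1 : \forall h \near (0 : X), U (x + h).
  by apply: near_translate; exact: near_open oU Ux _.
have N2 : \forall h \near (0 : X), forall s, s \in words -> cabs (ew s f (x + h) - ew s f x) < 1.
  by apply: near_forall_in => s; apply/near0_vnorm; exact: vcontinuous (dY s x Ux) _ ltr01.
have N3 : \forall h \near (0 : X), forall d : J, d \in index_enum J ->
    cabs (((x + h) d.1 d.2)^-1 - (x d.1 d.2)^-1) < 1.
  apply: near_forall_in => d; apply/near0_vnorm.
  apply: (vcontinuous (f := fun y => (y d.1 d.2)^-1)) ltr01.
  by apply: differentiableV; [exact: diff_coord|exact: x0].
have /near0_vnorm[r r0 Hr] : \forall h \near (0 : X), [/\ U (x + h),
   forall s, s \in words -> cabs (ew s f (x + h) - ew s f x) < 1 &
   forall d : J, d \in index_enum J -> cabs (((x + h) d.1 d.2)^-1 - (x d.1 d.2)^-1) < 1].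
  by apply: filterS3 N1 N2 N3 => h h1 h2 h3; split.
pose A : R := (#|{: J}|)%:R * (Lam * (2 * Gsum_const * (size words)%:R)).
have Lam0 : 0 <= Lam.
  by apply: le_trans (Lam1 (ord0, ord0)); rewrite addr_ge0 ?cabs_ge0.
have c20 : 0 <= 2 * Gsum_const by rewrite pmulr_rge0 // Gsum_const_ge0.
have A0 : 0 <= A.
  by apply: mulr_ge0 => //; apply: mulr_ge0 => //; exact: mulr_ge0.
(* This gives A del <= 1/4; the doubling in [mvt_complex] then leaves the factor 1/2 per
   iteration. *)
pose del := Num.min r (4 * A + 1)^-1.
have A1 : 0 < 4 * A + 1 by rewrite ltr_wpDl // mulr_ge0.
have del0 : 0 < del by rewrite lt_min r0 invr_gt0.
have delA : A * del <= 4^-1.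
  have d1 : del <= (4 * A + 1)^-1 by rewrite ge_min lexx orbT.
  apply: le_trans (ler_wpM2l A0 d1) _; rewrite ler_pdivrMr //; lra.
have step n : forall h, vnorm h < del -> forall s, s \in words ->
    cabs (ew s f (x + h)) <= 2^-1 ^+ n.
  elim: n => [|n IH] h hd s sw.
    have hr : vnorm h < r by apply: lt_le_trans hd _; rewrite ge_min lexx.
    have [_ H2 _] := Hr h hr; have := H2 s sw; rewrite Gx // subr0 expr0; exact: ltW.
  have -> : ew s f (x + h) = ew s f (x + h) - ew s f x by rewrite Gx // subr0.
  have M : forall t : R, 0 <= t <= 1 -> differentiable (ew s f) (x + t%:C *: h) /\
      cabs ('d (ew s f) (x + t%:C *: h) h) <= 4^-1 * 2^-1 ^+ n.
    move=> t /andP[t0 t1].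
    have th_ : vnorm (t%:C *: h) < del.
      rewrite vnormZ cabsR ger0_norm //; apply: le_lt_trans hd.
      by rewrite ler_piMl ?vnorm_ge0.
    have tr : vnorm (t%:C *: h) < r by apply: lt_le_trans th_ _; rewrite ge_min lexx.
    have [Ut _ H3] := Hr _ tr.
    have D := dY s _ Ut; split; first exact: D.
    rewrite (diff_pdE h D); apply: le_trans (cabs_sum _ _ _) _.
    have Gt : Gsum (x + t%:C *: h) <= (size words)%:R * 2^-1 ^+ n.
      apply: le_trans (_ : \sum_(s <- words) 2^-1 ^+ n <= _).
        rewrite /Gsum big_seq [leRHS]big_seq; apply: ler_sum => s' s'w.
        exact: IH th_ _ s'w.
      by rewrite big_const_seq count_predT iter_addr_0 mulr_natl.
    have p0 : 0 <= 2^-1 ^+ n :> R by rewrite exprn_ge0.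
    have P (d : J) : cabs (pd d (ew s f) (x + t%:C *: h) * h d.1 d.2) <=
        Lam * (2 * Gsum_const * (size words)%:R) * del * 2^-1 ^+ n.
      rewrite cabsM.
      have b1 : cabs (h d.1 d.2) <= del by apply: le_trans (cabs_entry _ _ _) (ltW hd).
      have b2 : cabs ((x + t%:C *: h) d.1 d.2)^-1 <= Lam.
        apply: le_trans (Lam1 d).
        have := cabsD ((((x + t%:C *: h) d.1 d.2)^-1) - (x d.1 d.2)^-1) ((x d.1 d.2)^-1).
        rewrite subrK => b; apply: le_trans b _; rewrite addrC lerD2l ltW //.
        exact: H3 (mem_index_enum d).
      have b3 := pd_ew_le d sw Ut.
      have b4 : cabs (pd d (ew s f) (x + t%:C *: h)) <=
          Lam * (2 * Gsum_const * ((size words)%:R * 2^-1 ^+ n)).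
        apply: le_trans b3 _; apply: ler_pM; rewrite ?cabs_ge0 ?b2 //.
          by apply: mulr_ge0 => //; exact: Gsum_ge0.
        by rewrite ler_wpM2l.
      apply: le_trans (ler_pM (cabs_ge0 _) (cabs_ge0 _) b4 b1) _.
      by rewrite le_eqVlt; apply/orP; left; apply/eqP; ring.
    apply: le_trans (ler_sum _ (fun d _ => P d)) _.
    rewrite sumr_const -[leLHS]mulr_natl.
    have -> : (#|{: J}|)%:R * (Lam * (2 * Gsum_const * (size words)%:R) * del * 2^-1 ^+ n) =
      A * del * 2^-1 ^+ n by rewrite /A; ring.
    by rewrite ler_wpM2r.
  apply: le_trans (mvt_complex M) _.
  rewrite exprS -mulrDl; suff -> : 4^-1 + 4^-1 = 2^-1 :> R by []; by field.
apply/near0_vnorm; exists del => // h hd s sw.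
by apply: le_pow2_eq0 => n; exact: step.
Qed.

(** The common zeros of the values eta^sigma f are open in U by [Gsum_local] and closed by
    continuity; the empty word is f itself. *)
Lemma solution_unique z : connected U -> U z ->
  (forall s, s \in words -> ew s f z = 0) -> forall x, U x -> f x = 0.
Proof.
move=> cnU Uz Gz.
pose A : set X := [set x | U x /\ forall s, s \in words -> ew s f x = 0].
have AU : A = U.
  apply: cnU; first by exists z.
  - exists A°; first exact: open_interior.
    apply/seteqP; split=> [x [Ux Gx]|x [Ux /interior_subset]] //.
    split=> //.
    have N : \forall h \near (0 : X), A (x + h).
      have N1 : \forall h \near (0 : X), U (x + h).
        by apply: near_translate; exact: near_open oU Ux _.
      by apply: filterS2 N1 (Gsum_local Ux Gx) => h h1 h2; split.
    change (\forall y \near x, A y); rewrite (near_shift 0 x).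
    by apply: filterS N => h; rewrite /= subr0 addrC.
  - exists (closure A); first exact: closed_closure.
    apply/seteqP; split=> [x Ax|x [Ux cx]].
      by split; [case: Ax|exact: subset_closure].
    split=> // s sw; apply/eqP/negPn/negP => n0.
    have D : differentiable (ew s f) x by exact: hol_diff (hol_ew oU s hf) Ux.
    have e0 : 0 < cabs (ew s f x) by rewrite cabs_gt0.
    have [r r0 Hr] := vcontinuous D e0.
    have N : nbhs x [set y | vnorm (y - x) < r].
      change (\forall y \near x, vnorm (y - x) < r); rewrite (near_shift 0 x).
      by apply/near0_vnorm; exists r => // h hr; rewrite /= subr0 addrK.
    have [y [[_ Gy] yr]] := cx _ N.
    have := Hr _ yr; rewrite [x + _]addrC subrK Gy // sub0r cabsN ltxx //.
move=> x; rewrite -AU => -[_ Gx].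
by have := Gx [::]; rewrite mem_index_words; exact.
Qed.

End Uniqueness.

(** * The matrix of corner derivatives of the series *)

Section CornerOperators.
Variables (m l : nat).
Local Notation I := ('I_m * 'I_l)%type.

Lemma stepco_corner n (k a : 'I_n) : \sum_(i : 'I_n.+1 | (i <= a)%N) stepco k i = (k == a)%:Z.
Proof.
rewrite /stepco sumrB.
have S (b : nat) : (b < n.+1)%N ->
    \sum_(i : 'I_n.+1 | (i <= a)%N) (i == b :> nat)%:Z = (b <= a)%N%:Z.
  move=> bn; rewrite big_mkcond (bigD1 (Ordinal bn)) //= eqxx big1 ?addr0; first by case: leqP.
  by move=> i; rewrite -val_eqE /= => /negPf->; case: ifP.
rewrite (S k (ltnW (ltn_ord k))) (S k.+1 (ltn_ord k)).
by rewrite -val_eqE /=; lia.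
Qed.

(** Corner sums are dual to the basis B: hence eta_a reads off s_a from Bs and the a-th coordinate
    from u. *)
Lemma bco_corner (k a : I) :
  \sum_(d : 'I_m.+1 * 'I_l.+1 | (d.1 <= a.1)%N && (d.2 <= a.2)%N) bco k.1 k.2 d.1 d.2 =
  (k == a)%:Z.
Proof.
rewrite -(pair_big (fun i : 'I_m.+1 => (i <= a.1)%N) (fun j : 'I_l.+1 => (j <= a.2)%N)
  (fun i j => bco k.1 k.2 i j)) /=.
under eq_bigr do rewrite -mulr_sumr stepco_corner.
rewrite -mulr_suml stepco_corner; case: k a => [k1 k2] [a1 a2] /=.
by rewrite xpair_eqE; case: (k1 == a1); case: (k2 == a2).
Qed.

Lemma corner_Bform (R : realType) (y : 'M[R[i]]_(m, l)) (a : I) :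
  \sum_(d : 'I_m.+1 * 'I_l.+1 | (d.1 <= a.1)%N && (d.2 <= a.2)%N) linform (Bform R d) y = y a.1 a.2.
Proof.
have H (k : I) : \sum_(d : 'I_m.+1 * 'I_l.+1 | (d.1 <= a.1)%N && (d.2 <= a.2)%N)
    Bform R d k.1 k.2 * y k.1 k.2 = (k == a)%:R * y k.1 k.2.
  rewrite -mulr_suml; under eq_bigr do rewrite mxE.
  by rewrite -rmorph_sum bco_corner.
rewrite exchange_big /= (eq_bigr _ (fun k _ => H k)) (bigD1 a) //= eqxx mul1r big1 ?addr0 //.
by move=> k /negPf->; rewrite mul0r.
Qed.

Lemma corner_cdeg (u : 'M[int]_(m.+1, l.+1)) (a : I) : cone u ->
  \sum_(d : 'I_m.+1 * 'I_l.+1 | (d.1 <= a.1)%N && (d.2 <= a.2)%N) u d.1 d.2 = (cdeg u a)%:Z.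
Proof.
move=> [_ cu]; rewrite /cdeg gez0_abs; last exact: cu.
by rewrite /corner pair_big.
Qed.

End CornerOperators.

Section EulerOnSeries.
Variables (R : realType) (m l : nat) (eps : R).
Variables (U : set 'M[R[i]]_(m.+1, l.+1)) (lg : 'M[R[i]]_(m.+1, l.+1) -> 'M[R[i]]_(m.+1, l.+1)).
Local Notation C := R[i].
Local Notation X := ('M[C]_(m.+1, l.+1)).
Local Notation V := ('M[C]_(m, l)).
Local Notation I := ('I_m * 'I_l)%type.
Local Notation J := ('I_m.+1 * 'I_l.+1)%type.
Local Notation Mz := ('M[int]_(m.+1, l.+1)).
Hypotheses (eps0 : 0 < eps) (oU : open U) (cU : U `<=` conv_domain eps)
  (hlg : log_branch U lg).
Implicit Types (x : X) (y : V) (s tau : seq I) (a : I) (u : Mz) (g : Mz -> V -> C).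
Local Notation lam := (lam lg).
Local Notation Ser := (Ser lg).
Local Notation Fam := (@Fam R m l eps).

Let oW := @Wball_open R m l.
Let W0 := @Wball0 R m l.

Definition cshift (a : I) g : Mz -> V -> C :=
  fun u y => (y a.1 a.2 + (cdeg u a)%:R) * g u y.

Lemma cshiftE a g u y : (forall u, ~ cone u -> g u = (fun=> 0)) ->
  \sum_(d : J | (d.1 <= a.1)%N && (d.2 <= a.2)%N) shift d g u y = cshift a g u y.
Proof.
move=> g0; have [cu|ncu] := pselect (cone u); last first.
  by rewrite /cshift g0 // mulr0 big1 // => d _; rewrite /shift g0 // mulr0.
rewrite /shift -mulr_suml big_split /= corner_Bform -rmorph_sum /= corner_cdeg //.
Qed.

Lemma Fam_cshift s a g : Fam (size s) g -> Fam (size s) (cshift a g).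
Proof.
move=> hg; have [_ g0 _] := hg.
have [h _] := Ser_sum eps0 cU hlg (index_enum J) (fun d => (d.1 <= a.1)%N && (d.2 <= a.2)%N)
  (fun d => Fam_shift0 eps0 d hg).
rewrite (_ : cshift a g = fun u y => \sum_(d : J | (d.1 <= a.1)%N && (d.2 <= a.2)%N) shift d g u y) //.
by apply: funext => u; apply: funext => y; rewrite cshiftE.
Qed.

Lemma et_Ser s a g x : Fam (size s) g -> U x -> et a (Ser s g) x = Ser s (cshift a g) x.
Proof.
move=> hg Ux; have [_ g0 _] := hg; rewrite /et.
have H (d : J) : th d (Ser s g) x = Ser s (shift d g) x.
  rewrite /th (pd_Ser eps0 oU cU hlg d hg Ux) mulVKf //; exact: (log_branch_neq0 hlg).
under eq_bigr do rewrite H.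
have [_ ->] := Ser_sum eps0 cU hlg (index_enum J) (fun d => (d.1 <= a.1)%N && (d.2 <= a.2)%N)
  (fun d => Fam_shift0 eps0 d hg); last exact: Ux.
by apply: Ser_ext => u y _; rewrite cshiftE.
Qed.

Definition cword tau g := foldr cshift g tau.

Lemma Fam_cword s tau g : Fam (size s) g -> Fam (size s) (cword tau g).
Proof. by move=> hg; elim: tau => //= a tau; exact: Fam_cshift. Qed.

Lemma ew_Ser s tau g x : Fam (size s) g -> U x -> ew tau (Ser s g) x = Ser s (cword tau g) x.
Proof.
move=> hg; elim: tau x => //= a tau IH x Ux.
rewrite (et_ext oU a IH Ux); exact: et_Ser (Fam_cword tau hg) Ux.
Qed.

Lemma cwordE tau g u y :
  cword tau g u y = \prod_(a <- tau) (y a.1 a.2 + (cdeg u a)%:R) * g u y.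
Proof.
elim: tau => [|a tau IH] /=; first by rewrite big_nil mul1r.
by rewrite /cshift IH big_cons mulrA.
Qed.

End EulerOnSeries.

(** * Separating the logarithms from the derivatives at s = 0 *)

Section LogarithmicExpansion.
Variables (R : realType) (a b : nat).
Local Notation C := R[i].
Local Notation V := ('M[C]_(a, b)).
Local Notation I := ('I_a * 'I_b)%type.
Variable W : set V.
Hypotheses (oW : open W) (W0 : W 0).
Implicit Types (s t rho tau : seq I) (g : V -> C) (la : I -> C).

(* The splittings of a word into a subword and the complementary subword. *)
Fixpoint splits s : seq (seq I * seq I) :=
  if s is d :: s' then
    [seq (d :: p.1, p.2) | p <- splits s'] ++ [seq (p.1, d :: p.2) | p <- splits s']
  else [:: ([::], [::])].

Definition lprod la s : C := \prod_(d <- s) la d.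

Definition Tr s g : C := Tl (fun=> 0) s g.

Lemma TrS d s g : Tr (d :: s) g = Tr s (pd d g).
Proof. by rewrite /Tr /= mul0r addr0. Qed.

(** Each letter either derives g or contributes its logarithm. *)
Lemma Tl_splits la s g : Tl la s g = \sum_(p <- splits s) lprod la p.2 * Tr p.1 g.
Proof.
elim: s g => [|d s IH] g; first by rewrite big_seq1 /lprod big_nil mul1r.
rewrite [splits _]/= big_cat !big_map /= IH (IH g) mulr_sumr; congr (_ + _).
  by apply: eq_bigr => p _; rewrite TrS.
by apply: eq_bigr => p _; rewrite /lprod big_cons mulrA.
Qed.

Lemma splits_subseq s p : p \in splits s -> subseq p.1 s.
Proof.
elim: s p => [|d s IH] p /=; first by rewrite inE => /eqP->.
rewrite mem_cat => /orP[]/mapP[q /IH qs ->] /=; first by rewrite eqxx.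
exact: subseq_trans qs (subseq_cons _ _).
Qed.

(** A subword at least as long as s is s, with empty complement. This makes the logarithmic factor
    of the matrix unitriangular. *)
Lemma splits_top la s t : (size s <= size t)%N ->
  \sum_(p <- splits s | p.1 == t) lprod la p.2 = (s == t)%:R.
Proof.
elim: s t => [|d s IH] t st.
  by rewrite big_mkcond big_seq1 /= /lprod big_nil; case: ifP.
rewrite [splits _]/= big_cat !big_map /=.
have -> : \sum_(p <- splits s | p.1 == t) lprod la (d :: p.2) = 0.
  transitivity (la d * \sum_(p <- splits s | p.1 == t) lprod la p.2).
    by rewrite mulr_sumr; apply: eq_bigr => p _; rewrite /lprod big_cons.
  rewrite IH ?(ltnW st) //; case: eqP => [E|_]; last by rewrite mulr0.
  by move: st; rewrite E ltnn.
case: t st => [//|e t] st; rewrite addr0 eqseq_cons.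
have [->|ne] := eqVneq d e.
  by rewrite -IH //; apply: eq_bigl => p; rewrite eqseq_cons eqxx.
by rewrite big_pred0 // => p; rewrite eqseq_cons (negPf ne).
Qed.

Definition yprod tau (y : V) : C := \prod_(d <- tau) y d.1 d.2.

Lemma diff_yprod tau x : differentiable (yprod tau) x.
Proof.
elim: tau => [|d tau IH].
  rewrite (_ : yprod [::] = fun=> 1); first exact: differentiable_cst.
  by apply: funext => y; rewrite /yprod big_nil.
rewrite (_ : yprod (d :: tau) = fun y => y d.1 d.2 * yprod tau y).
  by apply: differentiableM; [exact: diff_coord|exact: IH].
by apply: funext => y; rewrite /yprod big_cons.
Qed.

Lemma pd_yprod d tau x : uniq tau ->
  pd d (yprod tau) x = if d \in tau then yprod (rem d tau) x else 0.
Proof.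
elim: tau => [|e tau IH] /=.
  rewrite (_ : yprod [::] = fun=> 1) ?pd_cst //.
  by apply: funext => y; rewrite /yprod big_nil.
move=> /andP[et ut].
rewrite (_ : yprod (e :: tau) = fun y => y e.1 e.2 * yprod tau y); last first.
  by apply: funext => y; rewrite /yprod big_cons.
rewrite (pdM d (diff_coord _ _ _) (diff_yprod tau x)) pd_coord (IH ut) inE.
rewrite -surjective_pairing [e == d]eq_sym.
have [E|de] := eqVneq d e.
  by rewrite -E in et *; rewrite (negPf et) mulr0 addr0 mul1r.
rewrite mul0r add0r /=; case: ifP => _; last by rewrite mulr0.
by rewrite /yprod big_cons.
Qed.

(** A squarefree monomial survives at 0 exactly when each of its variables is derived once. *)
Lemma Tr_yprod rho tau : uniq tau -> Tr rho (yprod tau) = (perm_eq rho tau)%:R.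
Proof.
elim: rho tau => [|d rho IH] tau ut.
  rewrite /Tr /= /yprod; case: tau ut => [|e tau] _; first by rewrite big_nil.
  rewrite big_cons mxE mul0r (_ : perm_eq _ _ = false) //.
  by apply/negP => /perm_size.
rewrite TrS; have [dt|ndt] := boolP (d \in tau).
  transitivity (Tr rho (yprod (rem d tau))).
    by apply: (Tl_ext oW W0) => y _; rewrite pd_yprod // dt.
  rewrite IH ?rem_uniq //; congr (_ %:R); congr nat_of_bool.
  by rewrite [RHS](permPr (perm_to_rem dt)) perm_cons.
transitivity (Tr rho (fun=> 0)).
  by apply: (Tl_ext oW W0) => y _; rewrite pd_yprod // (negPf ndt).
rewrite /Tr Tl_cst0 (_ : perm_eq _ _ = false) //; apply/negP => /perm_mem/(_ d).
by rewrite mem_head (negPf ndt).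
Qed.

End LogarithmicExpansion.

(** * Invertibility of the matrix at a point *)

Section Perturbation.
Variables (R : realType) (m l : nat) (eps : R).
Variables (U : set 'M[R[i]]_(m.+1, l.+1)) (lg : 'M[R[i]]_(m.+1, l.+1) -> 'M[R[i]]_(m.+1, l.+1)).
Local Notation C := R[i].
Local Notation X := ('M[C]_(m.+1, l.+1)).
Local Notation V := ('M[C]_(m, l)).
Local Notation I := ('I_m * 'I_l)%type.
Local Notation Mz := ('M[int]_(m.+1, l.+1)).
Local Notation n := #|{: I}|.
Hypotheses (eps0 : 0 < eps) (oU : open U) (cU : U `<=` conv_domain eps)
  (hlg : log_branch U lg).
Implicit Types (x : X) (y : V) (s rho sigma tau : seq I) (a : I) (u : Mz).
Local Notation lam := (lam lg).
Local Notation words := (@index_words m l).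

Let oW := @Wball_open R m l.
Let W0 := @Wball0 R m l.

Definition gword tau : Mz -> V -> C := cword tau (@gm R m l 0).

(** At most n factors s_a + c_a(u), for u of degree N, give (n + 1)^n (N + 1)^n. By [pow_le_exp2]
    the second power is at most n! 2^n 2^N, and the 2^N goes into [gword_rate]. *)
Definition gword_const : R := ((n.+1 ^ n) * (n`! * 2 ^ n))%:R.
Definition gword_rate : R := 2 * Kcoef R m l n.

Lemma gword_const_ge0 : 0 <= gword_const. Proof. exact: ler0n. Qed.
Lemma gword_rate_ge0 : 0 <= gword_rate.
Proof. by rewrite mulr_ge0 // (le_trans ler01) ?Kcoef_ge1. Qed.

Lemma Tn_coord s a : Tn s (fun y : V => y a.1 a.2) <= (size s)%:R.
Proof.
have E (y : V) : y a.1 a.2 = linform (delta_mx a.1 a.2 : V) y.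
  rewrite /linform (bigD1 a) //= mxE !eqxx mul1r big1 ?addr0 // => k nk.
  rewrite mxE; case: a k nk => a1 a2 [k1 k2] /=; rewrite xpair_eqE /=.
  by case: (k1 == a1) => /= [/negPf->|_]; rewrite mul0r.
rewrite (_ : (fun y : V => y a.1 a.2) = linform (delta_mx a.1 a.2)); last exact: funext.
rewrite -[leRHS]mulr1; apply: Tn_lin => d; rewrite mxE.
by case: (_ && _); rewrite ?cabs0 ?cabs_nat.
Qed.

Lemma hol_coord a : hol (@Wball R m l) (fun y => y a.1 a.2).
Proof. by move=> k; exact: smooth_coord. Qed.

Lemma Tn_gword rho tau u : (size rho <= n)%N -> (size tau <= n)%N -> cone u ->
  Tn rho (gword tau u) <= gword_const * gword_rate ^+ mdeg (@cdeg m l) u.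
Proof.
move=> rn tn cu; set N := mdeg _ u.
have -> : gword tau u = fun y => \prod_(a <- tau) (y a.1 a.2 + (cdeg u a)%:R) * acoef u y.
  by apply: funext => y; rewrite /gword cwordE /gm mem_set // subr0.
have hF a : hol (@Wball R m l) (fun y => y a.1 a.2 + (cdeg u a)%:R).
  exact: (holD oW (hol_coord a) (hol_cst _ _)).
have [hP TP] := Tn_prod oW W0 rho tau hF.
have hA := @hol_acoef R m l u.
apply: le_trans (TnM oW W0 rho hP hA) _.
have F1 a : Tn rho (fun y : V => y a.1 a.2 + (cdeg u a)%:R) <= (n.+1 * N.+1)%:R.
  apply: le_trans (TnD oW W0 rho (hol_coord a) (hol_cst _ _)) _.
  rewrite Tn_cst cabs_nat.
  apply: le_trans (lerD (Tn_coord rho a) (lexx _)) _.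
  rewrite -natrD ler_nat.
  have : (cdeg u a <= N)%N by rewrite /N /mdeg (bigD1 a) //= leq_addr.
  by move: rn; clear; nia.
have F2 : Tn rho (fun y : V => \prod_(a <- tau) (y a.1 a.2 + (cdeg u a)%:R)) <=
    (n.+1 ^ n * (n`! * 2 ^ n) * 2 ^ N)%:R.
  apply: le_trans TP _.
  apply: le_trans (_ : \prod_(a <- tau) (n.+1 * N.+1)%:R <= _).
    by apply: ler_prod => a _; rewrite Tn_ge0 F1.
  rewrite big_const_seq count_predT iter_mulr_1 -natrX ler_nat.
  apply: leq_trans (_ : (n.+1 * N.+1) ^ n <= _)%N.
    exact: leq_pexp2l.
  rewrite expnMn -mulnA leq_mul //; exact: pow_le_exp2.
have := Tn_acoef R rn cu; rewrite -/N => F3.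
apply: le_trans (ler_pM (Tn_ge0 _ _) (Tn_ge0 _ _) F2 F3) _.
by rewrite natrM natrX /gword_const /gword_rate exprMn mulrA.
Qed.

Definition Qser rho tau x : C := csum (fun u => xpow u x * Tr rho (gword tau u)).

(** For u of degree N > 0 the term is at most C (q/2)^N <= C q 2^(-N), where C is [gword_const], q =
    2 [gword_rate] eps and q <= 1; the sum of the 2^(-N) over the cone is at most 2^n. *)
Definition delta : R := gword_const * (2 * gword_rate * eps) * 2 ^+ n.

Hypotheses (smallK : 4 * (Kcoef R m l n * eps) <= 1) (small3 : 2 * gword_rate * eps <= 1).

Lemma Fam_gword s tau : (size s <= n)%N -> Fam eps (size s) (gword tau).
Proof.
move=> sn; have hF := FamW sn (Fam_gm0 eps0 smallK).
exact: (Fam_cword eps0 cU hlg tau hF).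
Qed.

Lemma lamnorm0 s : lamnorm (fun=> 0 : C) s = 1.
Proof. by rewrite /lamnorm big1 // => d _; rewrite cabs0 addr0. Qed.

(* The term at u = 0 gives the Kronecker symbol; the other terms are O(eps). *)
Lemma Qser_approx rho tau x : (size rho <= n)%N -> (size tau <= n)%N -> uniq tau -> U x ->
  cabs (Qser rho tau x - (perm_eq rho tau)%:R) <= delta.
Proof.
move=> rn tn ut Ux.
have as_ := Tl_summable eps0 cU hlg (fun=> 0) (Fam_gword tau rn) Ux.
have T0 : xpow 0 x * Tr rho (gword tau 0) = (perm_eq rho tau)%:R.
  rewrite xpow0 mul1r -(Tr_yprod oW W0 rho ut); congr Tr; apply: funext => y.
  rewrite /gword cwordE /gm mem_set ?subr0; last exact: cone0.
  rewrite [acoef 0 y]big1 ?mulr1.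
    by apply: eq_bigr => a _; rewrite (_ : cdeg 0 a = 0%N) ?addr0 // /cdeg
      /corner big1 // => i _; rewrite big1 // => j _; rewrite mxE.
  by move=> d _; rewrite mxE /phi /= !big_ord0 invr1 mulr1.
rewrite /Qser (csum_single 0 as_) T0 addrAC subrr add0r; apply: csum_le => F.
set N := mdeg (@cdeg m l).
have P0 : 0 <= 2 * gword_rate * eps.
  by apply: mulr_ge0; [apply: mulr_ge0 => //; exact: gword_rate_ge0|exact: ltW].
have K20 := gword_const_ge0; have P1 := mulr_ge0 K20 P0.
have B u : cabs (if u == 0 then 0 else xpow u x * Tr rho (gword tau u)) <=
    if u \in @cone m l then gword_const * (2 * gword_rate * eps) * 2^-1 ^+ N u else 0.
  have [cu|ncu] := boolP (u \in @cone m l); last first.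
    rewrite (_ : gword tau u = fun=> 0); first by rewrite /Tr Tl_cst0 mulr0; case: eqP; rewrite cabs0.
    by apply: funext => y; rewrite /gword cwordE /gm (negPf ncu) mulr0.
  have [_|u0] := eqVneq u 0.
    by rewrite cabs0; apply: mulr_ge0; rewrite ?exprn_ge0.
  have Np : (0 < N u)%N by apply: mdeg_gt0 => //; exact: set_mem.
  rewrite cabsM; apply: le_trans (ler_pM (cabs_ge0 _) (cabs_ge0 _)
    (cabs_xpow_le eps0 cU hlg (set_mem cu) Ux) (Tl_le _ _ _)) _.
  rewrite lamnorm0 mul1r.
  have e0 : 0 <= eps ^+ N u by rewrite exprn_ge0 // ltW.
  apply: le_trans (ler_wpM2l e0 (Tn_gword rn tn (set_mem cu))) _.
  rewrite -/N mulrCA -mulrA ler_wpM2l // -exprMn.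
  have -> : eps * gword_rate = (2 * gword_rate * eps) * 2^-1 by field.
  rewrite exprMn ler_wpM2r ?exprn_ge0 //.
  rewrite -(prednK Np) exprS ler_piMr // exprn_ile1 //.
apply: le_trans (ler_sum _ (fun u _ => B u)) _.
rewrite -big_mkcond -mulr_sumr /delta -/N ler_wpM2l //.
rewrite -big_filter; apply: cone_geometric => //.
  by rewrite filter_uniq // fset_uniq.
by move=> u; rewrite mem_filter => /andP[/set_mem].
Qed.

Definition Emx x tau sigma : C := ew tau (dF lg sigma) x.

Lemma word_size s : s \in words -> (size s <= n)%N.
Proof. by rewrite mem_index_words; exact: sigma_index_size. Qed.

(** The matrix factors through the subwords: one factor consists of series without logarithms, the
    other of polynomials in the logarithms. *)
Lemma Emx_splits x tau sigma : sigma \in words -> U x ->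
  Emx x tau sigma = \sum_(p <- splits (rev sigma)) lprod (lam x) p.2 * Qser p.1 tau x.
Proof.
move=> sw Ux; have sn := word_size sw; rewrite mem_index_words in sw.
rewrite -size_rev in sn.
have hF := Fam_gword [::] sn.
rewrite /Emx (ew_ext oU tau (fun (z : X) Uz => dF_eq lg sw Uz) Ux).
rewrite (ew_Ser eps0 oU cU hlg tau hF Ux) -/(gword tau).
(* The guard on the length makes every [f p] summable, as [csum_sum] requires. *)
pose f (p : seq I * seq I) u : C := if (size p.1 <= n)%N then
  lprod (lam x) p.2 * (xpow u x * Tr p.1 (gword tau u)) else 0.
have pn p : p \in splits (rev sigma) -> (size p.1 <= n)%N.
  by move=> /splits_subseq/size_subseq h; exact: leq_trans h sn.
have fa p : asum (f p).
  rewrite /f; case h: (size p.1 <= n)%N; last exact: asum0.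
  exact: asumZ (Tl_summable eps0 cU hlg (fun=> 0) (Fam_gword tau h) Ux).
have [_ E] := csum_sum (splits (rev sigma)) fa.
transitivity (csum (fun u => \sum_(p <- splits (rev sigma)) f p u)).
  congr csum; apply: funext => u; rewrite Tl_splits mulr_sumr.
  by apply: eq_big_seq => p ps; rewrite /f (pn p ps) mulrCA.
rewrite E; apply: eq_big_seq => p ps; rewrite -csumZ.
  by congr csum; apply: funext => u; rewrite /f (pn p ps).
exact: (Tl_summable eps0 cU hlg (fun=> 0) (Fam_gword tau (pn p ps)) Ux).
Qed.

Lemma perm_words rho tau : rho \in words -> tau \in words ->
  perm_eq (rev rho) tau = (rho == tau).
Proof.
rewrite !mem_index_words => hr ht; rewrite perm_rev.
apply/idP/eqP => [pe|->//]; apply: irr_sorted_eq hr ht _.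
- by move=> b a c /= /andP[h1 h2] /andP[h3 h4]; rewrite (ltn_trans h1) // (ltn_trans h4).
- by move=> a; rewrite /= ltnn.
- exact: perm_mem.
Qed.

Lemma words_uniq : uniq words. Proof. exact: undup_uniq. Qed.

(** Index words are closed under subwords, so both factors of the matrix are square over the same
    index set. *)
Lemma words_subseq s sigma : sigma \in words -> subseq s (rev sigma) -> rev s \in words.
Proof.
rewrite !mem_index_words => hs ss; apply: subseq_sorted hs.
  by move=> b a c /= /andP[h1 h2] /andP[h3 h4]; rewrite (ltn_trans h1) // (ltn_trans h4).
by rewrite -[sigma]revK subseq_rev.
Qed.

Section Invertibility.
Variable x : X.
Hypotheses (Ux : U x) (smallD : (size words)%:R * delta <= 2^-1).

Definition dcoef (c : seq I -> C) rho : C := \sum_(sigma <- words) c sigma *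
  \sum_(p <- splits (rev sigma) | p.1 == rev rho) lprod (lam x) p.2.

Lemma Emx_dcoef c tau : \sum_(sigma <- words) c sigma * Emx x tau sigma =
  \sum_(rho <- words) Qser (rev rho) tau x * dcoef c rho.
Proof.
under [RHS]eq_bigr do rewrite mulr_sumr.
rewrite exchange_big /=; apply: eq_big_seq => sigma sw.
rewrite Emx_splits // mulr_sumr.
transitivity (\sum_(p <- splits (rev sigma)) \sum_(rho <- words | p.1 == rev rho)
   c sigma * (lprod (lam x) p.2 * Qser p.1 tau x)).
  apply: eq_big_seq => p ps.
  have rw := words_subseq sw (splits_subseq ps).
  have E : [seq rho <- words | p.1 == rev rho] = [:: rev p.1].
    rewrite -(@filter_pred1_uniq _ words (rev p.1) words_uniq rw).
    by apply: eq_filter => rho /=; rewrite -(inj_eq (can_inj (@revK I))) revK eq_sym.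
  by rewrite -big_filter E big_seq1.
rewrite (exchange_big_dep xpredT) //=; apply: eq_bigr => rho _.
rewrite mulr_sumr mulr_sumr; apply: eq_bigr => p /eqP->.
by rewrite [RHS]mulrCA; congr (_ * _); rewrite mulrC.
Qed.

(** The factor without logarithms is within [delta] of the identity, entry by entry. The sum D of
    the moduli then satisfies D <= D / 2. *)
Lemma dcoef_eq0 c : (forall tau, tau \in words -> \sum_(sigma <- words) c sigma * Emx x tau sigma = 0) ->
  forall rho, rho \in words -> dcoef c rho = 0.
Proof.
move=> H; pose D := \sum_(rho <- words) cabs (dcoef c rho).
have dD rho : rho \in words -> cabs (dcoef c rho) <= D.
  move=> rw; rewrite /D (big_rem rho) //= lerDl sumr_ge0 // => s _; exact: cabs_ge0.
have D0 : 0 <= D by rewrite sumr_ge0 // => s _; exact: cabs_ge0.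
have dl tau : tau \in words -> cabs (dcoef c tau) <= delta * D.
  move=> tw; have := H tau tw; rewrite Emx_dcoef.
  have E : \sum_(rho <- words) (perm_eq (rev rho) tau)%:R * dcoef c rho = dcoef c tau.
    rewrite (bigD1_seq tau) ?words_uniq //= perm_words // eqxx mul1r big_seq_cond.
    rewrite big1 ?addr0 // => rho /andP[rw ne]; rewrite perm_words // (negPf ne) mul0r.
    by [].
  move=> Z; rewrite -cabsN -[- _]addr0 -[in X in _ + X]Z -E addrC -sumrB.
  apply: le_trans (cabs_sum _ _ _) _; rewrite mulr_sumr big_seq [leRHS]big_seq.
  apply: ler_sum => rho rw; rewrite -mulrBl cabsM ler_wpM2r ?cabs_ge0 //.
  apply: Qser_approx => //; first by rewrite size_rev word_size.
    exact: word_size.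
  by rewrite mem_index_words in tw; case: (sigma_antichain tw).
have : D <= 2^-1 * D.
  apply: le_trans (_ : \sum_(rho <- words) delta * D <= _).
    by rewrite {1}/D big_seq [leRHS]big_seq; apply: ler_sum => s; exact: dl.
  rewrite big_const_seq count_predT iter_addr_0 -[leLHS]mulr_natl mulrA.
  exact: ler_wpM2r.
move=> h; have {h} D00 : D = 0 by lra.
move=> rho rw; apply/eqP; rewrite -cabs_eq0 eq_le cabs_ge0 andbT -D00; exact: dD.
Qed.

(** The logarithmic factor is unitriangular for the length of words; the coefficients are eliminated
    from the longest words downwards. *)
Lemma Emx_inj c : (forall tau, tau \in words -> \sum_(sigma <- words) c sigma * Emx x tau sigma = 0) ->
  forall sigma, sigma \in words -> c sigma = 0.
Proof.
move=> /dcoef_eq0 d0.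
suff H k : forall sigma, sigma \in words -> (n - size sigma < k)%N -> c sigma = 0.
  by move=> sigma sw; exact: (H _ sigma sw (ltnSn _)).
elim: k => // k IH sigma sw sk; have := d0 sigma sw; rewrite /dcoef.
rewrite (bigD1_seq sigma) ?words_uniq //= splits_top // eqxx mulr1.
rewrite big_seq_cond big1 ?addr0 // => t /andP[tw ne].
have [ts|st] := leqP (size t) (size sigma).
  rewrite splits_top ?size_rev // (inj_eq (can_inj (@revK I))) (negPf ne) mulr0.
  by [].
rewrite IH ?mul0r //.
exact: leq_trans (ltn_sub2l (leq_trans st (word_size tw)) st) sk.
Qed.

Lemma Emx_solve (v : seq I -> C) :
  exists c, forall tau, tau \in words -> \sum_(sigma <- words) c sigma * Emx x tau sigma = v tau.
Proof.
pose N := size words; pose wd (i : 'I_N) := nth [::] words i.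
(* Rows are indexed by sigma, so that a row vector times M is a combination of the series;
   injectivity on rows makes the square matrix invertible. *)
pose M : 'M[C]_N := \matrix_(j, i) Emx x (wd i) (wd j).
have wdw i : wd i \in words by exact: mem_nth.
have wdK s (sw : s \in words) : exists i, s = wd i.
  have si : (index s words < N)%N by rewrite index_mem.
  by exists (Ordinal si); rewrite /wd nth_index.
pose ext (r : 'rV[C]_N) s : C := \sum_(j < N | wd j == s) r 0 j.
have extE r j : ext r (wd j) = r 0 j.
  rewrite /ext (big_pred1 j) // => i /=.
  by rewrite /wd nth_uniq ?words_uniq.
have MulE (r : 'rV[C]_N) i : (r *m M) 0 i = \sum_(sigma <- words) ext r sigma * Emx x (wd i) sigma.
  rewrite mxE (big_nth [::]) big_mkord; apply: eq_bigr => j _.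
  by rewrite mxE -/(wd j) extE.
have Mu : M \in unitmx.
  rewrite -row_free_unit; apply: inj_row_free => r r0; apply/rowP => j.
  rewrite mxE -extE; apply: Emx_inj (wdw j) => tau /wdK[i ->].
  by rewrite -MulE r0 mxE.
exists (ext ((\row_i v (wd i)) *m invmx M)) => tau /wdK[i ->].
by rewrite -MulE mulmxKV // mxE.
Qed.

End Invertibility.

End Perturbation.

(** * The basis *)

Section Linearity.
Variables (R : realType) (m l : nat) (U : set 'M[R[i]]_(m.+1, l.+1)).
Local Notation C := R[i].
Local Notation X := ('M[C]_(m.+1, l.+1)).
Local Notation I := ('I_m * 'I_l)%type.
Local Notation J := ('I_m.+1 * 'I_l.+1)%type.
Local Notation hol := (hol U).
Hypothesis oU : open U.
Implicit Types (x y : X) (f g : X -> C) (c : C).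

Lemma pd_lincomb (d : J) f g c x : hol f -> hol g -> U x ->
  pd d (fun y => f y + c * g y) x = pd d f x + c * pd d g x.
Proof.
move=> hf hg Ux; have Df := hol_diff hf Ux; have Dg := hol_diff hg Ux.
have Dc : differentiable (fun y => c * g y) x.
  by apply: differentiableM; [exact: differentiable_cst|exact: Dg].
by rewrite (pdD d Df Dc) (pdZ _ _ Dg).
Qed.

Lemma hol_lincomb f g c : hol f -> hol g -> hol (fun y => f y + c * g y).
Proof. by move=> hf hg; exact: (holD oU hf (holZ oU c hg)). Qed.

Lemma ew0 (w : seq I) x : ew w (fun=> 0 : C) x = 0.
Proof.
rewrite (_ : ew w _ = fun=> 0) //; elim: w => //= a w ->; apply: funext => y.
by rewrite /et big1 // => d _; rewrite /th pd_cst mulr0.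
Qed.

Lemma ew_lincomb (w : seq I) f g c x : hol f -> hol g -> U x ->
  ew w (fun y => f y + c * g y) x = ew w f x + c * ew w g x.
Proof.
move=> hf hg; elim: w x => // a w IH x Ux.
rewrite [LHS]/= (et_ext oU a IH Ux) /= /et mulr_sumr -big_split /=.
apply: eq_bigr => d _; rewrite /th.
rewrite (pd_lincomb d c (hol_ew oU w hf) (hol_ew oU w hg) Ux) mulrDr.
by rewrite [x d.1 d.2 * (c * _)]mulrCA.
Qed.

Lemma wact_ext P f g : (forall y, U y -> f y = g y) ->
  forall y, U y -> wact P f y = wact P g y.
Proof.
elim: P f g => [e|i j|i j|P1 IH1 P2 IH2|P1 IH1 P2 IH2] f g E y Uy.
- by rewrite /= E.
- by rewrite /= E.
- by rewrite !wact_Wd (pd_ext (i, j) oU Uy E).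
- by rewrite /= (IH1 f g E y Uy) (IH2 f g E y Uy).
- by rewrite /=; apply: IH1 => // z Uz; exact: IH2.
Qed.

Lemma hol_wact P f : hol f -> hol (wact P f).
Proof.
elim: P f => [e|i j|i j|P1 IH1 P2 IH2|P1 IH1 P2 IH2] f hf.
- exact: (holZ oU e hf).
- by apply: (holM oU) => // k; exact: smooth_coord.
- by rewrite wact_Wd; exact: hol_pd.
- exact: (holD oU (IH1 f hf) (IH2 f hf)).
- exact: IH1 _ (IH2 f hf).
Qed.

Lemma wact_lincomb P f g c x : hol f -> hol g -> U x ->
  wact P (fun y => f y + c * g y) x = wact P f x + c * wact P g x.
Proof.
elim: P f g x => [e|i j|i j|P1 IH1 P2 IH2|P1 IH1 P2 IH2] f g x hf hg Ux.
- by rewrite /= mulrDr [e * (c * _)]mulrCA.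
- by rewrite /= mulrDr [x i j * (c * _)]mulrCA.
- by rewrite !wact_Wd pd_lincomb.
- by rewrite /= IH1 // IH2 // mulrDr addrACA.
- rewrite /= (wact_ext P1 (g := fun y => wact P2 f y + c * wact P2 g y) _ Ux); last first.
    by move=> z Uz; exact: IH2.
  by apply: IH1 => //; exact: hol_wact.
Qed.

Lemma solution_lincomb f g c : solution_on U f -> solution_on U g ->
  solution_on U (fun y => f y + c * g y).
Proof.
move=> [/holomorphic_onP hf sf] [/holomorphic_onP hg sg]; split.
  apply/holomorphic_onP; exact: hol_lincomb.
by move=> P HP x Ux; rewrite wact_lincomb // sf // sg // mulr0 addr0.
Qed.

Lemma solution_sum (T : eqType) (S : seq T) (c : T -> C) (F : T -> X -> C) f :
  solution_on U f -> (forall t, t \in S -> solution_on U (F t)) ->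
  solution_on U (fun y => f y + \sum_(t <- S) c t * F t y) /\
  forall w x, U x -> ew w (fun y => f y + \sum_(t <- S) c t * F t y) x =
    ew w f x + \sum_(t <- S) c t * ew w (F t) x.
Proof.
move=> sf; elim: S => [|t S IH] sF.
  rewrite (_ : (fun y => _) = f); last by apply: funext => y; rewrite big_nil addr0.
  by split=> // w x _; rewrite big_nil addr0.
have [IH1 IH2] := IH (fun t' h => sF t' (mem_behead (s := t :: S) h)).
have st := sF t (mem_head _ _).
rewrite (_ : (fun y => _) = fun y => (f y + \sum_(t <- S) c t * F t y) + c t * F t y); last first.
  by apply: funext => y; rewrite big_cons addrA addrAC.
split=> [|w x Ux]; first exact: solution_lincomb.
have [/holomorphic_onP h1 _] := IH1; have [/holomorphic_onP h2 _] := st.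
by rewrite ew_lincomb // IH2 // big_cons -addrA [_ + c t * _]addrC.
Qed.

Lemma solution0 : solution_on U (fun=> 0).
Proof.
split; first by apply/holomorphic_onP => n; exact: smooth_cst.
by move=> P _ x Ux; apply: (wact0 P oU).
Qed.

End Linearity.

Lemma exists_small (R : realType) (s : seq R) : (forall k, k \in s -> 0 <= k) ->
  exists2 eps : R, 0 < eps & forall k, k \in s -> k * eps <= 1.
Proof.
move=> s0; have S0 : 0 <= \sum_(k <- s) k by rewrite big_seq sumr_ge0.
have S1 : 0 < 1 + \sum_(k <- s) k by rewrite ltr_wpDr.
exists (1 + \sum_(k <- s) k)^-1; first by rewrite invr_gt0.
move=> k ks; rewrite ler_pdivrMr // mul1r (big_rem k) //= addrCA lerDl addr_ge0 //.
rewrite big_seq sumr_ge0 // => e /mem_rem; exact: s0.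
Qed.

Section Basis.
Variables (R : realType) (m l : nat) (eps : R).
Variables (U : set 'M[R[i]]_(m.+1, l.+1)) (lg : 'M[R[i]]_(m.+1, l.+1) -> 'M[R[i]]_(m.+1, l.+1)).
Local Notation C := R[i].
Local Notation I := ('I_m * 'I_l)%type.
Local Notation words := (@index_words m l).
Hypotheses (eps0 : 0 < eps) (oU : open U) (cU : U `<=` conv_domain eps)
  (hlg : log_branch U lg) (cnU : connected U).
Hypotheses (smallK : 4 * (Kcoef R m l #|{: I}| * eps) <= 1)
  (small3 : 2 * gword_rate R m l * eps <= 1)
  (smallD : (size words)%:R * delta m l eps <= 2^-1)
  (smallC : Gsum_const R m l * bad_const R m l * eps <= 2^-1).

Lemma sigma_Fam (sigma : seq I) : sigma_index sigma -> Fam eps (size sigma) (@gm R m l 0).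
Proof. by move=> /sigma_index_size h; exact: FamW h (Fam_gm0 eps0 smallK). Qed.

Lemma dF_sol (sigma : seq I) : sigma_index sigma -> solution_on U (dF lg sigma).
Proof. by move=> si; exact: dF_solution eps0 oU cU hlg _ (sigma_Fam si) si. Qed.

Lemma dF_free z (S : seq (seq I)) (c : seq I -> C) : U z -> uniq S -> all (@sigma_index m l) S ->
  (forall x, U x -> \sum_(i <- S) c i * dF lg i x = 0) -> forall i, i \in S -> c i = 0.
Proof.
move=> Uz uS /allP aS H.
(* Extension by 0 to all index words, the index set of the matrix. *)
pose c' s := if s \in S then c s else 0.
suff K s : s \in words -> c' s = 0.
  by move=> s sS; have := K s; rewrite mem_index_words /c' sS; apply; exact: aS.
apply: (Emx_inj eps0 oU cU hlg smallK small3 Uz smallD) => tau tw.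
have [sol E] := solution_sum oU c (solution0 oU) (fun t ts => dF_sol (aS t ts)).
have := E tau z Uz; rewrite (ew_ext oU tau (g := fun=> 0) _ Uz); last first.
  by move=> y Uy; rewrite add0r H.
rewrite ew0 add0r => E1; rewrite [RHS]E1.
transitivity (\sum_(s <- words | s \in S) c s * Emx lg z tau s).
  by rewrite [RHS]big_mkcond; apply: eq_bigr => t _; rewrite /c'; case: ifP; rewrite ?mul0r.
rewrite -big_filter; apply: perm_big; apply: uniq_perm => //.
  by rewrite filter_uniq // words_uniq.
move=> t; rewrite mem_filter mem_index_words.
by case tS: (t \in S) => //=; exact: aS.
Qed.

(** The coefficients are chosen to match the values eta^tau f at z for all antichains tau; the
    difference is a solution that vanishes by uniqueness. *)
Lemma dF_span z f : U z -> solution_on U f -> exists (S : seq (seq I)) (c : seq I -> C),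
  all (@sigma_index m l) S /\ forall x, U x -> f x = \sum_(i <- S) c i * dF lg i x.
Proof.
move=> Uz sf.
have [c Hc] := Emx_solve eps0 oU cU hlg smallK small3 Uz smallD (fun tau => ew tau f z).
exists words, c; split; first by apply/allP => s; rewrite mem_index_words.
have sw t : t \in words -> solution_on U (dF lg t).
  by rewrite mem_index_words; exact: dF_sol.
have [[/holomorphic_onP hg sg] E] := solution_sum oU (fun t => - c t) sf sw.
move=> x Ux.
have x0 y i j : U y -> y i j != 0 by move=> Uy; exact: (log_branch_neq0 hlg).
have g0 := solution_unique oU x0 hg cU eps0 sg smallC cnU Uz _ Ux.
apply/eqP; rewrite -subr_eq0 -[X in _ == X]g0.
  by rewrite -sumrN; under [X in _ == _ + X]eq_bigr do rewrite mulNr.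
move=> tau tw; rewrite E // -(Hc tau tw) -big_split big1 // => t _ /=.
by rewrite mulNr subrr.
Qed.

End Basis.

Theorem corollary5p5 (R : realType) (m l : nat) (w : 'M[R]_(m.+1, l.+1))
  (w_generic : generic_weight w)
  (w_order : forall (i p : 'I_m.+1) (j q : 'I_l.+1),
     (i, j) != (p, q) -> (i <= p)%N -> (j <= q)%N -> w p q < w i j) :
  exists2 eps : R, 0 < eps &
    forall (U : set 'M[R[i]]_(m.+1, l.+1))
      (lg : 'M[R[i]]_(m.+1, l.+1) -> 'M[R[i]]_(m.+1, l.+1)),
      U !=set0 -> open U -> connected U ->
      U `<=` conv_domain eps -> log_branch U lg ->
      (forall sigma x, sigma_index sigma -> U x ->
         summable [set: 'M[int]_(m.+1, l.+1)]
           (fun u => (complex.Re `|dFterm lg sigma x u|)%:E)) /\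
      basis_on U (solution_on U) (@sigma_index m l) (dF lg).
Proof.
pose n := #|{: 'I_m * 'I_l}|; pose K1 := Kcoef R m l n.
pose K2 := gword_const R m l; pose K3 := gword_rate R m l; pose N : R := (size (index_words m l))%:R.
pose CB := Gsum_const R m l * bad_const R m l.
have K10 : 0 <= K1 by rewrite (le_trans ler01) ?Kcoef_ge1.
have K20 : 0 <= K2 by exact: gword_const_ge0.
have K30 : 0 <= K3 by exact: gword_rate_ge0.
have N0 : 0 <= N by exact: ler0n.
have CB0 : 0 <= CB by apply: mulr_ge0; [exact: Gsum_const_ge0|exact: bad_const_ge0].
have P0 : 0 <= 2 ^+ n :> R by rewrite exprn_ge0.
(* Four constraints on eps, in this order: summability of the coefficient families, decay of the
   terms with u different from 0, invertibility of the matrix at a point, and absorption in the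
   uniqueness estimate. *)
have [|eps eps0 he] := @exists_small R
    [:: 4 * K1; 2 * K3; 2 * (N * (K2 * (2 * K3) * 2 ^+ n)); 2 * CB].
  move=> k; rewrite !inE => /or4P[]/eqP->; rewrite mulr_ge0 // !mulr_ge0 //.
have e1 : 4 * (K1 * eps) <= 1 by rewrite mulrA he // !inE eqxx.
have e2 : 2 * K3 * eps <= 1 by rewrite he // !inE eqxx ?orbT.
have e3 : N * delta m l eps <= 2^-1.
  have : 2 * (N * (K2 * (2 * K3) * 2 ^+ n)) * eps <= 1 by rewrite he // !inE eqxx ?orbT.
  rewrite /delta -/K2 -/K3 -/n => h.
  rewrite -[leRHS]mulr1 ler_pdivlMl //; apply: le_trans h.
  by rewrite le_eqVlt; apply/orP; left; apply/eqP; ring.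
have e4 : CB * eps <= 2^-1.
  have : 2 * CB * eps <= 1 by rewrite he // !inE eqxx ?orbT.
  by rewrite -mulrA -[2^-1]mulr1 => h; rewrite ler_pdivlMl.
exists eps => // U lg [z Uz] oU cnU cU hlg; split=> [sigma x si Ux|].
  have hF := sigma_Fam eps0 e1 si; exact: (dF_summable eps0 cU hlg hF si Ux).
split=> [sigma si|S c uS aS|f sf].
- exact: (dF_sol eps0 oU cU hlg e1 si).
- exact: (dF_free eps0 oU cU hlg e1 e2 e3 Uz uS aS).
- exact: (dF_span eps0 oU cU hlg cnU e1 e2 e3 e4 Uz sf).
Qed.
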